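(* Let $n\in\{1,2\}$ and let $\Omega\subset\mathbb{R}^n$ be a bounded convex domain with smooth boundary. Suppose that $\phi\in C^1([0,\infty))\cap C^3((0,\infty))$ is such that $\phi(0)=0$, $\phi'(0)>0$ and $\phi>0$ on $(0,\infty)$, and let $u_0\in W^{1,\infty}(\Omega)$ be nonnegative with $u_0\not\equiv const.$ Then for all $K>0$ there exists $\delta(K)>0$ with the property that whenever $v_0\in W^{1,\infty}(\Omega)$ is nonnegative with $\sqrt{v_0}\in W^{1,2}(\Omega)$ and such that $$0<\|v_0\|_{L^\infty(\Omega)}\le K\qquad\text{and}\qquad\int_\Omega v_0\le\delta(K),$$ the large time limit $u_\infty$ (that is, the function $u_\infty\in\bigcap_{p\ge1}L^p(\Omega)$ with $u(\cdot,t)\rightharpoonup u_\infty$ in $L^p(\Omega)$ for all $p\ge1$ as $t\to\infty$) of the first component of the global solution $(u,v)$, obtained by the approximation procedure described in the context, of $$u_t=\Delta\big(u\phi(v)\big),\quad v_t=\Delta v-uv\ \text{ in }\Omega\times(0,\infty),\qquad \frac{\partial u}{\partial\nu}=\frac{\partial v}{\partial\nu}=0\ \text{ on }\partial\Omega\times(0,\infty),$$ with $u(\cdot,0)=u_0$ and $v(\cdot,0)=v_0$, satisfies $$u_\infty\not\equiv const.$$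
   Context: $\nu$ is the outward unit normal on $\partial\Omega$; $\rightharpoonup$ and $\stackrel{\star}{\rightharpoonup}$ denote weak and weak-$\star$ convergence. $C^{2,1}$ refers to functions twice continuously differentiable in $x$ and once in $t$. The solution: for $\varepsilon\in(0,1)$ let $(u_\varepsilon,v_\varepsilon)$ be the global classical solution (which the paper shows to exist) of the regularized problem $$u_{\varepsilon t}=\varepsilon\Delta u_\varepsilon+\Delta\big(u_\varepsilon\phi(v_\varepsilon)\big),\quad v_{\varepsilon t}=\Delta v_\varepsilon-u_\varepsilon v_\varepsilon\ \text{ in }\Omega\times(0,\infty),\quad \frac{\partial u_\varepsilon}{\partial\nu}=\frac{\partial v_\varepsilon}{\partial\nu}=0\ \text{ on }\partial\Omega\times(0,\infty),$$ $u_\varepsilon(\cdot,0)=u_0$, $v_\varepsilon(\cdot,0)=v_0$, with $u_\varepsilon\in C^0(\overline\Omega\times[0,\infty))\cap C^{2,1}(\overline\Omega\times(0,\infty))$, $v_\varepsilon\in\bigcap_{q\ge1}C^0([0,\infty);W^{1,q}(\Omega))\cap C^{2,1}(\overline\Omega\times(0,\infty))$, $u_\varepsilon\ge0$ and $v_\varepsilon>0$ in $\overline\Omega\times(0,\infty)$. The paper shows that there exist a sequence $\varepsilon_j\searrow0$ in $(0,1)$ and functions $u\in C^{2,1}(\overline\Omega\times(0,\infty))$ and $v\in C^0(\overline\Omega\times[0,\infty))\cap C^{2,1}(\overline\Omega\times(0,\infty))$, both positive in $\overline\Omega\times(0,\infty)$, such that as $\varepsilon=\varepsilon_j\searrow0$: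 $u_\varepsilon\to u$ in $C^{2,1}_{loc}(\overline\Omega\times(0,\infty))$; $u_\varepsilon\rightharpoonup u$ in $L^p_{loc}(\overline\Omega\times[0,\infty))$ for all $p\ge1$; $v_\varepsilon\to v$ in $C^0_{loc}(\overline\Omega\times[0,\infty))$ and in $C^{2,1}_{loc}(\overline\Omega\times(0,\infty))$; $\nabla v_\varepsilon\stackrel{\star}{\rightharpoonup}\nabla v$ in $L^\infty(\Omega\times(0,\infty))$. The pair $(u,v)$ satisfies $u_t=\Delta\big(u\phi(v)\big)$ and $v_t=\Delta v-uv$ classically in $\Omega\times(0,\infty)$ and $\frac{\partial u}{\partial\nu}=\frac{\partial v}{\partial\nu}=0$ on $\partial\Omega\times(0,\infty)$, with $v(\cdot,0)=v_0$ and $u(\cdot,t)\rightharpoonup u_0$ in $L^p(\Omega)$ for all $p\ge1$ as $t\searrow0$. ''The solution $(u,v)$'' refers to such a limit. The paper also shows that the limit $u_\infty$ exists for every such solution, is nonnegative, and satisfies $\int_\Omega u_\infty=\int_\Omega u_0$. *)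

(* Defs.v *)
From HB Require Import structures.
From mathcomp Require Import all_boot all_order all_algebra.
From mathcomp Require Import all_classical all_reals all_analysis.

Set Implicit Arguments.
Unset Strict Implicit.
Unset Printing Implicit Defensive.

Import Order.TTheory GRing.Theory Num.Theory.
Import numFieldNormedType.Exports.

Local Open Scope classical_set_scope.
Local Open Scope ring_scope.

(* R^n is 'rV[R]_n with the sigma-algebra generated by the coordinates, that is
   the Borel sigma-algebra. *)
Section measurable_rV.
Context (R : realType) (n : nat).

Let coors : 'I_n -> 'rV[R]_n -> R := fun i x => x ord0 i.

Let rV_set0 : g_sigma_preimage coors set0.
Proof. exact: sigma_algebra0. Qed.

Let rV_setC A : g_sigma_preimage coors A -> g_sigma_preimage coors (~` A).
Proof. exact: sigma_algebraC. Qed.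

Let rV_bigcup (F : _^nat) : (forall i, g_sigma_preimage coors (F i)) ->
  g_sigma_preimage coors (\bigcup_i (F i)).
Proof. exact: sigma_algebra_bigcup. Qed.

HB.instance Definition _ :=
  @isMeasurable.Build default_measure_display
    'rV[R]_n (g_sigma_preimage coors) rV_set0 rV_setC rV_bigcup.

End measurable_rV.

Lemma measurable_coord (R : realType) n (i : 'I_n) :
  measurable_fun [set: 'rV[R]_n] (fun x : 'rV[R]_n => x ord0 i).
Proof.
move=> _ Y mY; rewrite setTI; apply: sub_sigma_algebra => /=.
rewrite -bigcup_seq/=; exists i => /=; first by rewrite mem_index_enum.
by exists Y => //; rewrite setTI.
Qed.

Lemma measurable_fun_coordP (R : realType) n d (T : measurableType d)
    (f : T -> 'rV[R]_n) :
  (forall i, measurable_fun [set: T] (fun t => f t ord0 i)) ->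
  measurable_fun [set: T] f.
Proof.
move=> mf; apply: (@measurability _ _ _ _ _ _
  (\big[setU/set0]_(i < n) preimage_set_system setT
     (fun x : 'rV[R]_n => x ord0 i) measurable)) => //.
move=> _ [B + <-]; rewrite -bigcup_seq => -[i /= _ [C mC <-]].
by rewrite setTI; have := mf i measurableT C mC; rewrite !setTI.
Qed.

Section lebesgue_rV.
Context (R : realType).

Definition rV_cons n (z : R * 'rV[R]_n) : 'rV[R]_n.+1 :=
  \row_(i < n.+1) if unlift ord0 i is Some j then z.2 ord0 j else z.1.

Lemma measurable_rV_cons n : measurable_fun [set: R * 'rV[R]_n] (@rV_cons n).
Proof.
apply: measurable_fun_coordP => i; case: (unliftP ord0 i) => [j|] ->.
- rewrite (_ : (fun _ => _) = (fun x : 'rV[R]_n => x ord0 j) \o snd); last first.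
    by apply/funext => z /=; rewrite mxE liftK.
  by apply: measurableT_comp => //; exact: measurable_coord.
- rewrite (_ : (fun _ => _) = fst); last first.
    by apply/funext => z /=; rewrite mxE unlift_none.
  exact: measurable_fst.
Qed.

Definition rV_uncons n (x : 'rV[R]_n.+1) : R * 'rV[R]_n :=
  (x ord0 ord0, \row_(j < n) x ord0 (lift ord0 j)).

Lemma rV_consK n : cancel (@rV_cons n) (@rV_uncons n).
Proof.
move=> [a y]; rewrite /rV_uncons /rV_cons mxE unlift_none; congr pair.
by apply/rowP => j; rewrite !mxE liftK.
Qed.

Lemma measurable_rV_uncons n : measurable_fun [set: 'rV[R]_n.+1] (@rV_uncons n).
Proof.
apply: measurable_fun_pair; first exact: measurable_coord.
apply: measurable_fun_coordP => j.
rewrite (_ : (fun _ => _) = (fun x : 'rV[R]_n.+1 => x ord0 (lift ord0 j))).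
  exact: measurable_coord.
by apply/funext => x; rewrite mxE.
Qed.

Section lebesgue_rV_step.
Variables (n : nat) (mu : {sigma_finite_measure set 'rV[R]_n -> \bar R}).

Definition lebesgue_rV_step : set 'rV[R]_n.+1 -> \bar R :=
  pushforward (@lebesgue_measure R \x mu)%E (@rV_cons n).

Let step0 : lebesgue_rV_step set0 = 0%E.
Proof. by apply: measure0; exact: measurable_rV_cons. Qed.

Let step_ge0 A : (0 <= lebesgue_rV_step A)%E.
Proof. by apply: measure_ge0; exact: measurable_rV_cons. Qed.

Let step_sigma_additive : semi_sigma_additive lebesgue_rV_step.
Proof.
by apply: measure_semi_sigma_additive; exact: measurable_rV_cons.
Qed.

HB.instance Definition _ := isMeasure.Build _ _ _ lebesgue_rV_step
  step0 step_ge0 step_sigma_additive.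

Let step_sigma_finite : sigma_finite setT lebesgue_rV_step.
Proof.
have /sigma_finiteP[F [FT ndF Foo]] := sigma_finiteT (@lebesgue_measure R).
have /sigma_finiteP[G [GT ndG Goo]] := sigma_finiteT mu.
exists (fun k => @rV_uncons n @^-1` (F k `*` G k)).
  apply/seteqP; split => // x _.
  have [i _ Fi] : (\bigcup_i F i) (x ord0 ord0) by rewrite -FT.
  have [j _ Gj] : (\bigcup_i G i) (rV_uncons x).2 by rewrite -GT.
  exists (maxn i j) => //; split => /=.
    by move: Fi; exact/subsetPset/ndF/leq_maxl.
  by move: Gj; exact/subsetPset/ndG/leq_maxr.
move=> k; have [mF Fk] := Foo k; have [mG Gk] := Goo k; split.
  rewrite -[X in measurable X]setTI; apply: measurable_rV_uncons => //.
  exact: measurableX.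
rewrite /lebesgue_rV_step /pushforward -comp_preimage.
rewrite (_ : _ \o _ = id) ?preimage_id; last first.
  by apply/funext => z /=; rewrite rV_consK.
by rewrite product_measure1E// lte_mul_pinfty// ge0_fin_numE.
Qed.

HB.instance Definition _ := Measure_isSigmaFinite.Build _ _ _ lebesgue_rV_step
  step_sigma_finite.

End lebesgue_rV_step.

Fixpoint lebesgue_rV n : {sigma_finite_measure set 'rV[R]_n -> \bar R} :=
  if n is m.+1 then lebesgue_rV_step (lebesgue_rV m)
  else @dirac _ 'rV[R]_0 0 R.

End lebesgue_rV.
Arguments lebesgue_rV {R} n.

Section Lebesgue_spaces.
Context d (T : measurableType d) (R : realType).
Variables (mu : {measure set T -> \bar R}) (D : set T).

(* f \_ D is f on D and 0 outside D, so this is the norm of L^p(D). *)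
Definition normLp (p : \bar R) (f : T -> R) : \bar R :=
  Lnorm mu p (EFin \o (f \_ D)).

Definition inLp (p : \bar R) (f : T -> R) : Prop :=
  measurable_fun D f /\ (normLp p f < +oo)%E.

(* Meant for 1 <= p < oo, when the dual of L^p(D) is L^p'(D), p' conjugate to p. *)
Definition weakLp_cvg (p : R) (I : Type) (F : set_system I)
    (f : I -> T -> R) (g : T -> R) : Prop :=
  [/\ \forall i \near F, inLp p%:E (f i),
      inLp p%:E g &
      forall psi, inLp (hoelder_conjugate p%:E) psi ->
        \int[mu]_(x in D) (f i x * psi x) @[i --> F] -->
        \int[mu]_(x in D) (g x * psi x)].

(* L^oo(D) as the dual of L^1(D) *)
Definition weakstar_cvg (I : Type) (F : set_system I)
    (f : I -> T -> R) (g : T -> R) : Prop :=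
  [/\ \forall i \near F, inLp +oo%E (f i),
      inLp +oo%E g &
      forall psi, inLp 1%E psi ->
        \int[mu]_(x in D) (f i x * psi x) @[i --> F] -->
        \int[mu]_(x in D) (g x * psi x)].

Definition ae_const (f : T -> R) : Prop :=
  exists c, {ae mu, forall x, D x -> f x = c}.

End Lebesgue_spaces.

Section classical.
Context (R : realType) (n : nat).
Implicit Types (Omega U : set 'rV[R]_n) (w : 'rV[R]_n -> R).

Definition unit_vec (i : 'I_n) : 'rV[R]_n := delta_mx ord0 i.

Definition pderiv (i : 'I_n) w : 'rV[R]_n -> R := 'D_(unit_vec i) w.

Definition iter_pderiv (s : seq 'I_n) w : 'rV[R]_n -> R := foldr pderiv w s.

Definition smooth_on U w : Prop := forall (s : seq 'I_n) x, U x ->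
  {for x, continuous (iter_pderiv s w)} /\
  forall i, derivable (iter_pderiv s w) x (unit_vec i).

Definition grad w (x : 'rV[R]_n) : 'rV[R]_n := \row_i pderiv i w x.

Definition frontier Omega : set 'rV[R]_n :=
  closure Omega `&` closure (~` Omega).

(* On the neighbourhood U of x, Omega is the sublevel set {rho < 0} of a smooth
   function without critical points. *)
Definition local_defining Omega (x : 'rV[R]_n) U (rho : 'rV[R]_n -> R) : Prop :=
  [/\ open U, U x, smooth_on U rho,
      forall y, U y -> grad rho y != 0 &
      forall y, U y -> (Omega y <-> rho y < 0)].

Definition smooth_boundary Omega : Prop :=
  forall x, frontier Omega x -> exists U rho, local_defining Omega x U rho.

Definition outward_unit_normal Omega (x nu : 'rV[R]_n) : Prop :=
  \sum_i nu ord0 i ^+ 2 = 1 /\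
  exists U rho, local_defining Omega x U rho /\
    exists2 c : R, 0 < c & nu = c *: grad rho x.

Record bounded_convex_smooth_domain Omega : Prop := {
  domain_nonempty : Omega !=set0 ;
  domain_open : open Omega ;
  domain_bounded : bounded_set Omega ;
  domain_convex : @convex_set R 'rV[R]_n Omega ;
  domain_smooth : smooth_boundary Omega }.

End classical.

Section Sobolev.
Context (R : realType) (n : nat) (Omega : set 'rV[R]_n).
Local Notation mu := (@lebesgue_rV R n).

Definition test_function (psi : 'rV[R]_n -> R) : Prop :=
  smooth_on setT psi /\
  exists K, [/\ compact K, K `<=` Omega & forall x, ~ K x -> psi x = 0].

Definition weak_gradient (f : 'rV[R]_n -> R) (G : 'I_n -> 'rV[R]_n -> R) :=
  forall i psi, test_function psi ->
    \int[mu]_(x in Omega) (f x * pderiv i psi x) =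
    - \int[mu]_(x in Omega) (G i x * psi x).

Definition W1p_with (p : \bar R) (f : 'rV[R]_n -> R)
    (G : 'I_n -> 'rV[R]_n -> R) : Prop :=
  [/\ inLp mu Omega p f, forall i, inLp mu Omega p (G i) & weak_gradient f G].

Definition W1p (p : \bar R) (f : 'rV[R]_n -> R) : Prop :=
  exists G, W1p_with p f G.

(* C^0([0,oo); W^{1,q}(Omega)); G is the weak spatial gradient of f. *)
Definition C0_W1q (q : R) (f : 'rV[R]_n * R -> R) : Prop :=
  exists G : 'I_n -> 'rV[R]_n * R -> R,
    (forall t, 0 <= t ->
      W1p_with q%:E (fun x => f (x, t)) (fun i x => G i (x, t))) /\
    forall s, 0 <= s ->
      normLp mu Omega q%:E (fun x => f (x, t) - f (x, s))
        @[t --> within `[0, +oo[ (nbhs s)] --> 0%E /\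
      forall i, normLp mu Omega q%:E (fun x => G i (x, t) - G i (x, s))
        @[t --> within `[0, +oo[ (nbhs s)] --> 0%E.

End Sobolev.

Section space_time.
Context (R : realType) (n : nat) (Omega : set 'rV[R]_n).
Implicit Types (u : 'rV[R]_n * R -> R).

Definition dx (i : 'I_n) u : 'rV[R]_n * R -> R :=
  fun z => pderiv i (fun x => u (x, z.2)) z.1.

Definition dt u : 'rV[R]_n * R -> R := fun z => derive1 (fun t => u (z.1, t)) z.2.

Definition laplacian u : 'rV[R]_n * R -> R :=
  fun z => \sum_i dx i (dx i u) z.

(* the sets written Omega x (0,oo), closure Omega x (0,oo) and
   closure Omega x [0,oo) *)
Definition cyl : set ('rV[R]_n * R) := Omega `*` `]0, +oo[.
Definition cylx : set ('rV[R]_n * R) := closure Omega `*` `]0, +oo[.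
Definition cylxt : set ('rV[R]_n * R) := closure Omega `*` `[0, +oo[.

Definition extends_to_cylx (g : 'rV[R]_n * R -> R) : Prop :=
  exists h : 'rV[R]_n * R -> R,
    {within cylx, continuous h} /\ forall z, cyl z -> g z = h z.

(* u in C^{2,1}(closure Omega x (0,oo)): the derivatives exist in the open
   cylinder and extend continuously up to the lateral boundary. *)
Definition C21 u : Prop :=
  [/\ {within cylx, continuous u},
      forall z, cyl z ->
        [/\ derivable (fun t => u (z.1, t)) z.2 1,
            forall i, derivable (fun x => u (x, z.2)) z.1 (unit_vec R i) &
            forall i j,
              derivable (fun x => dx j u (x, z.2)) z.1 (unit_vec R i)],
      extends_to_cylx (dt u),
      forall i, extends_to_cylx (dx i u) &
      forall i j, extends_to_cylx (dx i (dx j u))].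

(* On the boundary, grad u is the continuous extension of its values in Omega. *)
Definition normal_derivative u (nu x : 'rV[R]_n) (t : R) : R :=
  \sum_i nu ord0 i * lim (dx i u (y, t) @[y --> within Omega (nbhs x)]).

Definition neumann u : Prop :=
  forall x nu t, frontier Omega x -> outward_unit_normal Omega x nu -> 0 < t ->
    normal_derivative u nu x t = 0.

Definition C0_loc_cvg (E : set ('rV[R]_n * R)) (f : nat -> 'rV[R]_n * R -> R)
    (g : 'rV[R]_n * R -> R) : Prop :=
  (forall j, {within E, continuous (f j)}) /\
  forall K, compact K -> K `<=` E -> {uniform K, f @ \oo --> g}.

(* Derivatives are compared at the points of the open cylinder in K; for
   K = closure Omega x [a,b], continuity makes this the comparison of the
   extended derivatives on all of K. *)
Definition C21_loc_cvg (f : nat -> 'rV[R]_n * R -> R)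
    (g : 'rV[R]_n * R -> R) : Prop :=
  C0_loc_cvg cylx f g /\
  forall K, compact K -> K `<=` cylx ->
    [/\ {uniform K `&` cyl, (fun j => dt (f j)) @ \oo --> dt g},
        forall i, {uniform K `&` cyl, (fun j => dx i (f j)) @ \oo --> dx i g} &
        forall i k, {uniform K `&` cyl,
          (fun j => dx i (dx k (f j))) @ \oo --> dx i (dx k g)}].

Definition space_time_measure :
    {measure set ('rV[R]_n * measurableTypeR R) -> \bar R} :=
  (@lebesgue_rV R n \x @lebesgue_measure R)%E.

(* L^p_loc(closure Omega x [0,oo)): every compact subset of closure Omega x [0,oo)
   lies in closure Omega x [0,T] for some T. *)
Definition weakLp_loc_cvg (p : R) (f : nat -> 'rV[R]_n * R -> R)
    (g : 'rV[R]_n * R -> R) : Prop :=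
  forall T : R, 0 < T ->
    weakLp_cvg space_time_measure (Omega `*` `]0, T[) p \oo f g.

End space_time.

Section phi.
Context (R : realType) (phi : R -> R).

(* Only the values of phi on [0,oo) matter; at 0 this is the right derivative. *)
Definition deriv0y (x : R) : R :=
  lim ((phi y - phi x) / (y - x) @[y --> within `[0, +oo[ x^']).

Record admissible_phi : Prop := {
  phi_derivable : forall x, 0 <= x ->
    cvg ((phi y - phi x) / (y - x) @[y --> within `[0, +oo[ x^']) ;
  phi_C1 : {within `[0, +oo[, continuous deriv0y} ;
  phi_derivable3 : forall (k : nat) x, (k < 3)%N -> 0 < x ->
    derivable (derive1n k phi) x 1 ;
  phi_C3 : forall x, 0 < x -> {for x, continuous (derive1n 3 phi)} ;
  phi_at0 : phi 0 = 0 ;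
  phi_deriv_at0 : 0 < deriv0y 0 ;
  phi_gt0 : forall x, 0 < x -> 0 < phi x }.

End phi.

Section system.
Context (R : realType) (n : nat) (Omega : set 'rV[R]_n) (phi : R -> R).
Local Notation mu := (@lebesgue_rV R n).
Local Notation field := ('rV[R]_n * R -> R).

(* Initial data are classes of functions modulo equality a.e. *)
Definition initial_value (u : field) (u0 : 'rV[R]_n -> R) : Prop :=
  {ae mu, forall x, Omega x -> u (x, 0) = u0 x}.

Record regularized_solution (u0 v0 : 'rV[R]_n -> R) (eps : R) (u v : field) :
    Prop := {
  reg_u_C0 : {within cylxt Omega, continuous u} ;
  reg_u_C21 : C21 Omega u ;
  reg_v_C0 : forall q : R, 1 <= q -> C0_W1q Omega q v ;
  reg_v_C21 : C21 Omega v ;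
  reg_u_ge0 : forall z, cylx Omega z -> 0 <= u z ;
  reg_v_gt0 : forall z, cylx Omega z -> 0 < v z ;
  reg_eq_u : forall z, cyl Omega z ->
    dt u z = eps * laplacian u z + laplacian (fun y => u y * phi (v y)) z ;
  reg_eq_v : forall z, cyl Omega z -> dt v z = laplacian v z - u z * v z ;
  reg_neumann_u : neumann Omega u ;
  reg_neumann_v : neumann Omega v ;
  reg_init_u : initial_value u u0 ;
  reg_init_v : initial_value v v0 }.

(* (u, v) is the limit of the solutions (ue e, ve e) of the regularized problems
   along some sequence e = eps j decreasing to 0. *)
Definition approximation_limit (u0 v0 : 'rV[R]_n -> R) (u v : field) : Prop :=
  exists (ue ve : R -> field) (eps : nat -> R),
    (forall e, 0 < e < 1 -> regularized_solution u0 v0 e (ue e) (ve e)) /\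
    [/\ forall j, 0 < eps j < 1, nonincreasing_seq eps & eps @ \oo --> 0] /\
    [/\ C21_loc_cvg Omega (ue \o eps) u,
        forall p : R, 1 <= p -> weakLp_loc_cvg Omega p (ue \o eps) u,
        C0_loc_cvg (cylxt Omega) (ve \o eps) v,
        C21_loc_cvg Omega (ve \o eps) v &
        forall i, weakstar_cvg (space_time_measure R n) (cyl Omega) \oo
          (fun j => dx i (ve (eps j))) (dx i v)].

Record global_solution (u0 v0 : 'rV[R]_n -> R) (u v : field) : Prop := {
  sol_u_C21 : C21 Omega u ;
  sol_v_C0 : {within cylxt Omega, continuous v} ;
  sol_v_C21 : C21 Omega v ;
  sol_u_gt0 : forall z, cylx Omega z -> 0 < u z ;
  sol_v_gt0 : forall z, cylx Omega z -> 0 < v z ;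
  sol_approx : approximation_limit u0 v0 u v ;
  sol_eq_u : forall z, cyl Omega z ->
    dt u z = laplacian (fun y => u y * phi (v y)) z ;
  sol_eq_v : forall z, cyl Omega z -> dt v z = laplacian v z - u z * v z ;
  sol_neumann_u : neumann Omega u ;
  sol_neumann_v : neumann Omega v ;
  sol_init_u : forall p : R, 1 <= p ->
    weakLp_cvg mu Omega p 0^'+ (fun t x => u (x, t)) u0 ;
  sol_init_v : initial_value v v0 }.

Definition large_time_limit (u : field) (uoo : 'rV[R]_n -> R) : Prop :=
  forall p : R, 1 <= p ->
    weakLp_cvg mu Omega p +oo (fun t x => u (x, t)) uoo.

End system.

(* Main.v *)
Require Import Defs.
From mathcomp Require Import all_boot all_order all_algebra.
From mathcomp Require Import all_classical all_reals all_analysis.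
From mathcomp Require Import measurable_realfun ess_sup_inf hoelder ring lra.

(** Fix a twice continuously differentiable [psi] with compact support in
    [Omega] and zero mean such that m = \int u0 psi is nonzero; it exists because
    u0 is not constant ([nonconst_test]).  Put X(t) = \int u(.,t) psi.  If the
    limit of u were a constant, X(t) would tend to 0, whereas X starts from m.  So
    it suffices that X drifts by at most |m|/2 over all times ([moment_drift_le]),
    and this is where the smallness of \int v0 enters: with |Delta psi| <= B,
    |X'| <= B \int u phi(v) ([moment_rate]), and since phi vanishes linearly at 0,
    the last integral is controlled by the consumption rate \int u v of the second
    component, whose integral over all times is at most \int v0.

    The constant in phi(v) <= C v must depend on K only, but a solution is merely
    known to be bounded on each time interval, its data being below K.  The mass of
    v is therefore replaced by the convex energy Y(t) = \int H(v(.,t)), where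
    H(s) = C s + L max(s - K, 0)^4.  Here C serves the values v <= K + 1, and L,
    chosen after the solution and the time interval, serves the larger ones, so
    that phi(v) <= H'(v) v throughout; yet Y(0) = C \int v0, whatever L is.
    Convexity of H and the Neumann condition give Y' <= - \int u phi(v)
    ([energy_rate]), so that B Y + X and B Y - X are nonincreasing, and the drift of
    X up to any time is at most B Y(0) = B C \int v0.

    The Neumann condition enters through \int div(H'(v) grad v) = 0, that is,
    through the divergence theorem for a field F whose normal component vanishes on
    the boundary ([divergence_tangential]).  It is obtained without boundary
    integrals.  Finitely many supporting hyperplanes give a cutoff chi with compact
    support in [Omega], equal to 1 outside a thin layer ([cutoff]), and
    \int chi div F = - \int F . grad chi.  In the layer, grad chi is a negative
    combination of normals of hyperplanes that are close to the point, and F is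
    almost orthogonal to these: by compactness this follows from the limit case,
    where the hyperplane touches the boundary and its normal has to be the outward
    normal, the boundary being smooth ([almost_tangential]).  Hence
    |F . grad chi| <= kappa (x0 - x) . grad chi for an interior point x0 and a small
    kappa, and the right-hand side integrates to kappa n \int chi <= kappa n |Omega|
    ([Rintegral_cutoff_div]), however thin the layer is.

    The same cutoffs, with half-spaces {x_i > b_i} added to the list, approximate the
    indicators of [Omega] intersected with orthants, which yields the fundamental
    lemma of the calculus of variations behind [nonconst_test]. *)

Set Implicit Arguments.
Unset Strict Implicit.
Unset Printing Implicit Defensive.

Import Order.TTheory GRing.Theory Num.Theory.
Import numFieldNormedType.Exports.

Local Open Scope classical_set_scope.
Local Open Scope ring_scope.

(** * Borel sets and Lebesgue measure of R^n *)

Lemma ball_rVP (R : realType) (n : nat) (x y : 'rV[R]_n) (e : R) : 0 < e ->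
  ball x e y <-> forall i, `|x ord0 i - y ord0 i| < e.
Proof.
move=> e0; split=> [[_ xy] i|xy]; first exact: xy.
by split=> // i j; rewrite (ord1 i); exact: xy.
Qed.

(** The sigma-algebra of R^n is generated by the coordinates, whereas open sets are
    unions of boxes: rational boxes make the union countable. *)
Lemma open_measurable_rV (R : realType) (n : nat) (U : set 'rV[R]_n) :
  open U -> measurable U.
Proof.
move=> oU.
pose B (qk : 'rV[rat]_n * nat) : set 'rV[R]_n :=
  [set y | forall i, `|ratr (qk.1 ord0 i) - y ord0 i| < qk.2.+1%:R^-1].
have -> : U = \bigcup_qk (if `[< B qk `<=` U >] then B qk else set0).
  apply/seteqP; split => [x Ux|x [qk _]]; last by case: asboolP => // BU Bx; exact: BU.
  have /nbhs_ballP[e /= e0 eU] : nbhs x U by exact: open_nbhs_nbhs.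
  have [k ke] : exists k : nat, k.+1%:R^-1 < e / 2 :> R.
    have e20 : 0 < e / 2 by rewrite divr_gt0.
    have [k _ kP] := near_infty_natSinv_lt (PosNum e20).
    by exists k; apply: kP => /=.
  have kS0 : 0 < k.+1%:R^-1 :> R by rewrite invr_gt0.
  have qx i : exists q : rat, `|ratr q - x ord0 i| < k.+1%:R^-1 :> R.
    have lt_c : x ord0 i - k.+1%:R^-1 < x ord0 i + k.+1%:R^-1.
      by rewrite ltrBlDr -addrA ltrDl addr_gt0.
    have [q] := rat_in_itvoo lt_c.
    rewrite in_itv/= => /andP[q1 q2]; exists q.
    by rewrite ltr_distl q1 q2.
  pose q : 'rV[rat]_n := \row_i projT1 (cid (qx i)).
  have qP i : `|ratr (q ord0 i) - x ord0 i| < k.+1%:R^-1 :> R.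
    by rewrite mxE; exact: projT2 (cid (qx i)).
  exists (q, k) => //; case: asboolP => [_|[]]; first exact: qP.
  move=> y /= By; apply: eU; apply/ball_rVP => // i.
  move: (qP i) (By i) ke => /=; move: (_^-1) (ratr _) => c b.
  by rewrite !ltr_norml => /andP[? ?] /andP[? ?] ?; apply/andP; split; lra.
apply: countable_bigcupT_measurable => // qk; case: ifP => // _.
have -> : B qk = \bigcap_(i in [set: 'I_n])
    ((fun y => `|ratr (qk.1 ord0 i) - y ord0 i|) @^-1` `]-oo, qk.2.+1%:R^-1[).
  apply/seteqP; split => [y By i _ /=|y By i].
    by rewrite in_itv/=; exact: By.
  by have := By i I; rewrite /= in_itv.
apply: fin_bigcap_measurable => // i _.
have mf : measurable_fun setT (fun y : 'rV[R]_n => `|ratr (qk.1 ord0 i) - y ord0 i|).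
  apply: measurableT_comp => //; apply: measurable_funB => //.
  exact: measurable_coord.
by rewrite -[X in measurable X]setTI; exact: mf.
Qed.

Lemma continuous_on_open_measurable (R : realType) (n : nat) (D : set 'rV[R]_n)
    (f : 'rV[R]_n -> R) :
  open D -> (forall x, D x -> {for x, continuous f}) -> measurable_fun D f.
Proof.
move=> oD cf; apply: (measurability _ (RGenOInfty.measurableE R)).
move=> _ [_ [a ->] <-]; apply: open_measurable_rV.
rewrite openE => x [Dx]; rewrite /= in_itv/= andbT => afx.
apply: filterI; first exact: open_nbhs_nbhs.
near=> y; rewrite /= in_itv/= andbT; near: y.
exact: (cf x Dx _ (open_nbhs_nbhs (conj (@open_gt R a) afx))).
Unshelve. all: by end_near. Qed.

Definition cube (R : realType) (n : nat) (M : R) : set 'rV[R]_n :=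
  [set x | forall i, `|x ord0 i| <= M].
Arguments cube {R} n M.

Lemma measurable_cube (R : realType) (n : nat) (M : R) : measurable (cube n M).
Proof.
have -> : cube n M = \bigcap_(i in [set: 'I_n])
    ((fun y : 'rV[R]_n => `|y ord0 i|) @^-1` `]-oo, M]).
  apply/seteqP; split => [y By i _ /=|y By i].
    by rewrite in_itv/=; exact: By.
  by have := By i I; rewrite /= in_itv.
apply: fin_bigcap_measurable => // i _.
rewrite -[X in measurable X]setTI.
have mf : measurable_fun setT (fun y : 'rV[R]_n => `|y ord0 i|).
  by apply: measurableT_comp => //; exact: measurable_coord.
exact: mf.
Qed.

Lemma lebesgue_rV_cube_lty (R : realType) (n : nat) (M : R) :
  (lebesgue_rV n (cube n M) < +oo)%E.
Proof.
elim: n => [|n IHn].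
  by rewrite /= diracE; case: (_ \in _); exact: ltry.
rewrite /= /lebesgue_rV_step /pushforward.
have -> : @rV_cons R n @^-1` cube n.+1 M = `[-M, M] `*` cube n M.
  apply/seteqP; split => [[a y] /= H|[a y] /= [H1 H2] i].
    split=> [|i].
      by have := H ord0; rewrite /rV_cons mxE unlift_none /= ler_norml in_itv.
    by have := H (lift ord0 i); rewrite mxE liftK.
  rewrite /rV_cons mxE; case: (unliftP ord0 i) => [j _|_]; first exact: H2.
  by rewrite /= ler_norml; move: H1; rewrite in_itv.
rewrite product_measure1E//=; last exact: measurable_cube.
rewrite lte_mul_pinfty // lebesgue_measure_itv/=.
by case: ifP => // _; exact: ltry.
Qed.

Lemma bounded_set_cube (R : realType) (n : nat) (A : set 'rV[R]_n) :
  bounded_set A -> exists2 M : R, 0 < M & A `<=` cube n M.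
Proof.
move=> [M [_ HM]]; exists (`|M| + 1); first by rewrite ltr_wpDl.
move=> x Ax i.
have xM : `|x| <= `|M| + 1.
  by apply: HM Ax; rewrite (le_lt_trans (ler_norm M)) ?ltrDl.
apply: le_trans xM; rewrite [leRHS]/Num.norm /= mx_normrE.
by apply: le_trans (le_bigmax_cond _ _ (j := (ord0, i)) _).
Qed.

Lemma lebesgue_rV_bounded_lty (R : realType) (n : nat) (A : set 'rV[R]_n) :
  measurable A -> bounded_set A -> (lebesgue_rV n A < +oo)%E.
Proof.
move=> mA /bounded_set_cube[M _ AM].
apply: le_lt_trans (@lebesgue_rV_cube_lty R n M).
by apply: le_measure; rewrite ?inE//; exact: measurable_cube.
Qed.

Lemma bounded_continuous_integrable (R : realType) (n : nat)
    (D : set 'rV[R]_n) (f : 'rV[R]_n -> R) (M : R) :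
  open D -> bounded_set D -> (forall x, D x -> {for x, continuous f}) ->
  (forall x, D x -> `|f x| <= M) ->
  (lebesgue_rV n).-integrable D (EFin \o f).
Proof.
move=> oD bD cf fM; have mD := open_measurable_rV oD.
apply: measurable_bounded_integrable => //.
- exact: lebesgue_rV_bounded_lty.
- exact: continuous_on_open_measurable.
- exists M; split; first exact: num_real.
  by move=> N MN x Dx /=; apply: le_trans (fM x Dx) (ltW MN).
Qed.

(** * Integrals of partial derivatives with compact support *)

Lemma unit_vec_cons_head (R : realType) (n : nat) (h a : R) (y : 'rV[R]_n) :
  h *: unit_vec R ord0 + rV_cons (a, y) = rV_cons (h + a, y).
Proof.
apply/rowP => i; rewrite /unit_vec /rV_cons !mxE/=.
case: (unliftP ord0 i) => [j ->|->]; rewrite ?liftK ?unlift_none/=.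
  by rewrite mulr0 add0r.
by rewrite mulr1.
Qed.

Lemma unit_vec_cons_tail (R : realType) (n : nat) (h a : R) (y : 'rV[R]_n) (i : 'I_n) :
  h *: unit_vec R (lift ord0 i) + rV_cons (a, y) =
  rV_cons (a, h *: unit_vec R i + y).
Proof.
apply/rowP => k; rewrite /unit_vec /rV_cons !mxE/=.
case: (unliftP ord0 k) => [j ->|->]; rewrite ?liftK ?unlift_none/=.
  by rewrite !mxE (inj_eq (@lift_inj _ ord0)) ?eqxx.
by rewrite mulr0 add0r.
Qed.

Lemma rV_cons_continuousl (R : realType) (n : nat) (y : 'rV[R]_n) :
  continuous (fun a : R => rV_cons (a, y)).
Proof.
move=> a A /nbhs_ballP[e /= e0 eA]; apply/nbhs_ballP; exists e => //= b ab.
apply: eA; apply/ball_rVP => // i; rewrite !mxE/=.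
by case: (unliftP ord0 i) => [j _|_] //=; rewrite subrr normr0.
Qed.

Lemma rV_cons_continuousr (R : realType) (n : nat) (a : R) :
  continuous (fun y : 'rV[R]_n => rV_cons (a, y)).
Proof.
move=> y A /nbhs_ballP[e /= e0 eA]; apply/nbhs_ballP; exists e => //= z yz.
apply: eA; apply/ball_rVP => // i; rewrite !mxE/=.
case: (unliftP ord0 i) => [j _|_] //=; last by rewrite subrr normr0.
by move/ball_rVP : yz; exact.
Qed.

Lemma compact_cube (R : realType) (n : nat) (M : R) : compact (cube n M).
Proof.
have := @rV_compact R n (fun=> `[- M, M]%classic) (fun=> @segment_compact _ _ _).
rewrite (_ : [set v | _] = cube n M)//.
by apply/seteqP; split => x /= xM i; have := xM i; rewrite in_itv/= ler_norml.
Qed.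

Lemma continuous_cpt_support_integrable (R : realType) (n : nat)
    (f : 'rV[R]_n -> R) (M : R) :
  continuous f -> (forall x, ~ cube n M x -> f x = 0) ->
  (lebesgue_rV n).-integrable setT (EFin \o f).
Proof.
move=> cf f0.
have mf : measurable_fun setT f.
  by apply: continuous_on_open_measurable; [exact: openT|move=> x _; exact: cf].
have : (lebesgue_rV n).-integrable (cube n M) (EFin \o f).
  apply: measurable_bounded_integrable.
  - exact: measurable_cube.
  - exact: lebesgue_rV_cube_lty.
  - exact: measurable_funTS.
  - have /compact_bounded[N [Nr HN]] : compact (f @` cube n M).
      apply: continuous_compact; last exact: compact_cube.
      exact: continuous_subspaceT.
    by exists N; split => // e Ne x Ax; apply: HN Ne _ _; exists x.
move/(integrable_mkcond _ (@measurable_cube R n M)).1.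
apply: eq_integrable => // x _; rewrite patchE; case: ifPn => //.
by rewrite notin_setE => /f0 /= ->.
Qed.

(** Lebesgue measure on R^(n+1) is the image of the product of the line and R^n
    under [rV_cons], so Fubini applies to the first coordinate in either order. *)
Section Fubini_rV.
Context (R : realType) (n : nat) (f : 'rV[R]_n.+1 -> R).
Hypothesis fint : (lebesgue_rV n.+1).-integrable setT (EFin \o f).

Local Notation mu := (@lebesgue_measure R \x lebesgue_rV n)%E.

(* the same map, on the product where the line carries the display of
   [lebesgue_measure] *)
Let mcons : measurable_fun [set: measurableTypeR R * 'rV[R]_n] (@rV_cons R n).
Proof. by move=> _ Y mY; have := @measurable_rV_cons R n measurableT Y mY. Qed.

Let mf : measurable_fun setT (EFin \o f). Proof. exact: measurable_int fint. Qed.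

Let integrable_uncons : mu.-integrable setT ((EFin \o f) \o @rV_cons R n).
Proof.
apply/integrableP; split.
  by apply: measurableT_comp => //; exact: measurable_rV_cons.
have /integrableP[_] := fint.
rewrite /= /lebesgue_rV_step ge0_integral_pushforward ?preimage_setT//.
by apply/measurable_EFinP/measurableT_comp => //; exact/measurable_EFinP.
Qed.

Let integral_uncons :
  (\int[lebesgue_rV n.+1]_x (f x)%:E = \int[mu]_z (f (rV_cons z))%:E)%E.
Proof.
rewrite /= /lebesgue_rV_step.
exact: (integral_pushforward mcons mf integrable_uncons measurableT).
Qed.

Lemma integral_lebesgue_rVS12 :
  (\int[lebesgue_rV n.+1]_x (f x)%:E =
   \int[lebesgue_measure]_a \int[lebesgue_rV n]_y (f (rV_cons (a, y)))%:E)%E.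
Proof.
rewrite integral_uncons -(integral12_prod_meas1 integrable_uncons)//.
Qed.

Lemma integral_lebesgue_rVS21 :
  (\int[lebesgue_rV n.+1]_x (f x)%:E =
   \int[lebesgue_rV n]_y \int[lebesgue_measure]_a (f (rV_cons (a, y)))%:E)%E.
Proof.
rewrite integral_uncons -(integral21_prod_meas1 integrable_uncons)//.
Qed.

End Fubini_rV.

Lemma integral_derive1_cpt_support (R : realType) (g : R -> R) (M : R) :
  0 < M -> (forall a, derivable g a 1) -> continuous (derive1 g) ->
  (forall a, ~ `|a| <= M -> g a = 0) ->
  (\int[lebesgue_measure]_a (derive1 g a)%:E = 0)%E.
Proof.
move=> M0 dg cg g0.
have g'0 a : ~ `|a| <= M -> derive1 g a = 0.
  move=> /negP; rewrite -ltNge => aM; rewrite derive1E.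
  rewrite (@near_eq_derive _ _ _ _ (cst 0)) ?derive_cst//.
  near=> b; apply: g0; apply/negP; rewrite -ltNge; near: b.
  have cn : {for a, continuous (fun b : R => `|b|)} by exact: norm_continuous.
  exact: (cn _ (open_nbhs_nbhs (conj (@open_gt R M) aM))).
have gM : g (M + 1) = 0.
  by apply: g0; apply/negP; rewrite -ltNge ger0_norm ?ltrDl// addr_ge0// ltW.
have gNM : g (- (M + 1)) = 0.
  by apply: g0; apply/negP; rewrite -ltNge normrN ger0_norm ?ltrDl// addr_ge0// ltW.
have cont_g : continuous g.
  by move=> a; apply: differentiable_continuous; exact/derivable1_diffP.
pose I : set R := `[- (M + 1), M + 1]%classic.
have FTC : (\int[lebesgue_measure]_(a in I) (derive1 g a)%:E = 0)%E.
  rewrite (@continuous_FTC2 R (derive1 g) g (- (M + 1)) (M + 1)) ?gM ?gNM ?sube0//.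
  - by rewrite gtrN// addr_gt0.
  - exact: continuous_subspaceT.
  - split=> //; first exact: cvg_at_right_filter (cont_g _).
    exact: cvg_at_left_filter (cont_g _).
rewrite -FTC integral_mkcond [RHS]integral_mkcond.
apply: eq_integral => a _; rewrite !patchE in_setT.
case: ifPn => //; rewrite notin_setE /I/= in_itv/= -ler_norml => aM.
rewrite g'0// => aM'; apply: aM; apply: le_trans aM' _; by rewrite lerDl.
Unshelve. all: by end_near. Qed.

(** For the first coordinate, the inner integral over the line vanishes by the
    fundamental theorem of calculus; any other coordinate is handled by induction on
    the remaining ones, after integrating in the other order. *)
Lemma integral_pderiv_cpt_support (R : realType) (n : nat) (i : 'I_n)
    (f : 'rV[R]_n -> R) (M : R) : 0 < M ->
  (forall x, ~ cube n M x -> f x = 0) ->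
  (forall x, derivable f x (unit_vec R i)) -> continuous (pderiv i f) ->
  (\int[lebesgue_rV n]_x (pderiv i f x)%:E = 0)%E.
Proof.
move=> M0.
have dcube m (g : 'rV[R]_m -> R) (k : 'I_m) : (forall x, ~ cube m M x -> g x = 0) ->
    forall x, ~ cube m M x -> pderiv k g x = 0.
  move=> g0 x xM; rewrite /pderiv (@near_eq_derive _ _ _ _ (cst 0)) ?derive_cst//.
  have oC : open (~` cube m M).
    apply: closed_openC; apply: compact_closed; first exact: norm_hausdorff.
    exact: compact_cube.
  near=> y; apply: g0; near: y.
  exact: (open_nbhs_nbhs (conj oC xM)).
elim: n i f => [[]//|n IHn] i f f0 df cf.
have pint := continuous_cpt_support_integrable cf (dcube _ _ i f0).
case: (unliftP ord0 i) => [j|] ij; last first.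
  rewrite (integral_lebesgue_rVS21 pint) integral0_eq// => y _.
  pose g a := f (rV_cons (a, y)).
  have gE a : derive1 g a = pderiv i f (rV_cons (a, y)).
    rewrite /derive1 /pderiv /derive ij /=.
    by under [in RHS]eq_fun do rewrite unit_vec_cons_head.
  under eq_integral => a _ do rewrite -gE.
  apply: (integral_derive1_cpt_support M0).
  - move=> a; have := df (rV_cons (a, y)); rewrite /derivable ij.
    rewrite (_ : (fun h => _) = (fun h : R => h^-1 *: (g (h *: 1 + a) - g a)))//.
    by apply/funext => h; rewrite /= unit_vec_cons_head /g [h%:A]mulr1.
  - rewrite (_ : derive1 g = fun a => pderiv i f (rV_cons (a, y))); last exact/funext.
    move=> a; apply: continuous_comp; last exact: cf.
    exact: rV_cons_continuousl.
  - move=> a aM; apply: f0 => /(_ ord0); rewrite /rV_cons mxE unlift_none.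
    exact: aM.
rewrite (integral_lebesgue_rVS12 pint) integral0_eq// => a _.
pose g y := f (rV_cons (a, y)).
have gE y : pderiv j g y = pderiv i f (rV_cons (a, y)).
  rewrite /pderiv /derive ij /=.
  by under [in RHS]eq_fun do rewrite unit_vec_cons_tail.
under eq_integral => y _ do rewrite -gE.
apply: IHn.
- move=> y yM; apply: f0 => H; apply: yM => k; have := H (lift ord0 k).
  by rewrite /rV_cons mxE liftK.
- move=> y; have := df (rV_cons (a, y)); rewrite /derivable ij.
  rewrite (_ : (fun h => _) = (fun h : R => h^-1 *: (g (h *: unit_vec R j + y) - g y)))//.
  by apply/funext => h; rewrite /= unit_vec_cons_tail.
- rewrite (_ : pderiv j g = fun y => pderiv i f (rV_cons (a, y))); last exact/funext.
  move=> y; apply: continuous_comp; last exact: cf.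
  exact: rV_cons_continuousr.
Unshelve. all: by end_near. Qed.

(** * Increments along the coordinate axes *)

Lemma is_derive_line (R : realType) (V : normedModType R) (f : V -> R)
    (p e : V) (t : R) :
  derivable f (t *: e + p) e ->
  is_derive t 1 (fun s : R => f (s *: e + p)) ('D_e f (t *: e + p)).
Proof.
have E : (fun h : R => h^-1 *: (f ((h *: 1 + t) *: e + p) - f (t *: e + p))) =
    (fun h => h^-1 *: (f (h *: e + (t *: e + p)) - f (t *: e + p))).
  by apply/funext => h; rewrite [h%:A]mulr1 scalerDl addrA.
move=> df; apply: DeriveDef; first by rewrite /derivable /= E.
by rewrite /derive /= E.
Qed.

Lemma MVT_line (R : realType) (V : normedModType R) (f : V -> R) (p e : V) (h : R) :
  (forall t, `|t| <= `|h| -> derivable f (t *: e + p) e) ->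
  exists2 c, `|c| <= `|h| & f (h *: e + p) - f p = h * 'D_e f (c *: e + p).
Proof.
move=> df; pose g (s : R) := f (s *: e + p); pose g' s := 'D_e f (s *: e + p).
have dg (s : R) : `|s| <= `|h| -> is_derive s 1 g (g' s).
  by move=> sh; exact: is_derive_line (df s sh).
have cg (s : R) : `|s| <= `|h| -> {for s, continuous g}.
  move=> /dg [dgs _]; apply: differentiable_continuous; exact/derivable1_diffP.
have f0 : f p = g 0 by rewrite /g scale0r add0r.
have [h0|h0] := leP 0 h.
  have [||c] := @MVT_segment R g g' 0 h h0.
  - move=> x; rewrite in_itv/= => /andP[x0 xh]; apply: dg.
    by rewrite !ger0_norm // ltW.
  - apply: continuous_in_subspaceT => x; rewrite inE/= in_itv/= => /andP[x0 xh].
    by apply: cg; rewrite !ger0_norm.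
  rewrite in_itv/= => /andP[c0 ch]; rewrite subr0 f0 => E.
  by exists c; [rewrite !ger0_norm|rewrite [LHS]E mulrC].
have [||c] := @MVT_segment R g g' h 0 (ltW h0).
- move=> x; rewrite in_itv/= => /andP[xh x0]; apply: dg.
  by rewrite (ler0_norm (ltW x0)) (ler0_norm (ltW h0)) lerN2 ltW.
- apply: continuous_in_subspaceT => x; rewrite inE/= in_itv/= => /andP[xh x0].
  by apply: cg; rewrite (ler0_norm x0) (ler0_norm (ltW h0)) lerN2.
rewrite in_itv/= => /andP[ch c0]; rewrite sub0r f0 mulrN => E.
exists c; first by rewrite (ler0_norm c0) (ler0_norm (ltW h0)) lerN2.
by rewrite -[LHS]opprB -/(g h) E opprK mulrC.
Qed.

Lemma ball_rV_le (R : realType) (n : nat) (x y z : 'rV[R]_n) (r : R) : 0 < r ->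
  ball x r y -> (forall i, `|z ord0 i - x ord0 i| <= `|y ord0 i - x ord0 i|) ->
  ball x r z.
Proof.
move=> r0 /(ball_rVP _ _ r0) xy H; apply/ball_rVP => // i.
by rewrite distrC (le_lt_trans (H i))// distrC.
Qed.

(** Only partial derivatives are assumed to exist, so the increment is split along a
    staircase from [x] to [y] that changes one coordinate at a time; each stair stays
    in the same ball because balls of the sup norm are boxes. *)
Lemma increment_partial (R : realType) (n : nat) (f : 'rV[R]_n -> R)
    (x y : 'rV[R]_n) (r : R) : 0 < r -> ball x r y ->
  (forall z i, ball x r z -> derivable f z (unit_vec R i)) ->
  exists xi : 'I_n -> 'rV[R]_n, (forall i, ball x r (xi i)) /\
    f y - f x = \sum_i (y ord0 i - x ord0 i) * pderiv i f (xi i).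
Proof.
move=> r0 xy df.
pose p (k : nat) : 'rV[R]_n := \row_i (if (i < k)%N then y ord0 i else x ord0 i).
have pS (i : 'I_n) : p i.+1 = (y ord0 i - x ord0 i) *: unit_vec R i + p i.
  apply/rowP => j; rewrite /unit_vec !mxE /= ltnS.
  have [->|ji] := eqVneq j i; first by rewrite leqnn ltnn mulr1 subrK.
  by rewrite mulr0 add0r leq_eqVlt (inj_eq val_inj) (negbTE ji).
have step (i : 'I_n) : exists2 z, ball x r z &
    f (p i.+1) - f (p i) = (y ord0 i - x ord0 i) * pderiv i f z.
  have inb t : `|t| <= `|y ord0 i - x ord0 i| -> ball x r (t *: unit_vec R i + p i).
    move=> tle; apply: (ball_rV_le r0 xy) => j; rewrite /unit_vec !mxE /=.
    have [->|ji] := eqVneq j i; first by rewrite ltnn mulr1 addrK.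
    by rewrite mulr0 add0r; case: ifP => // _; rewrite subrr normr0.
  have [|c ch E] := @MVT_line R _ f (p i) (unit_vec R i) (y ord0 i - x ord0 i).
    by move=> t /inb; exact: df.
  by exists (c *: unit_vec R i + p i); [exact: inb|rewrite pS E].
pose xi i := projT1 (cid2 (step i)).
exists xi; split=> [i|]; first by rewrite /xi; case: cid2.
transitivity (\sum_(i < n) (f (p i.+1) - f (p i))).
  rewrite -(big_mkord xpredT (fun i => f (p i.+1) - f (p i))) telescope_sumr//.
  congr (f _ - f _); apply/rowP => i; rewrite !mxE ?ltn_ord//.
by apply: eq_bigr => i _; rewrite /xi; case: cid2.
Qed.

(** A first-order expansion from continuous partial derivatives: all of them differ
    by less than [eta] from their values at [x] in a small ball, and [eta] is chosen
    so that the error cannot outweigh the negative slope. *)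
Lemma partial_slope_lt0 (R : realType) (n : nat) (f : 'rV[R]_n -> R)
    (U : set 'rV[R]_n) (x e : 'rV[R]_n) : open U -> U x ->
  (forall z i, U z -> derivable f z (unit_vec R i)) ->
  (forall i, {for x, continuous (pderiv i f)}) ->
  \sum_i e ord0 i * pderiv i f x < 0 ->
  \forall s \near 0^'+, f (x + s *: e) < f x.
Proof.
move=> oU Ux df cf slope.
pose eta := - (\sum_i e ord0 i * pderiv i f x) / (1 + \sum_i `|e ord0 i|).
have D0 : 0 < 1 + \sum_i `|e ord0 i| by rewrite ltr_pwDl// sumr_ge0.
have eta0 : 0 < eta by rewrite divr_gt0// oppr_gt0.
have cfe i : \forall z \near x, `|pderiv i f x - pderiv i f z| < eta.
  by have /cvgrPdist_lt := cf i; exact.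
have cfE := @filter_forall _ _ _ (nbhs x) (nbhs_filter x) cfe.
have : nbhs x (U `&` [set z | forall i, `|pderiv i f x - pderiv i f z| < eta]).
  by apply: filterI => //; exact: open_nbhs_nbhs.
move=> /nbhs_ballP[r /= r0 rH].
have cs : (x + s *: e) @[s --> 0^'+] --> x.
  rewrite -[X in _ --> X]addr0; apply: cvgD; first exact: cvg_cst.
  rewrite -(scale0r e); apply: cvgZl; last exact: cvg_within.
have /cs bs : nbhs x (ball x r) by exact: nbhsx_ballx.
near=> s.
have s0 : 0 < s by [].
have [||xi [bxi E]] := @increment_partial R n f x (x + s *: e) r r0.
- by near: s.
- by move=> z i /rH[Uz _]; exact: df.
rewrite -subr_lt0 E.
under eq_bigr do rewrite !mxE (addrC (x _ _)) addrK -mulrA.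
rewrite -mulr_sumr pmulr_rlt0//.
apply: (@le_lt_trans _ _ (\sum_i e ord0 i * pderiv i f x + eta * \sum_i `|e ord0 i|)).
  rewrite mulr_sumr -big_split/=; apply: ler_sum => i _.
  rewrite -lerBlDl -mulrBr; apply: le_trans (ler_norm _) _.
  rewrite normrM mulrC ler_wpM2r// distrC ltW//.
  by have [_] := rH _ (bxi i); exact.
have -> : \sum_i e ord0 i * pderiv i f x = - eta * (1 + \sum_i `|e ord0 i|).
  by rewrite /eta mulNr mulfVK ?gt_eqF// opprK.
by rewrite mulNr mulrDr mulr1 opprD addrNK oppr_lt0.
Unshelve. all: by end_near. Qed.

(** * Supporting hyperplanes of a smooth convex domain *)

Definition dot (R : realType) (n : nat) (a b : 'rV[R]_n) : R :=
  \sum_i a ord0 i * b ord0 i.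

Section dot_lemmas.
Context (R : realType) (n : nat).
Implicit Types a b c : 'rV[R]_n.

Lemma dotC a b : dot a b = dot b a.
Proof. by apply: eq_bigr => i _; rewrite mulrC. Qed.

Lemma dotDr a b c : dot a (b + c) = dot a b + dot a c.
Proof. by rewrite /dot -big_split/=; apply: eq_bigr => i _; rewrite mxE mulrDr. Qed.

Lemma dotZr a k b : dot a (k *: b) = k * dot a b.
Proof. by rewrite /dot mulr_sumr; apply: eq_bigr => i _; rewrite mxE mulrCA. Qed.

Lemma dotNr a b : dot a (- b) = - dot a b.
Proof. by rewrite -scaleN1r dotZr mulN1r. Qed.

Lemma dotBr a b c : dot a (b - c) = dot a b - dot a c.
Proof. by rewrite dotDr dotNr. Qed.

Lemma dotZl a k b : dot (k *: a) b = k * dot a b.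
Proof. by rewrite dotC dotZr dotC. Qed.

Lemma dot_ge0 a : 0 <= dot a a.
Proof. by apply: sumr_ge0 => i _; rewrite -expr2 sqr_ge0. Qed.

Lemma dot_eq0 a : (dot a a == 0) = (a == 0).
Proof.
apply/eqP/eqP => [a0|->]; last by rewrite /dot big1// => i _; rewrite mxE mul0r.
apply/rowP => i; rewrite mxE; apply/eqP; rewrite -sqrf_eq0 expr2; apply/eqP.
by move/psumr_eq0P: a0; apply => // j _; rewrite -expr2 sqr_ge0.
Qed.

Lemma dot_gt0 a : (0 < dot a a) = (a != 0).
Proof. by rewrite lt_def dot_ge0 andbT dot_eq0. Qed.

Lemma unit_coord_le1 a i : dot a a = 1 -> `|a ord0 i| <= 1.
Proof.
move=> a1; rewrite -[leRHS](@normr1 R) -ler_sqr ?nnegrE// !real_normK ?num_real//.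
rewrite expr1n -a1 /dot (bigD1 i)//= -expr2 lerDl.
by apply: sumr_ge0 => j _; rewrite -expr2 sqr_ge0.
Qed.

(** If [nu] had a component [w] orthogonal to [g], then [w], tilted slightly
    against [g], would be a direction in which [g] decreases and [nu] increases. *)
Lemma dot_halfspace_colinear (g nu : 'rV[R]_n) : g != 0 -> nu != 0 ->
  (forall e, dot g e < 0 -> dot nu e <= 0) ->
  exists2 c, 0 < c & nu = c *: g.
Proof.
move=> g0 nu0 H; have gg : 0 < dot g g by rewrite dot_gt0.
pose c := dot nu g / dot g g; pose w := nu - c *: g.
have gw : dot g w = 0.
  by rewrite /w dotBr dotZr /c mulfVK ?gt_eqF// dotC subrr.
have nuw : dot nu w = dot w w.
  by rewrite -[in LHS](subrK (c *: g) nu) -/w dotC dotDr dotZr (dotC w g) gw mulr0 addr0.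
have ww0 : dot w w <= 0.
  apply/ler_addgt0Pr => d d0; rewrite add0r.
  have e0 : 0 < d / (1 + `|dot nu g|) by rewrite divr_gt0// ltr_pwDl.
  have : dot g (w - (d / (1 + `|dot nu g|)) *: g) < 0.
    by rewrite dotBr gw dotZr sub0r oppr_lt0 mulr_gt0.
  move=> /H; rewrite dotBr nuw dotZr subr_le0 => /le_trans; apply.
  apply: le_trans (ler_norm _) _; rewrite normrM (ger0_norm (ltW e0)).
  rewrite mulrAC ler_pdivrMr ?ltr_pwDl//; apply: ler_wpM2l; first exact: ltW.
  by rewrite lerDr.
have w0 : w = 0 by apply/eqP; rewrite -dot_eq0 eq_le ww0 dot_ge0.
have nuE : nu = c *: g by apply/eqP; rewrite -subr_eq0 -/w w0.
exists c => //; rewrite lt_def; apply/andP; split.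
  by apply: contra nu0 => /eqP c0; rewrite nuE c0 scale0r.
have : dot nu (- g) <= 0 by apply: H; rewrite dotNr oppr_lt0.
by rewrite dotNr oppr_le0 => nug; rewrite /c divr_ge0// ltW.
Qed.

End dot_lemmas.

Definition supports (R : realType) (n : nat) (Omega : set 'rV[R]_n)
    (x nu : 'rV[R]_n) : Prop :=
  dot nu nu = 1 /\ forall y, Omega y -> dot nu (y - x) <= 0.

Lemma frontier_openP (R : realType) (n : nat) (Omega : set 'rV[R]_n) x :
  open Omega -> frontier Omega x <-> closure Omega x /\ ~ Omega x.
Proof.
move=> oO; rewrite /frontier -(proj1 (closure_id (~` Omega)))//.
exact: open_closedC.
Qed.

Section local_defining_function.
Context (R : realType) (n : nat) (Omega : set 'rV[R]_n).
Hypotheses (oO : open Omega) (cO : @convex_set R 'rV[R]_n Omega).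
Context (x : 'rV[R]_n) (Fx : frontier Omega x).
Context (U : set 'rV[R]_n) (rho : 'rV[R]_n -> R).
Hypothesis ld : local_defining Omega x U rho.

Let NOx : ~ Omega x. Proof. by have /(frontier_openP _ oO)[] := Fx. Qed.

Let drho z i : U z -> derivable rho z (unit_vec R i).
Proof. by case: ld => _ _ sm _ _ /(sm [::] z)[]. Qed.

Let crho i : {for x, continuous (pderiv i rho)}.
Proof. by case: ld => _ Ux sm _ _; have [] := sm [:: i] x Ux. Qed.

Let rhox0 : rho x = 0.
Proof.
case: ld => oU Ux sm _ OU; apply/eqP; rewrite eq_le; apply/andP; split; last first.
  by rewrite leNgt; apply/negP => /(OU _ Ux).
rewrite leNgt; apply/negP => rx0.
have [cr _] := sm [::] x Ux.
have [cx _] := proj1 (frontier_openP _ oO) Fx.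
have nU : nbhs x U by exact: open_nbhs_nbhs.
have := cx _ (filterI nU (cr _ (open_nbhs_nbhs (conj (@open_gt R 0) rx0)))).
by case=> y [Oy [Uy /=]]; rewrite ltNge => /negP; apply; apply/ltW/(OU _ Uy).
Qed.

(** Near [x] the domain is {rho < 0}, and rho vanishes at the boundary point [x], so
    that a direction in which rho decreases enters the domain. *)
Lemma inward_direction e : dot (grad rho x) e < 0 ->
  \forall s \near 0^'+, Omega (x + s *: e).
Proof.
case: ld => oU Ux sm _ OU slope.
have cs : (x + s *: e) @[s --> 0^'+] --> x.
  rewrite -[X in _ --> X]addr0; apply: cvgD; first exact: cvg_cst.
  rewrite -(scale0r e); apply: cvgZl; last exact: cvg_within.
have /cs nU : nbhs x U by exact: open_nbhs_nbhs.
have sl : \sum_i e ord0 i * pderiv i rho x < 0.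
  by move: slope; rewrite /dot /grad; under eq_bigr do rewrite mxE mulrC.
have decr := partial_slope_lt0 oU Ux (fun z i => @drho z i) crho sl.
near=> s; have Us : U (x + s *: e) by near: s.
by apply/(OU _ Us); rewrite -rhox0; near: s.
Unshelve. all: by end_near. Qed.

(** If some [y] of the domain lay strictly beyond the tangent hyperplane, the
    direction opposite to [y - x] would point inward, and [x] would lie on a segment
    between two points of the domain. *)
Lemma grad_supporting y : Omega y -> dot (grad rho x) (y - x) <= 0.
Proof.
move=> Oy; rewrite leNgt; apply/negP => gy.
have := @inward_direction (- (y - x)); rewrite dotNr oppr_lt0 => /(_ gy) nO.
have [s [s0 s1]] : exists s : R, 0 < s < 1 /\ Omega (x + s *: - (y - x)).
  have n1 : \forall s \near (0:R)^'+, s < 1 by exact: nbhs_right_lt.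
  near (0:R)^'+ => s; exists s; split; last by near: s.
  by apply/andP; split; [near: s; exact: nbhs_right_gt|near: s].
move: s1; set z := x + _ => Oz; apply: NOx.
have D0 : 0 < 1 + s by rewrite addr_gt0//; case/andP: s0.
have l0 : 0 <= (1 + s)^-1 by rewrite invr_ge0 ltW.
have l1 : (1 + s)^-1 <= 1 by rewrite invf_le1// lerDl; case/andP: s0 => /ltW.
have E : x = (1 + s)^-1 *: z + (1 - (1 + s)^-1) *: y.
  have -> : 1 - (1 + s)^-1 = (1 + s)^-1 * s.
    by field; exact: lt0r_neq0.
  rewrite -scalerA -scalerDr /z scalerN scalerBr opprB -addrA subrK.
  by rewrite -[X in _ *: (X + _)]scale1r -scalerDl scalerA mulVf ?scale1r ?lt0r_neq0.
have := cO (Itv01 l0 l1) (mem_set Oz) (mem_set Oy).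
by rewrite inE /conv/= E.
Unshelve. all: by end_near. Qed.

(** Smoothness of the boundary makes the supporting normal unique: all directions of
    decrease of rho enter the domain, hence are nonpositive on [nu]. *)
Lemma supports_colinear nu : supports Omega x nu ->
  exists2 c, 0 < c & nu = c *: grad rho x.
Proof.
case: ld => oU Ux sm g0 OU [nu1 nuO]; apply: dot_halfspace_colinear.
- exact: g0.
- by rewrite -dot_gt0 nu1.
move=> e /inward_direction nO.
have [s s0 Os] : exists2 s : R, 0 < s & Omega (x + s *: e).
  by near (0:R)^'+ => s; exists s; [by []|near: s].
have := nuO _ Os; rewrite addrC addKr dotZr.
by rewrite pmulr_rle0.
Unshelve. all: by end_near. Qed.

End local_defining_function.

Section smooth_domain.
Context (R : realType) (n : nat) (Omega : set 'rV[R]_n).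
Hypothesis hO : bounded_convex_smooth_domain Omega.
Let oO := domain_open hO.
Let cO := domain_convex hO.

Lemma supports_outward x nu : frontier Omega x -> supports Omega x nu ->
  outward_unit_normal Omega x nu.
Proof.
move=> Fx snu; split.
  by case: snu => <- _; apply: eq_bigr => i _; rewrite expr2.
have [U [rho ld]] := domain_smooth hO Fx.
exists U, rho; split => //; exact: (supports_colinear oO Fx ld snu).
Qed.

Lemma frontier_supports x : frontier Omega x -> exists nu, supports Omega x nu.
Proof.
move=> Fx; have [U [rho ld]] := domain_smooth hO Fx.
have g0 : grad rho x != 0 by case: ld => _ Ux _ g0 _; exact: g0.
have gg : 0 < dot (grad rho x) (grad rho x) by rewrite dot_gt0.
have s0 : 0 < (Num.sqrt (dot (grad rho x) (grad rho x)))^-1.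
  by rewrite invr_gt0 sqrtr_gt0.
exists ((Num.sqrt (dot (grad rho x) (grad rho x)))^-1 *: grad rho x); split.
  rewrite dotZl dotZr mulrA -expr2 exprVn sqr_sqrtr ?ltW//.
  by rewrite mulVf ?lt0r_neq0.
move=> y Oy; rewrite dotZl pmulr_rle0//.
exact: (grad_supporting oO cO Fx ld Oy).
Qed.

(** The limit case of the compactness argument below: a point of the closure at
    distance zero from a supporting hyperplane is a boundary point, because from an
    interior point one could move a little further along the normal. *)
Lemma supports_touching p x nu : supports Omega p nu -> closure Omega x ->
  dot nu (p - x) = 0 -> frontier Omega x /\ supports Omega x nu.
Proof.
move=> [nu1 nup] cx px.
have supx : supports Omega x nu.
  by split=> // y /nup; rewrite !dotBr; move: px; rewrite dotBr; lra.
split=> //; apply/(frontier_openP _ oO); split=> // Ox.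
have [e e0 eO] : exists2 e : R, 0 < e & Omega (x + e *: nu).
  have cs : (x + s *: nu) @[s --> (0:R)^'+] --> x.
    rewrite -[X in _ --> X]addr0; apply: cvgD; first exact: cvg_cst.
    rewrite -(scale0r nu); apply: cvgZl; last exact: cvg_within.
  have /cs nO : nbhs x Omega by exact: open_nbhs_nbhs.
  by near (0:R)^'+ => s; exists s; [by []|near: s].
have := supx.2 _ eO; rewrite addrC addKr dotZr nu1 mulr1.
by rewrite leNgt e0.
Unshelve. all: by end_near. Qed.

End smooth_domain.

(** * Fields tangential to the boundary *)

Lemma cvg_sumr (R : realType) (T I : Type) (F : set_system T) (FF : Filter F)
    (r : seq I) (f : I -> T -> R) (a : I -> R) :
  (forall i, f i @ F --> a i) ->
  (\sum_(i <- r) f i x) @[x --> F] --> \sum_(i <- r) a i.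
Proof.
move=> fa; elim: r => [|i r IH].
  by rewrite big_nil; under eq_fun do rewrite big_nil; exact: cvg_cst.
by rewrite big_cons; under eq_fun do rewrite big_cons; apply: cvgD.
Qed.

Lemma cvg_maxr (R : realType) (T : Type) (F : set_system T) (FF : Filter F)
    (f g : T -> R) (a b : R) : f @ F --> a -> g @ F --> b ->
  (Num.max (f x) (g x)) @[x --> F] --> Num.max a b.
Proof.
move=> fa gb; rewrite maxr_absE; under eq_fun do rewrite maxr_absE.
apply: cvgM; last exact: cvg_cst.
by apply: cvgD; [exact: cvgD|apply: cvg_norm; exact: cvgB].
Qed.

Lemma continuous_sumr (R : realType) (T : topologicalType) (I : Type)
    (r : seq I) (f : I -> T -> R) (x : T) :
  (forall i, {for x, continuous (f i)}) ->
  {for x, continuous (fun y => \sum_(i <- r) f i y)}.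
Proof. by move=> fc; apply: cvg_sumr. Qed.

Lemma within_continuous_comp (S T U : topologicalType) (g : S -> T) (h : T -> U)
    (A : set S) (D : set T) :
  (forall x, A x -> {for x, continuous g}) -> (forall x, A x -> D (g x)) ->
  {within D, continuous h} -> {within A, continuous (h \o g)}.
Proof.
move=> cg AD /subspace_continuousP ch; apply/subspace_continuousP => x Ax W hW.
have := ch _ (AD _ Ax) _ hW; rewrite /= !nbhs_simpl/= /within/= => /(cg _ Ax).
rewrite /= !nbhs_simpl/=; apply: filterS => y H Ay; apply: H; exact: AD.
Qed.

Lemma closure_cube (R : realType) (n : nat) (A : set 'rV[R]_n) M :
  A `<=` cube n M -> closure A `<=` cube n M.
Proof.
move=> AM; have cl : closed (cube n M).
  by apply: compact_closed; [exact: norm_hausdorff|exact: compact_cube].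
by rewrite (proj1 (closure_id _) cl); exact: closure_subset.
Qed.

Lemma compact_closure_bounded (R : realType) (n : nat) (A : set 'rV[R]_n) :
  bounded_set A -> compact (closure A).
Proof.
move=> /bounded_set_cube[M _ AM].
apply: subclosed_compact (@compact_cube R n M) _; first exact: closed_closure.
exact: closure_cube.
Qed.

(** A continuous [g] that vanishes on the zero set of [f >= 0] is small where [f] is
    small.  The threshold is the minimum over the compact set of
    [max (f z) (eta - |g z|)], which is positive by assumption. *)
Lemma compact_zero_modulus (R : realType) (T : topologicalType) (A : set T)
    (f g : T -> R) (eta : R) : compact A ->
  {within A, continuous f} -> {within A, continuous g} ->
  (forall z, A z -> 0 <= f z) -> (forall z, A z -> f z = 0 -> g z = 0) ->
  0 < eta ->
  exists2 theta : R, 0 < theta &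
    forall z, A z -> f z < theta -> `|g z| < eta.
Proof.
move=> cA cf cg f0 fg eta0.
have [A0|A0] := pselect (A !=set0); last first.
  by exists 1 => // z Az; case: A0; exists z.
pose m z : R := Num.max (f z) (eta - `|g z|).
have cm : {within A, continuous m}.
  move=> z; apply: cvg_maxr; first exact: cf.
  by apply: cvgB; [exact: cvg_cst|apply: cvg_norm; exact: cg].
have [c cA' mc] := compact_EVT_min A0 cA cm.
have Ac : A c by exact: set_mem.
exists (m c).
  rewrite /m lt_max; have := f0 _ Ac; rewrite le_eqVlt => /predU1P[fc0|->//].
  by rewrite [g c]fg// normr0 subr0 eta0 orbT.
move=> z Az fz; have := mc z (mem_set Az).
rewrite {2}/m le_max leNgt fz/= => H; rewrite -subr_gt0.
apply: lt_le_trans H.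
rewrite /m lt_max; have := f0 _ Ac; rewrite le_eqVlt => /predU1P[fc0|->//].
by rewrite [g c]fg// normr0 subr0 eta0 orbT.
Qed.

Lemma continuous_coord (R : realType) (n : nat) (i : 'I_n) :
  continuous (fun x : 'rV[R]_n => x ord0 i).
Proof. exact: coord_continuous. Qed.

Lemma continuous_dot (R : realType) (n : nat) (T : topologicalType)
    (a b : T -> 'rV[R]_n) x :
  {for x, continuous a} -> {for x, continuous b} ->
  {for x, continuous (fun y => dot (a y) (b y))}.
Proof.
move=> ca cb; apply: continuous_sumr => i.
by apply: continuousM; apply: (continuous_comp _ (@continuous_coord R n i _)).
Qed.

(** On the compact set of triples (point, point of contact, supporting normal), the
    distance of the point to the hyperplane vanishes only if the normal is an outward
    normal at that point, and there the field is tangential. *)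
Section tangential.
Context (R : realType) (n : nat) (Omega : set 'rV[R]_n).
Hypothesis hO : bounded_convex_smooth_domain Omega.
Variable h : 'I_n -> 'rV[R]_n -> R.
Hypothesis ch : forall i, {within closure Omega, continuous (h i)}.
Hypothesis h_tangential : forall x nu, frontier Omega x ->
  outward_unit_normal Omega x nu -> \sum_i nu ord0 i * h i x = 0.

Local Notation E3 := ('rV[R]_n * ('rV[R]_n * 'rV[R]_n))%type.

Let S : set E3 :=
  [set z | [/\ closure Omega z.1, closure Omega z.2.1 & supports Omega z.2.1 z.2.2]].

Let continuous1 : continuous (fun z : E3 => z.1).
Proof. by move=> z; exact: cvg_fst. Qed.
Let continuous21 : continuous (fun z : E3 => z.2.1).
Proof. by move=> z; apply: continuous_comp; [exact: cvg_snd|exact: cvg_fst]. Qed.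
Let continuous22 : continuous (fun z : E3 => z.2.2).
Proof. by move=> z; apply: continuous_comp; [exact: cvg_snd|exact: cvg_snd]. Qed.

Let compactS : compact S.
Proof.
have cO := compact_closure_bounded (domain_bounded hO).
apply: subclosed_compact (compact_setX cO (compact_setX cO (@compact_cube R n 1))) _.
- have -> : S = (fun z : E3 => z.1) @^-1` (closure Omega) `&`
     ((fun z : E3 => z.2.1) @^-1` (closure Omega) `&`
     ((fun z : E3 => dot z.2.2 z.2.2) @^-1` [set x | x = 1] `&`
     \bigcap_(y in Omega) ((fun z : E3 => dot z.2.2 (y - z.2.1)) @^-1` [set x | x <= 0]))).
    apply/seteqP; split=> [[x [p nu]] [/= cx cp [nu1 H]]//|].
    by move=> [x [p nu]] [/= cx [cp [nu1 H]]].
  apply: closedI; first by apply: preimage_closed => //; exact: closed_closure.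
  apply: closedI; first by apply: preimage_closed => //; exact: closed_closure.
  apply: closedI.
    apply: preimage_closed; last exact: closed_eq.
    move=> z _; by apply: (continuous_dot (a := fun z : E3 => z.2.2) (b := fun z : E3 => z.2.2));
      exact: continuous22.
  apply: closed_bigI => y _; apply: preimage_closed; last exact: closed_le.
  move=> z _.
  apply: (continuous_dot (a := fun z : E3 => z.2.2) (b := fun z : E3 => y - z.2.1)).
    exact: continuous22.
  by apply: continuousB; [exact: cst_continuous|exact: continuous21].
- move=> [x [p nu]] [/= cx cp [nu1 _]]; split => //; split => //= i.
  exact: unit_coord_le1.
Qed.

Lemma almost_tangential (eta : R) : 0 < eta ->
  exists2 theta : R, 0 < theta &
    forall x p nu, closure Omega x -> closure Omega p -> supports Omega p nu ->
      dot nu (p - x) < theta -> `|\sum_i nu ord0 i * h i x| < eta.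
Proof.
move=> eta0.
have [|||||theta t0 H] := @compact_zero_modulus R _ S
  (fun z : E3 => dot z.2.2 (z.2.1 - z.1)) (fun z : E3 => \sum_i z.2.2 ord0 i * h i z.1)
  eta compactS.
- apply: continuous_subspaceT => z.
  apply: (continuous_dot (a := fun z : E3 => z.2.2) (b := fun z : E3 => z.2.1 - z.1)).
    exact: continuous22.
  by apply: continuousB; [exact: continuous21|exact: continuous1].
- move=> z; apply: continuous_sumr => i; apply: continuousM.
    apply: continuous_subspaceT => w.
    apply: (@continuous_comp _ _ _ (fun z : E3 => z.2.2) (fun x : 'rV[R]_n => x ord0 i)).
      exact: continuous22.
    exact: continuous_coord.
  apply: (@within_continuous_comp _ _ _ (fun z : E3 => z.1) (h i) S (closure Omega)).
  + by move=> w _; exact: continuous1.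
  + by move=> w [].
  + exact: ch.
- move=> [x [p nu]] [/= cx cp [nu1 sup]].
  have cl : closed [set y : 'rV[R]_n | dot nu (y - p) <= 0].
    rewrite (_ : [set y : 'rV[R]_n | _] =
      (fun y : 'rV[R]_n => dot nu (y - p)) @^-1` [set x | x <= 0])//.
    apply: preimage_closed; last exact: closed_le.
    move=> z _.
    apply: (continuous_dot (T := 'rV[R]_n) (a := fun=> nu) (b := fun y : 'rV[R]_n => y - p)).
      exact: cst_continuous.
    by apply: continuousB; [exact: cvg_id|exact: cst_continuous].
  have : closure Omega `<=` [set y : 'rV[R]_n | dot nu (y - p) <= 0].
    by rewrite [X in _ `<=` X](proj1 (closure_id _) cl); exact: closure_subset.
  by move=> /(_ x cx) /=; rewrite -oppr_ge0 -dotNr opprB.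
- move=> [x [p nu]] [/= cx cp sup] px0.
  have [Fx snu] := supports_touching hO sup cx px0.
  exact: h_tangential Fx (supports_outward hO Fx snu).
- exact: eta0.
by exists theta => // x p nu cx cp snu; apply: (H (x, (p, nu))).
Qed.

End tangential.

(** * Calculus of C^1 and C^2 functions on open sets *)

Lemma is_derive_comp (R : realType) (V : normedModType R) (g : R -> R)
    (f : V -> R) (x v : V) (dg df : R) :
  is_derive x v f df -> is_derive (f x) 1 g dg ->
  is_derive x v (fun y => g (f y)) (dg * df).
Proof.
move=> [fx <-] [gx <-].
pose k (h : R) := f (h *: v + x).
have k0 : k 0 = f x by rewrite /k scale0r add0r.
have dk : is_derive (0:R) 1 k ('D_v f x).
  by have dl := @is_derive_line R V f x v 0; rewrite scale0r add0r in dl; exact (dl fx).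
have dg0 : is_derive (k 0) 1 g ('D_1 g (f x)) by rewrite k0; exact: derivableP.
have gk : is_derive (0:R) 1 (g \o k) ('D_1 g (f x) * 'D_v f x).
  exact: (is_derive1_comp dg0 dk).
have gkE : (fun h : R => h^-1 *: ((g \o k) (h *: 1 + 0) - (g \o k) 0)) =
    (fun h : R => h^-1 *: (g (f (h *: v + x)) - g (f x))).
  by apply/funext => h; rewrite /= k0 [h%:A]mulr1 addr0.
case: gk; rewrite /derivable /derive /= gkE => d1 d2.
by split; [exact: d1|rewrite /derive /= d2].
Qed.

Lemma is_derive_affine (R : realType) (V : normedModType R) (f : V -> R)
    (x v : V) (c : R) :
  (forall h, f (h *: v + x) = f x + h * c) -> is_derive x v f c.
Proof.
move=> fE.
have E : (fun h : R => h^-1 *: (f (h *: v + x) - f x)) = (fun h : R => h^-1 * (h * c)).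
  by apply/funext => h; rewrite fE addrAC subrr add0r.
have H : (h^-1 * (h * c)) @[h --> (0:R)^'] --> (c : R).
  apply: (@cvg_trans _ (cst c @ (0:R)^')); last exact: cvg_cst.
  apply: near_eq_cvg; near=> h; rewrite mulrA mulVf ?mul1r//.
  by near: h; exact: nbhs_dnbhs_neq.
split; first by apply/cvg_ex; exists c; rewrite /= E.
by rewrite /derive /= E; apply/cvg_lim.
Unshelve. all: by end_near. Qed.
Section pointwise_forms.
Context (R : realType).

Lemma cont_add (T : topologicalType) (f g : T -> R) x :
  {for x, continuous f} -> {for x, continuous g} ->
  {for x, continuous (fun y => f y + g y)}.
Proof. by move=> cf cg; exact (cvgD cf cg). Qed.

Lemma cont_mul (T : topologicalType) (f g : T -> R) x :
  {for x, continuous f} -> {for x, continuous g} ->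
  {for x, continuous (fun y => f y * g y)}.
Proof. by move=> cf cg; exact (cvgM cf cg). Qed.

Lemma deriv_add (V : normedModType R) (f g : V -> R) x v :
  derivable f x v -> derivable g x v -> derivable (fun y => f y + g y) x v.
Proof. by move=> df dg; exact (derivableD df dg). Qed.

Lemma deriv_mul (V : normedModType R) (f g : V -> R) x v :
  derivable f x v -> derivable g x v -> derivable (fun y => f y * g y) x v.
Proof. by move=> df dg; exact (derivableM df dg). Qed.

End pointwise_forms.

Section C1.
Context (R : realType) (n : nat).
Implicit Types (D : set 'rV[R]_n) (f g : 'rV[R]_n -> R).

Definition C1on D f := forall x, D x -> {for x, continuous f} /\
  forall i, derivable f x (unit_vec R i) /\ {for x, continuous (pderiv i f)}.

Definition C2on D f := C1on D f /\ forall i, C1on D (pderiv i f).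

Lemma pderiv_near f g x i : (\near x, f x = g x) -> pderiv i f x = pderiv i g x.
Proof. exact: near_eq_derive. Qed.

Lemma eq_on_open D f g x : open D -> (forall y, D y -> f y = g y) -> D x ->
  \near x, f x = g x.
Proof. by move=> oD fg Dx; apply: filterS (open_nbhs_nbhs (conj oD Dx)). Qed.

Lemma pderiv_eq_on D f g i : open D -> (forall y, D y -> f y = g y) ->
  forall x, D x -> pderiv i f x = pderiv i g x.
Proof. by move=> oD fg x Dx; apply/pderiv_near/(eq_on_open oD fg Dx). Qed.

Lemma continuous_eq_on D f g x : open D -> (forall y, D y -> f y = g y) -> D x ->
  {for x, continuous f} -> {for x, continuous g}.
Proof.
move=> oD fg Dx cf; rewrite /prop_for /continuous_at -(fg x Dx).
have fgx : {near nbhs x, f =1 g} by exact: (eq_on_open oD fg Dx).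
exact: cvg_trans (@near_eq_cvg _ _ (nbhs x) (nbhs_filter x) _ _ fgx) cf.
Qed.

Lemma C1on_eq D f g : open D -> (forall y, D y -> f y = g y) ->
  C1on D f -> C1on D g.
Proof.
move=> oD fg Cf x Dx; have [cf df] := Cf x Dx; split.
  exact: (continuous_eq_on oD fg Dx cf).
move=> i; have [dfi cfi] := df i; split.
  exact: near_eq_derivable (eq_on_open oD fg Dx) dfi.
exact: (continuous_eq_on oD (@pderiv_eq_on D f g i oD fg) Dx cfi).
Qed.

Lemma C2on_eq D f g : open D -> (forall y, D y -> f y = g y) ->
  C2on D f -> C2on D g.
Proof.
move=> oD fg [C1f C2f]; split; first exact: C1on_eq C1f.
by move=> i; apply: C1on_eq (C2f i) => //; exact: pderiv_eq_on.
Qed.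

Lemma C1onU D1 D2 f : C1on D1 f -> C1on D2 f -> C1on (D1 `|` D2) f.
Proof. by move=> C1 C2 x [/C1|/C2]. Qed.

Lemma C2onU D1 D2 f : C2on D1 f -> C2on D2 f -> C2on (D1 `|` D2) f.
Proof.
by move=> [C1 D1f] [C2 D2f]; split; [exact: (C1onU C1 C2)|move=> i; exact: (C1onU (D1f i) (D2f i))].
Qed.

Lemma C1onS D1 D2 f : D1 `<=` D2 -> C1on D2 f -> C1on D1 f.
Proof. by move=> D12 C x /D12; exact: C. Qed.

Lemma C2onS D1 D2 f : D1 `<=` D2 -> C2on D2 f -> C2on D1 f.
Proof. by move=> D12 [C C1]; split=> [|i]; [exact: C1onS C|exact: C1onS (C1 i)]. Qed.

Lemma pderiv_cst (c : R) i (x : 'rV[R]_n) : pderiv i (fun=> c) x = 0.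
Proof. exact: derive_cst. Qed.

Lemma C1on_cst D (c : R) : C1on D (fun=> c).
Proof.
move=> x Dx; split; first exact: cst_continuous.
move=> i; split; first exact: derivable_cst.
rewrite (_ : pderiv i _ = fun=> 0); first exact: cst_continuous.
by apply/funext => y; rewrite pderiv_cst.
Qed.

Lemma C2on_cst D (c : R) : C2on D (fun=> c).
Proof.
split=> [|i]; first exact: C1on_cst.
rewrite (_ : pderiv i _ = fun=> 0); first exact: C1on_cst.
by apply/funext => y; rewrite pderiv_cst.
Qed.

Lemma pderivD f g i x : derivable f x (unit_vec R i) ->
  derivable g x (unit_vec R i) ->
  pderiv i (fun y => f y + g y) x = pderiv i f x + pderiv i g x.
Proof. exact: deriveD. Qed.

Lemma pderivM f g i x : derivable f x (unit_vec R i) ->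
  derivable g x (unit_vec R i) ->
  pderiv i (fun y => f y * g y) x = f x * pderiv i g x + g x * pderiv i f x.
Proof. exact: deriveM. Qed.

Lemma pderivD_on D f g i : C1on D f -> C1on D g -> forall x, D x ->
  pderiv i (fun y => f y + g y) x = pderiv i f x + pderiv i g x.
Proof.
move=> Cf Cg x Dx; apply: pderivD; first by case: (Cf x Dx) => _ /(_ i)[].
by case: (Cg x Dx) => _ /(_ i)[].
Qed.

Lemma pderivM_on D f g i : C1on D f -> C1on D g -> forall x, D x ->
  pderiv i (fun y => f y * g y) x = f x * pderiv i g x + g x * pderiv i f x.
Proof.
move=> Cf Cg x Dx; apply: pderivM; first by case: (Cf x Dx) => _ /(_ i)[].
by case: (Cg x Dx) => _ /(_ i)[].
Qed.

Lemma C1onD D f g : open D -> C1on D f -> C1on D g -> C1on D (fun y => f y + g y).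
Proof.
move=> oD Cf Cg x Dx; have [cf df] := Cf x Dx; have [cg dg] := Cg x Dx; split.
  exact (cont_add cf cg).
move=> i; have [dfi cfi] := df i; have [dgi cgi] := dg i; split.
  exact (deriv_add dfi dgi).
apply: (@continuous_eq_on D (fun y => pderiv i f y + pderiv i g y)) => //.
  by move=> y Dy; rewrite (pderivD_on _ Cf Cg).
exact (cont_add cfi cgi).
Qed.

Lemma C1onM D f g : open D -> C1on D f -> C1on D g -> C1on D (fun y => f y * g y).
Proof.
move=> oD Cf Cg x Dx; have [cf df] := Cf x Dx; have [cg dg] := Cg x Dx; split.
  exact (cont_mul cf cg).
move=> i; have [dfi cfi] := df i; have [dgi cgi] := dg i; split.
  exact (deriv_mul dfi dgi).
apply: (@continuous_eq_on D (fun y => f y * pderiv i g y + g y * pderiv i f y)) => //.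
  by move=> y Dy; rewrite (pderivM_on _ Cf Cg).
exact (cont_add (cont_mul cf cgi) (cont_mul cg cfi)).
Qed.

Lemma C2onD D f g : open D -> C2on D f -> C2on D g -> C2on D (fun y => f y + g y).
Proof.
move=> oD [Cf C2f] [Cg C2g]; split; first exact: C1onD.
move=> i; apply: C1on_eq (C1onD oD (C2f i) (C2g i)) => // x Dx.
by rewrite (pderivD_on _ Cf Cg).
Qed.

Lemma C2onM D f g : open D -> C2on D f -> C2on D g -> C2on D (fun y => f y * g y).
Proof.
move=> oD [Cf C2f] [Cg C2g]; split; first exact: C1onM.
move=> i; apply: C1on_eq (C1onD oD (C1onM oD Cf (C2g i)) (C1onM oD Cg (C2f i))) => //.
by move=> x Dx; rewrite (pderivM_on _ Cf Cg).
Qed.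

Lemma C2on_sum D (I : Type) (r : seq I) (f : I -> 'rV[R]_n -> R) : open D ->
  (forall i, C2on D (f i)) -> C2on D (fun y => \sum_(i <- r) f i y).
Proof.
move=> oD Cf; elim: r => [|i r IH].
  rewrite (_ : (fun y => _) = fun=> 0); first exact: C2on_cst.
  by apply/funext => y; rewrite big_nil.
have -> : (fun y => \sum_(j <- i :: r) f j y) = (fun y => f i y + \sum_(j <- r) f j y).
  by apply/funext => y; rewrite big_cons.
exact: (C2onD oD (Cf i) IH).
Qed.

Lemma pderiv_comp (g : R -> R) (dg : R) f i x : derivable f x (unit_vec R i) ->
  is_derive (f x) 1 g dg ->
  is_derive x (unit_vec R i) (fun y => g (f y)) (dg * pderiv i f x).
Proof. by move=> /derivableP df dgx; exact: is_derive_comp. Qed.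

Lemma C1on_comp D (g g' : R -> R) f : open D -> C1on D f ->
  (forall x, D x -> is_derive (f x) 1 g (g' (f x)) /\ {for f x, continuous g'}) ->
  C1on D (fun y => g (f y)) /\
  forall i x, D x -> pderiv i (fun y => g (f y)) x = g' (f x) * pderiv i f x.
Proof.
move=> oD Cf Hg.
have dE i x : D x -> is_derive x (unit_vec R i) (fun y => g (f y)) (g' (f x) * pderiv i f x).
  move=> Dx; apply: pderiv_comp; last by case: (Hg x Dx).
  by have [_ /(_ i)[]] := Cf x Dx.
split; last by move=> i x /(dE i)[_ <-].
move=> x Dx; have [cf df] := Cf x Dx; have [dgx cg'] := Hg x Dx; split.
  have cg : {for f x, continuous g}.
    by apply: differentiable_continuous; apply/derivable1_diffP; case: dgx.
  exact (continuous_comp cf cg).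
move=> i; split; first by case: (dE i x Dx).
apply: (@continuous_eq_on D (fun y => g' (f y) * pderiv i f y)) => //.
  by move=> y /(dE i)[_ <-].
have [_ cfi] := df i.
exact (cont_mul (continuous_comp cf cg') cfi).
Qed.

Lemma C2on_comp D (g g' g'' : R -> R) f : open D -> C2on D f ->
  (forall x, D x -> is_derive (f x) 1 g (g' (f x))) ->
  (forall x, D x -> is_derive (f x) 1 g' (g'' (f x)) /\ {for f x, continuous g''}) ->
  C2on D (fun y => g (f y)).
Proof.
move=> oD [Cf C2f] Hg Hg'.
have [|C1 dE] := C1on_comp oD Cf (g := g) (g' := g').
  move=> x Dx; split; first exact: Hg.
  apply: differentiable_continuous.
  by apply/derivable1_diffP; have [[]] := Hg' x Dx.
split; [exact C1|move=> i].
have [C1' _] := C1on_comp oD Cf Hg'.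
apply: (C1on_eq oD _ (C1onM oD C1' (C2f i))).
by move=> y Dy; rewrite dE.
Qed.

Lemma is_derive_coord i j (x : 'rV[R]_n) :
  is_derive x (unit_vec R i) (fun y : 'rV[R]_n => y ord0 j) (j == i)%:R.
Proof.
by apply: is_derive_affine => h; rewrite /unit_vec !mxE addrC.
Qed.

Lemma C2on_coord D j : C2on D (fun y : 'rV[R]_n => y ord0 j).
Proof.
have E i : pderiv i (fun y : 'rV[R]_n => y ord0 j) = fun=> (j == i)%:R.
  by apply/funext => x; have [_ <-] := is_derive_coord i j x.
split; [move=> x Dx|by move=> i; rewrite E; exact: C1on_cst].
split; first exact: continuous_coord.
by move=> i; split; [have [] := is_derive_coord i j x|rewrite E; exact: cst_continuous].
Qed.

End C1.

(** * Cutoffs built from hyperplanes *)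

Definition pospow (R : realType) (k : nat) (t : R) : R := Num.max 0 t ^+ k.

Section pospow_lemmas.
Context (R : realType).
Implicit Types t : R.

Lemma pospow_ge0 k t : 0 <= pospow k t.
Proof. by rewrite exprn_ge0// le_max lexx. Qed.

Lemma pospow_le0 k t : t <= 0 -> pospow k.+1 t = 0.
Proof. by move=> t0; rewrite /pospow max_l// expr0n. Qed.

Lemma pospow_ge0E k t : 0 <= t -> pospow k t = t ^+ k.
Proof. by move=> t0; rewrite /pospow max_r. Qed.

Lemma pospow_ge1 k t : 1 <= t -> 1 <= pospow k t.
Proof. by move=> t1; rewrite pospow_ge0E ?exprn_ege1// (le_trans ler01). Qed.

Lemma pospow_le1 k t : t <= 1 -> pospow k t <= 1.
Proof. by move=> t1; rewrite exprn_ile1// ?le_max ?lexx// ge_max ler01. Qed.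

Lemma continuous_pospow k : continuous (@pospow R k).
Proof.
move=> t; have cm : {for t, continuous (fun s : R => Num.max 0 s)}.
  by apply: cvg_maxr; [exact: cvg_cst|exact: cvg_id].
exact (continuous_comp cm (@exprn_continuous R k _)).
Qed.

(** At 0 the difference quotient is bounded by a lower power, which tends to 0. *)
Lemma is_derive_pospow k t :
  is_derive t 1 (@pospow R k.+2) (k.+2%:R * pospow k.+1 t).
Proof.
have [t0|t0|->] := ltgtP t 0.
- rewrite pospow_le0 ?mulr0 ?(ltW t0)//.
  apply: (@near_eq_is_derive _ _ _ (cst 0)).
  near=> s; rewrite /= pospow_le0//; near: s.
  by apply: filterS (open_nbhs_nbhs (conj (@open_lt R 0) t0)) => s /ltW.
- rewrite pospow_ge0E ?(ltW t0)//.
  apply: (@near_eq_is_derive _ _ _ (fun s : R => s ^+ k.+2)).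
    near=> s; rewrite pospow_ge0E//; near: s.
    by apply: filterS (open_nbhs_nbhs (conj (@open_gt R 0) t0)) => s /ltW.
  split; first exact: exprn_derivable.
  by rewrite exp_derive; exact: mulr1.
have E : (fun h : R => h^-1 *: (pospow k.+2 (h *: 1 + 0) - pospow k.+2 0)) =
    (fun h : R => h^-1 * pospow k.+2 h).
  by apply/funext => h; rewrite [h%:A]mulr1 addr0 (pospow_le0 k.+1 (lexx 0)) subr0.
have H : (h^-1 * pospow k.+2 h) @[h --> (0:R)^'] --> (0 : R).
  apply: norm_cvg0.
  have c1 : (pospow k.+1 h) @[h --> (0:R)^'] --> (0 : R).
    have c0 := @continuous_pospow k.+1 0.
    rewrite /continuous_at (pospow_le0 k (lexx 0)) in c0.
    exact: cvg_within_filter c0.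
  apply: (@squeeze_cvgr _ _ _ _ (cst 0) (@pospow R k.+1)) => //; last exact: cvg_cst.
  near=> h; rewrite normr_ge0/=.
  have h0 : h != 0 by near: h; exact: nbhs_dnbhs_neq.
  have [hp|hn] := leP h 0; first by rewrite !pospow_le0// mulr0 normr0.
  by rewrite !pospow_ge0E ?(ltW hn)// exprS mulKf// ger0_norm// exprn_ge0// ltW.
rewrite (pospow_le0 k (lexx 0)) mulr0; split.
  by apply/cvg_ex; exists 0; rewrite /= E.
by rewrite /derive /= E; apply/cvg_lim.
Unshelve. all: by end_near. Qed.

End pospow_lemmas.

Lemma C2on_pospow (R : realType) (n k : nat) (D : set 'rV[R]_n) f :
  open D -> C2on D f -> C2on D (fun x => pospow k.+3 (f x)).
Proof.
move=> oD Cf.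
apply: (@C2on_comp _ _ _ _ (fun t => k.+3%:R * pospow k.+2 t)
  (fun t => k.+3%:R * (k.+2%:R * pospow k.+1 t)) _ oD Cf) => x Dx.
  exact: is_derive_pospow.
split; first exact (@is_deriveZ R R R (@pospow R k.+2) k.+3%:R _ 1 _ (@is_derive_pospow R k _)).
apply: cont_mul; first exact: cst_continuous.
by apply: cont_mul; [exact: cst_continuous|exact: continuous_pospow].
Qed.

Section cutoff.
Context (R : realType) (n : nat).
Local Notation V := 'rV[R]_n.
Implicit Types (l : seq (V * V)) (j : V * V) (x : V).

(** A hyperplane is encoded by a point [j.1] on it and an outer normal [j.2]; for a
    unit normal this is the signed distance, positive inside. *)
Definition depth j x : R := dot j.2 (j.1 - x).

Lemma depthB j x y : depth j y - depth j x = dot j.2 (x - y).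
Proof. by rewrite /depth !dotBr; ring. Qed.

Lemma C2on_depth j : C2on setT (depth j).
Proof.
rewrite (_ : depth j = fun x => \sum_i j.2 ord0 i * (j.1 ord0 i + -1 * x ord0 i)).
  apply: C2on_sum => [|i]; first exact: openT.
  apply: C2onM; [exact: openT|exact: C2on_cst|].
  apply: C2onD; [exact: openT|exact: C2on_cst|].
  by apply: C2onM; [exact: openT|exact: C2on_cst|exact: C2on_coord].
by apply/funext => x; apply: eq_bigr => i _; rewrite !mxE mulN1r.
Qed.

(** At least 1 at points of depth at most [theta] below some hyperplane of [l], and
    0 at points of depth at least [2 * theta] below all of them.  The third powers,
    here and in [cutoff], make the cutoffs twice continuously differentiable. *)
Definition penalty l (theta : R) x : R :=
  \sum_(j <- l) pospow 3 (2 - depth j x / theta).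

Definition cutoff l (theta : R) x : R := pospow 3 (1 - penalty l theta x).

Lemma penalty_ge0 l theta x : 0 <= penalty l theta x.
Proof. by apply: sumr_ge0 => j _; exact: pospow_ge0. Qed.

Lemma cutoff_ge0 l theta x : 0 <= cutoff l theta x.
Proof. exact: pospow_ge0. Qed.

Lemma cutoff_le1 l theta x : cutoff l theta x <= 1.
Proof. by apply: pospow_le1; rewrite lerBlDr lerDl penalty_ge0. Qed.

Lemma cutoff_shallow l theta x j : 0 < theta -> j \in l -> depth j x <= theta ->
  cutoff l theta x = 0.
Proof.
move=> t0 jl jx; rewrite /cutoff pospow_le0// subr_le0 /penalty (big_rem j)//=.
rewrite -[leLHS]addr0 lerD//; last by apply: sumr_ge0 => k _; exact: pospow_ge0.
apply: pospow_ge1; have : depth j x / theta <= 1 by rewrite ler_pdivrMr ?mul1r.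
lra.
Qed.

Lemma cutoff_deep l theta x : 0 < theta ->
  (forall j, j \in l -> 2 * theta <= depth j x) -> cutoff l theta x = 1.
Proof.
move=> t0 H; rewrite /cutoff /penalty big_seq big1 ?subr0 ?pospow_ge0E ?expr1n//.
move=> j jl; rewrite pospow_le0// subr_le0 ler_pdivlMr//; exact: H.
Qed.

Let C2on_scaled j (theta : R) : C2on setT (fun x => 2 - depth j x / theta).
Proof.
rewrite (_ : (fun x => _) = fun x => 2 + depth j x * - theta^-1).
  apply: C2onD; [exact: openT|exact: C2on_cst|].
  by apply: C2onM; [exact: openT|exact: C2on_depth|exact: C2on_cst].
by apply/funext => x; rewrite mulrN.
Qed.

Lemma C2on_penalty l theta : C2on setT (penalty l theta).
Proof.
apply: C2on_sum => [|j]; first exact: openT.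
by apply: C2on_pospow; [exact: openT|exact: C2on_scaled].
Qed.

Lemma C2on_cutoff l theta : C2on setT (cutoff l theta).
Proof.
apply: C2on_pospow; first exact: openT.
rewrite (_ : (fun x => _) = fun x => 1 + -1 * penalty l theta x).
  apply: C2onD; [exact: openT|exact: C2on_cst|].
  by apply: C2onM; [exact: openT|exact: C2on_cst|exact: C2on_penalty].
by apply/funext => x; rewrite mulN1r.
Qed.

(** The gradient of a cutoff is minus the combination of the normals with these
    nonnegative weights; only hyperplanes at depth below [2 * theta] contribute. *)
Definition cutoff_weight l (theta : R) x j : R :=
  3 * pospow 2 (1 - penalty l theta x) *
  (3 * pospow 2 (2 - depth j x / theta) / theta).

Lemma cutoff_weight_ge0 l theta x j : 0 < theta -> 0 <= cutoff_weight l theta x j.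
Proof.
move=> t0; have := @pospow_ge0 R; rewrite /cutoff_weight => pp.
by apply: mulr_ge0; [exact: mulr_ge0|apply: divr_ge0; [exact: mulr_ge0|exact: ltW]].
Qed.

Lemma cutoff_weight_eq0 l theta x j : 0 < theta -> 2 * theta <= depth j x ->
  cutoff_weight l theta x j = 0.
Proof.
move=> t0 jx; rewrite /cutoff_weight (@pospow_le0 _ 1 (2 - _)) ?mulr0 ?mul0r ?mulr0//.
by rewrite subr_le0 ler_pdivlMr.
Qed.

Let is_derive_scaled j theta i x : is_derive x (unit_vec R i)
  (fun y => 2 - depth j y / theta) (j.2 ord0 i / theta).
Proof.
apply: is_derive_affine => h.
have : depth j (h *: unit_vec R i + x) = depth j x + h * - j.2 ord0 i.
  rewrite {1}/depth; have -> : dot j.2 (j.1 - (h *: unit_vec R i + x)) =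
      dot j.2 (j.1 - x) - h * dot j.2 (unit_vec R i).
    by rewrite -dotZr -dotBr; congr (dot _ _); rewrite opprD addrCA addrC.
  rewrite mulrN; congr (_ - _ * _).
  by rewrite /dot (bigD1 i)//= /unit_vec mxE !eqxx mulr1 big1 ?addr0// => k ki;
    rewrite mxE (negbTE ki) andbF mulr0.
by move=> ->; ring.
Qed.

Lemma pderiv_cutoff l theta i x :
  pderiv i (cutoff l theta) x =
  - \sum_(j <- l) cutoff_weight l theta x j * j.2 ord0 i.
Proof.
have dp : is_derive x (unit_vec R i) (penalty l theta)
    (\sum_(j <- l) (3 * pospow 2 (2 - depth j x / theta)) * (j.2 ord0 i / theta)).
  rewrite /penalty; elim: l => [|j l IH].
    rewrite big_nil (_ : (fun y => _) = cst 0); last first.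
      by apply/funext => y; rewrite big_nil.
    exact: is_derive_cst.
  rewrite big_cons (_ : (fun y => _) = (fun y => pospow 3 (2 - depth j y / theta)) +
      (fun y => \sum_(k <- l) pospow 3 (2 - depth k y / theta))); last first.
    by apply/funext => y; rewrite big_cons.
  apply: is_deriveD.
  exact (is_derive_comp (is_derive_scaled j theta i x) (is_derive_pospow 1 _)).
have d1 : is_derive x (unit_vec R i) (fun y => 1 - penalty l theta y)
    (- \sum_(j <- l) (3 * pospow 2 (2 - depth j x / theta)) * (j.2 ord0 i / theta)).
  by rewrite -[X in is_derive _ _ _ X]sub0r; exact (is_deriveB (is_derive_cst (1 : R) _ _) dp).
have [_ ] := is_derive_comp d1 (is_derive_pospow 1 _).
rewrite /pderiv => ->; rewrite mulrN mulr_sumr; congr (- _).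
by apply: eq_bigr => j _; rewrite /cutoff_weight; ring.
Qed.

End cutoff.

(** * The divergence theorem for tangential fields *)

Section extension.
Context (R : realType) (n : nat) (Omega K : set 'rV[R]_n).
Hypotheses (oO : open Omega) (cK : closed K) (KO : K `<=` Omega).
Variable f : 'rV[R]_n -> R.
Hypothesis f0 : forall x, Omega x -> ~ K x -> f x = 0.

Let oK : open (~` K). Proof. exact: closed_openC. Qed.

Lemma patch_in x : Omega x -> (f \_ Omega) x = f x.
Proof. by move=> Ox; rewrite patchE mem_set. Qed.

Lemma patch_off x : ~ K x -> (f \_ Omega) x = 0.
Proof.
move=> Kx; rewrite patchE; case: ifPn => // /set_mem Ox; exact: f0.
Qed.

Let coverT : Omega `|` ~` K = setT.
Proof.
by apply/seteqP; split=> // x _; have [/KO|] := pselect (K x); [left|right].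
Qed.

Lemma C1on_patch : C1on Omega f -> C1on setT (f \_ Omega).
Proof.
move=> Cf; rewrite -coverT; apply: C1onU.
  by apply: (C1on_eq oO _ Cf) => x Ox; rewrite patch_in.
by apply: (C1on_eq oK _ (C1on_cst (D := ~` K) 0)) => x Kx; rewrite patch_off.
Qed.

Lemma C2on_patch : C2on Omega f -> C2on setT (f \_ Omega).
Proof.
move=> Cf; rewrite -coverT; apply: C2onU.
  by apply: (C2on_eq oO _ Cf) => x Ox; rewrite patch_in.
by apply: (C2on_eq oK _ (C2on_cst (~` K) 0)) => x Kx; rewrite patch_off.
Qed.

Hypothesis bK : bounded_set Omega.
Hypothesis Cf : C1on Omega f.

Let mu := @lebesgue_rV R n.

Let pderiv_patch i : pderiv i (f \_ Omega) = (pderiv i f) \_ Omega.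
Proof.
apply/funext => x; have [Ox|NOx] := pselect (Omega x).
  rewrite [RHS]patchE mem_set//.
  exact: (@pderiv_eq_on _ _ Omega (f \_ Omega) f i oO patch_in x Ox).
rewrite [RHS]patchE memNset//.
have NKx : (~` K) x by move=> /KO.
rewrite (@pderiv_eq_on _ _ (~` K) _ (fun=> 0) _ oK _ x NKx) ?pderiv_cst//.
by move=> y; exact: patch_off.
Qed.

Let support_cube : exists2 M : R, 0 < M & Omega `<=` cube n M.
Proof. exact: bounded_set_cube. Qed.

Lemma integrable_pderiv_cpt i : mu.-integrable Omega (EFin \o pderiv i f).
Proof.
have [M M0 OM] := support_cube.
apply/(integrable_mkcond _ (open_measurable_rV oO)).
rewrite restrict_EFin -pderiv_patch.
apply: (@continuous_cpt_support_integrable _ _ _ M).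
  by move=> x; have [_ /(_ i)[]] := C1on_patch Cf (I : setT x).
move=> x NM; rewrite pderiv_patch patchE memNset// => /OM.
exact: NM.
Qed.

Lemma Rintegral_pderiv_cpt i : \int[mu]_(x in Omega) pderiv i f x = 0.
Proof.
have [M M0 OM] := support_cube.
rewrite Rintegral_mkcond -pderiv_patch /Rintegral.
rewrite (@integral_pderiv_cpt_support _ _ _ _ M)//.
- move=> x NM; rewrite patchE memNset// => /OM; exact: NM.
- by move=> x; have [_ /(_ i)[]] := C1on_patch Cf (I : setT x).
- by move=> x; have [_ /(_ i)[]] := C1on_patch Cf (I : setT x).
Qed.

End extension.

Lemma Rintegral_sum d (T : measurableType d) (R : realType)
    (mu : {measure set T -> \bar R}) (D : set T) (I : Type) (r : seq I)
    (f : I -> T -> R) : measurable D ->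
  (forall i, mu.-integrable D (EFin \o f i)) ->
  mu.-integrable D (EFin \o (fun x => \sum_(i <- r) f i x)) /\
  \int[mu]_(x in D) (\sum_(i <- r) f i x) = \sum_(i <- r) \int[mu]_(x in D) f i x.
Proof.
move=> mD fi; elim: r => [|i r [IH1 IH2]].
  have -> : (fun x => \sum_(i <- [::]) f i x) = cst 0.
    by apply/funext => x; rewrite big_nil.
  split; first exact: integrable0.
  by rewrite big_nil Rintegral_cst// mul0r.
have -> : (fun x => \sum_(j <- i :: r) f j x) = (fun x => f i x + \sum_(j <- r) f j x).
  by apply/funext => x; rewrite big_cons.
split; last by rewrite big_cons RintegralD// IH2.
exact: (integrableD mD (fi i) IH1).
Qed.

Section covers.
Context (R : realType) (n : nat) (Omega : set 'rV[R]_n).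
Hypothesis hO : bounded_convex_smooth_domain Omega.
Local Notation V := 'rV[R]_n.
Implicit Types (l : seq (V * V)).

Definition covers_frontier l (theta : R) :=
  forall p, frontier Omega p -> exists2 j, j \in l & depth j p < theta.

Definition supporting_planes l :=
  forall j, j \in l -> closure Omega j.1 /\ supports Omega j.1 j.2.

Let continuous_depth (j : V * V) : continuous (depth j).
Proof. by move=> x; have [/(_ x I)[]] := C2on_depth j. Qed.

(** The regions of depth less than [theta] below the supporting hyperplanes at the
    boundary points are open and cover the boundary, which is compact. *)
Lemma frontier_cover (theta : R) : 0 < theta ->
  exists2 l, supporting_planes l & covers_frontier l theta.
Proof.
move=> t0.
have cF : compact (frontier Omega).
  apply: subclosed_compact (compact_closure_bounded (domain_bounded hO)) _.
    by apply: closedI; exact: closed_closure.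
  by move=> x [].
move: cF; rewrite compact_cover => cF.
pose D : set (V * V) := [set j | closure Omega j.1 /\ supports Omega j.1 j.2].
have [||D' D'D cov] := cF _ D (fun j => [set x | depth j x < theta]).
- move=> j _; rewrite (_ : [set x | _] = depth j @^-1` [set x | x < theta])//.
  by apply: open_comp => [x _|]; [exact: continuous_depth|exact: open_lt].
- move=> p Fp; have [nu snu] := frontier_supports hO Fp; exists (p, nu) => /=.
    by split=> //=; case: Fp.
  by rewrite /depth/= subrr /dot big1// => i _; rewrite mxE mulr0.
exists (finmap.enum_fset D') => [j jD'|p /cov[j jD' jp]]; last by exists j.
by have := D'D j jD'; rewrite inE.
Qed.

(** A point of the closure at depth at least [theta] below all hyperplanes is not a
    boundary point, since the regions of smaller depth cover the boundary. *)
Lemma cutoff_support l (theta : R) : 0 < theta -> covers_frontier l theta ->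
  exists K, [/\ compact K, K `<=` Omega &
    forall x, Omega x -> ~ K x -> cutoff l theta x = 0].
Proof.
move=> t0 cov.
pose K := closure Omega `&`
  \bigcap_(j in [set` l]) (depth j @^-1` [set y | theta <= y]).
exists K; split.
- apply: subclosed_compact (compact_closure_bounded (domain_bounded hO)) _.
    apply: closedI; first exact: closed_closure.
    apply: closed_bigI => j _; apply: preimage_closed; last exact: closed_ge.
    by move=> x _; exact: continuous_depth.
  by move=> x [].
- move=> x [cx Hx]; apply: contrapT => NOx.
  have /cov[j jl] : frontier Omega x.
    by apply/(frontier_openP _ (domain_open hO)).
  by rewrite ltNge => /negP; apply; exact: (Hx j jl).
- move=> x Ox NK; have [j jl jx] : exists2 j, j \in l & depth j x < theta.
    apply: contrapT => H; apply: NK; split; first exact: subset_closure.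
    move=> j jl /=; rewrite leNgt; apply/negP => jx; apply: H.
    by exists j.
  exact: cutoff_shallow t0 jl (ltW jx).
Qed.

(** A ball around the interior point lies in the domain, and its extreme point in
    the direction of the normal has not crossed the hyperplane. *)
Lemma depth_interior x0 : Omega x0 -> exists2 r : R, 0 < r &
  forall p nu, supports Omega p nu -> r <= depth (p, nu) x0.
Proof.
move=> Ox0.
have /nbhs_ballP[e /= e0 eO] : nbhs x0 Omega.
  by apply: open_nbhs_nbhs; split => //; exact: domain_open hO.
exists (e / 2); first by rewrite divr_gt0.
move=> p nu [nu1 H]; have : Omega (x0 + (e / 2) *: nu).
  apply: eO; apply/ball_rVP => // i; rewrite !mxE opprD addrA subrr sub0r normrN.
  rewrite normrM ger0_norm ?divr_ge0 ?ltW//.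
  have : `|nu ord0 i| <= 1 by exact: unit_coord_le1.
  have e2 : 0 < e / 2 by rewrite divr_gt0.
  move=> /(ler_wpM2l (ltW e2)); rewrite mulr1 => /le_lt_trans; apply.
  by rewrite ltr_pdivrMr// ltr_pMr// ltr1n.
move=> /H; rewrite dotBr dotDr dotZr nu1 mulr1 /depth/= dotBr; lra.
Qed.

End covers.

Lemma Rintegral_dominated d (T : measurableType d) (R : realType)
    (mu : {measure set T -> \bar R}) (D : set T) (f_ : nat -> T -> R)
    (f g : T -> R) : measurable D ->
  (forall k, measurable_fun D (f_ k)) -> measurable_fun D f ->
  (forall x, D x -> f_ ^~ x @ \oo --> f x) ->
  mu.-integrable D (EFin \o g) ->
  (forall k x, D x -> `|f_ k x| <= g x) ->
  \int[mu]_(x in D) f_ k x @[k --> \oo] --> \int[mu]_(x in D) f x.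
Proof.
move=> mD mf_ mf ff ig fg.
have [|||||intf _ cf] := @dominated_convergence _ T R mu D mD
    (fun k => EFin \o f_ k) (EFin \o f) (EFin \o g).
- by move=> k; apply/measurable_EFinP.
- exact/measurable_EFinP.
- by apply: aeW => x Dx; apply: cvg_EFin; [exact: nearW|exact: ff].
- exact: ig.
- by apply: aeW => x k Dx; rewrite /= lee_fin fg.
apply: fine_cvg; rewrite fineK//; exact: integrable_fin_num.
Qed.

Section divergence.
Context (R : realType) (n : nat) (Omega : set 'rV[R]_n).
Hypothesis hO : bounded_convex_smooth_domain Omega.
Local Notation V := 'rV[R]_n.
Local Notation mu := (@lebesgue_rV R n).
Variables (F h : 'I_n -> V -> R) (B : R).
Hypothesis CF : forall i, C1on Omega (F i).
Hypothesis ch : forall i, {within closure Omega, continuous (h i)}.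
Hypothesis Fh : forall i x, Omega x -> F i x = h i x.
Hypothesis h_tangential : forall x nu, frontier Omega x ->
  outward_unit_normal Omega x nu -> \sum_i nu ord0 i * h i x = 0.

Let divF x := \sum_i pderiv i (F i) x.
Hypothesis divB : forall x, Omega x -> `|divF x| <= B.

Let oO := domain_open hO.
Let bO := domain_bounded hO.
Let mO : measurable Omega := open_measurable_rV oO.
Let muO : (mu Omega < +oo)%E. Proof. exact: lebesgue_rV_bounded_lty. Qed.

Let C1cutoff l theta : C1on Omega (cutoff l theta).
Proof. by have [C _] := C2on_cutoff l theta; apply: C1onS C. Qed.

Let cont_divF x : Omega x -> {for x, continuous divF}.
Proof.
by move=> Ox; apply: continuous_sumr => i; have [_ /(_ i)[]] := CF i Ox.
Qed.

Let int_divF : mu.-integrable Omega (EFin \o divF).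
Proof. exact: bounded_continuous_integrable oO bO cont_divF divB. Qed.

Let int_cutoff_divF l theta :
  mu.-integrable Omega (EFin \o (fun x => cutoff l theta x * divF x)).
Proof.
apply: (@bounded_continuous_integrable _ _ _ _ B oO bO) => x Ox.
  by apply: cont_mul; [have [] := C1cutoff l theta Ox|exact: cont_divF].
rewrite normrM -[leRHS]mul1r ler_pM ?normr_ge0 ?divB//.
by rewrite ger0_norm ?cutoff_ge0// cutoff_le1.
Qed.

Let int_cutoff l theta : mu.-integrable Omega (EFin \o cutoff l theta).
Proof.
apply: (@bounded_continuous_integrable _ _ _ _ 1 oO bO) => x Ox.
  by have [] := C1cutoff l theta Ox.
by rewrite ger0_norm ?cutoff_ge0// cutoff_le1.
Qed.

Variables (x0 : V) (r : R).
Hypotheses (Ox0 : Omega x0) (r0 : 0 < r).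
Hypothesis depth_x0 : forall p nu, supports Omega p nu -> r <= depth (p, nu) x0.

Section one_cutoff.
Variables (l : seq (V * V)) (theta eta : R).
Hypotheses (t0 : 0 < theta) (eta0 : 0 < eta) (tr : 2 * theta <= r / 2).
Hypothesis sl : supporting_planes Omega l.
Hypothesis cl : covers_frontier Omega l theta.
Hypothesis Hl : forall x j, j \in l -> Omega x -> depth j x < 2 * theta ->
  `|\sum_i j.2 ord0 i * F i x| < eta.

Let chi := cutoff l theta.
Let w := cutoff_weight l theta.
Let flux x := \sum_i F i x * pderiv i chi x.
Let radial (x : V) := - \sum_i (x ord0 i - x0 ord0 i) * pderiv i chi x.

(* Both sides are combinations of the normals with the same weights.  At a hyperplane
   with nonzero weight the field contributes less than [eta], while
   [dot j.2 (x - x0)], the difference of the depths of [x0] and [x], is at least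
   [r - 2 * theta >= r / 2]. *)
Let flux_radial x : Omega x -> `|flux x| <= (2 * eta / r) * radial x.
Proof.
move=> Ox.
have -> : flux x = - \sum_(j <- l) w x j * \sum_i j.2 ord0 i * F i x.
  rewrite /flux; under eq_bigr do rewrite pderiv_cutoff mulrN mulr_sumr.
  rewrite sumrN exchange_big/=; congr (- _); apply: eq_bigr => j _.
  by rewrite mulr_sumr; apply: eq_bigr => i _; rewrite /w; ring.
have -> : radial x = \sum_(j <- l) w x j * dot j.2 (x - x0).
  rewrite /radial; under eq_bigr do rewrite pderiv_cutoff mulrN mulr_sumr.
  rewrite sumrN opprK exchange_big/=; apply: eq_bigr => j _.
  by rewrite /dot mulr_sumr; apply: eq_bigr => i _; rewrite !mxE /w; ring.
rewrite normrN mulr_sumr big_seq [leRHS]big_seq; apply: le_trans (ler_norm_sum _ _ _) _.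
apply: ler_sum => j jl.
rewrite normrM ger0_norm ?cutoff_weight_ge0// mulrCA.
have [far|near_j] := leP (2 * theta) (depth j x).
  by rewrite /w cutoff_weight_eq0// !mul0r.
apply: ler_wpM2l; first exact: cutoff_weight_ge0.
apply: le_trans (ltW (Hl jl Ox near_j)) _.
have r2 : r / 2 <= dot j.2 (x - x0).
  have dj : r <= depth j x0.
    by rewrite [j]surjective_pairing; exact: depth_x0 (sl jl).2.
  rewrite -depthB; move: tr near_j dj; lra.
move: (dot _ _) r2 => d r2; have -> : 2 * eta / r * d = eta * (2 * d / r) by ring.
rewrite ler_peMr ?(ltW eta0)// ler_pdivlMr// mul1r; lra.
Qed.

(** Two fields with compact support are integrated: [chi F], which moves the
    derivative from the field to the cutoff, and [chi (x - x0)], whose divergence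
    [n chi - radial] makes the integral of [radial] bounded by [n |Omega|]
    independently of the width of the layer. *)
Lemma Rintegral_cutoff_div :
  `|\int[mu]_(x in Omega) (chi x * divF x)| <=
  (2 * eta / r) * (n%:R * fine (mu Omega)).
Proof.
have [K [cK KO K0]] := cutoff_support hO t0 cl.
have cK' : closed K by apply: compact_closed => //; exact: norm_hausdorff.
pose E i (x : V) := F i x * chi x.
pose Y i (x : V) := (x ord0 i + - x0 ord0 i) * chi x.
have CE i : C1on Omega (E i) by exact: (C1onM oO (CF i) (C1cutoff l theta)).
have Cc i : C1on Omega (fun x : V => x ord0 i + - x0 ord0 i).
  have [C _] := @C2on_coord R n Omega i.
  exact: (C1onD oO C (@C1on_cst R n Omega _)).
have CY i : C1on Omega (Y i) by exact: (C1onM oO (Cc i) (C1cutoff l theta)).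
have E0 i x : Omega x -> ~ K x -> E i x = 0.
  by move=> Ox NK; rewrite /E /chi K0// mulr0.
have Y0 i x : Omega x -> ~ K x -> Y i x = 0.
  by move=> Ox NK; rewrite /Y /chi K0// mulr0.
have iE i := integrable_pderiv_cpt oO cK' KO (@E0 i) bO (CE i) i.
have iY i := integrable_pderiv_cpt oO cK' KO (@Y0 i) bO (CY i) i.
pose SE (x : V) := \sum_i pderiv i (E i) x.
pose SY (x : V) := \sum_i pderiv i (Y i) x.
have [isE sE] : mu.-integrable Omega (EFin \o SE) /\ \int[mu]_(x in Omega) SE x = 0.
  have [-> ->] := Rintegral_sum (index_enum 'I_n) mO iE; split=> //.
  by rewrite big1// => i _; exact: (Rintegral_pderiv_cpt oO cK' KO (@E0 i) bO (CE i)).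
have [isY sY] : mu.-integrable Omega (EFin \o SY) /\ \int[mu]_(x in Omega) SY x = 0.
  have [-> ->] := Rintegral_sum (index_enum 'I_n) mO iY; split=> //.
  by rewrite big1// => i _; exact: (Rintegral_pderiv_cpt oO cK' KO (@Y0 i) bO (CY i)).
have fluxE x : Omega x -> flux x = SE x - chi x * divF x.
  move=> Ox; rewrite /SE /divF mulr_sumr -sumrB; apply: eq_bigr => i _.
  by rewrite (pderivM_on _ (CF i) (C1cutoff l theta) Ox) addrK.
have pc i x : pderiv i (fun x : V => x ord0 i + - x0 ord0 i) x = 1.
  have dc := is_derive_coord i i x; have dk := is_derive_cst (- x0 ord0 i : R) x (unit_vec R i).
  have [_] := is_deriveD dc dk; rewrite eqxx addr0; exact.
have radialE x : Omega x -> radial x = n%:R * chi x - SY x.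
  move=> Ox; rewrite /radial /SY.
  under [in RHS]eq_bigr do rewrite (pderivM_on _ (Cc _) (C1cutoff l theta) Ox) pc mulr1.
  rewrite big_split/= sumr_const card_ord mulr_natl opprD addrCA subrr addr0//.
have iflux : mu.-integrable Omega (EFin \o flux).
  apply: eq_integrable (integrableB mO isE (int_cutoff_divF l theta)) => //.
  by move=> x /set_mem Ox /=; rewrite fluxE.
have inchi : mu.-integrable Omega (EFin \o (fun x => n%:R * chi x)).
  exact: (integrableZl mO n%:R (int_cutoff l theta)).
have iradial : mu.-integrable Omega (EFin \o radial).
  apply: eq_integrable (integrableB mO inchi isY) => //.
  by move=> x /set_mem Ox /=; rewrite radialE.
have fluxI : \int[mu]_(x in Omega) flux x = - \int[mu]_(x in Omega) (chi x * divF x).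
  have -> : \int[mu]_(x in Omega) flux x =
      \int[mu]_(x in Omega) (SE x - chi x * divF x).
    by apply: eq_Rintegral => x /set_mem Ox; exact: fluxE.
  by rewrite (RintegralB mO isE (int_cutoff_divF l theta)) sE sub0r.
have radialI : \int[mu]_(x in Omega) radial x = n%:R * \int[mu]_(x in Omega) chi x.
  have -> : \int[mu]_(x in Omega) radial x =
      \int[mu]_(x in Omega) (n%:R * chi x - SY x).
    by apply: eq_Rintegral => x /set_mem Ox; exact: radialE.
  by rewrite (RintegralB mO inchi isY) sY subr0 (RintegralZl _ mO (int_cutoff l theta)).
rewrite -normrN -fluxI; apply: le_trans (le_normr_Rintegral mO iflux) _.
apply: (@le_trans _ _ (\int[mu]_(x in Omega) ((2 * eta / r) * radial x))).
  apply: (le_Rintegral mO (integrable_norm iflux)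
    (integrableZl mO (2 * eta / r) iradial)) => x; exact: flux_radial.
rewrite (RintegralZl _ mO iradial) radialI; apply: ler_wpM2l.
  by rewrite divr_ge0 ?ltW// mulr_gt0.
apply: ler_wpM2l => //.
apply: (@le_trans _ _ (\int[mu]_(x in Omega) 1)).
  apply: (le_Rintegral mO (int_cutoff l theta)) => [|x _]; last exact: cutoff_le1.
    apply: (@bounded_continuous_integrable _ _ _ _ 1 oO bO) => x Ox.
      exact: cst_continuous.
    by rewrite normr1.
by rewrite Rintegral_cst// mul1r.
Qed.

End one_cutoff.
End divergence.

Section exhausting_cutoffs.
Context (R : realType) (n : nat) (Omega : set 'rV[R]_n).
Hypothesis hO : bounded_convex_smooth_domain Omega.
Local Notation V := 'rV[R]_n.
Implicit Types (l e : seq (V * V)).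

Lemma depth_min e x : (forall j, j \in e -> 0 < depth j x) ->
  exists2 m : R, 0 < m & forall j, j \in e -> m <= depth j x.
Proof.
elim: e => [|j e IH] H; first by exists 1.
have [|m m0 mH] := IH; first by move=> k ke; apply: H; rewrite inE ke orbT.
exists (Num.min m (depth j x)); first by rewrite lt_min m0 H// mem_head.
move=> k; rewrite inE => /predU1P[->|/mH mk]; first by rewrite ge_min lexx orbT.
by rewrite ge_min mk.
Qed.

(** The hyperplanes of [l_ k] support the domain, so their depths at [x] are bounded
    below uniformly in [k]; [e] is a fixed finite list of further half-spaces. *)
Lemma cutoff_cvg1 (l_ : nat -> seq (V * V)) (theta_ : nat -> R) e x :
  (forall k, supporting_planes Omega (l_ k)) -> (forall k, 0 < theta_ k) ->
  theta_ @ \oo --> (0 : R) -> Omega x -> (forall j, j \in e -> 0 < depth j x) ->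
  cutoff (l_ k ++ e) (theta_ k) x @[k --> \oo] --> (1 : R).
Proof.
move=> sl t0 tcv Ox He.
have [r r0 rH] := depth_interior hO Ox.
have [m m0 mH] := depth_min He.
have q0 : 0 < Num.min r m / 2 by rewrite divr_gt0// lt_min r0.
apply: (@cvg_trans _ (cst (1 : R) @ \oo)); last exact: cvg_cst.
apply: near_eq_cvg; near=> k; rewrite /= cutoff_deep// => j.
have tk : 2 * theta_ k <= Num.min r m.
  rewrite mulrC -ler_pdivlMr//; apply: ltW; near: k.
  by apply: (cvgr_lt (0 : R)).
rewrite mem_cat => /orP[/sl[_]|/mH mj].
  rewrite [j in depth j]surjective_pairing => /rH; apply: le_trans.
  by apply: le_trans tk _; rewrite ge_min lexx.
by apply: le_trans mj; apply: le_trans tk _; rewrite ge_min lexx orbT.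
Unshelve. all: by end_near. Qed.

Lemma exhausting_covers : exists (l_ : nat -> seq (V * V)),
  (forall k, supporting_planes Omega (l_ k)) /\
  (forall k, covers_frontier Omega (l_ k) (k.+1%:R^-1)).
Proof.
have H k : exists l, supporting_planes Omega l /\
    covers_frontier Omega l (k.+1%:R^-1 : R).
  have [|l sl cl] := @frontier_cover _ _ _ hO (k.+1%:R^-1 : R).
    by rewrite invr_gt0.
  by exists l.
by have [l_ lH] := choice H; exists l_; split=> k; have [] := lH k.
Qed.

End exhausting_cutoffs.

Section divergence_theorem.
Context (R : realType) (n : nat) (Omega : set 'rV[R]_n).
Hypothesis hO : bounded_convex_smooth_domain Omega.
Local Notation V := 'rV[R]_n.
Local Notation mu := (@lebesgue_rV R n).

(** [h] is the continuous extension of [F] to the closure, on which alone the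
    boundary condition makes sense.  The cutoffs of layers of width tending to 0
    converge to 1, while [Rintegral_cutoff_div] makes the integrals tend to 0. *)
Lemma divergence_tangential (F h : 'I_n -> V -> R) (B : R) :
  (forall i, C1on Omega (F i)) ->
  (forall i, {within closure Omega, continuous (h i)}) ->
  (forall i x, Omega x -> F i x = h i x) ->
  (forall x nu, frontier Omega x -> outward_unit_normal Omega x nu ->
     \sum_i nu ord0 i * h i x = 0) ->
  (forall x, Omega x -> `|\sum_i pderiv i (F i) x| <= B) ->
  \int[mu]_(x in Omega) (\sum_i pderiv i (F i) x) = 0.
Proof.
move=> CF ch Fh ht FB.
have oO := domain_open hO; have bO := domain_bounded hO.
have mO := open_measurable_rV oO.
have [x0 Ox0] := domain_nonempty hO.
have [r r0 rH] := depth_interior hO Ox0.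
pose C := 2 / r * (n%:R * fine (mu Omega)).
pose a k : R := k.+1%:R^-1.
have a0 k : 0 < a k by rewrite invr_gt0.
have H k : exists lt : seq (V * V) * R, [/\ supporting_planes Omega lt.1,
    0 < lt.2 <= a k &
    `|\int[mu]_(x in Omega) (cutoff lt.1 lt.2 x * \sum_i pderiv i (F i) x)| <= C * a k].
  have [th th0 thH] := almost_tangential hO ch ht (a0 k).
  pose theta := Num.min (a k) (Num.min (th / 2) (r / 4)).
  have t0 : 0 < theta by rewrite !lt_min a0 !divr_gt0.
  have ta : theta <= a k by rewrite ge_min lexx.
  have tth : theta <= th / 2 by rewrite !ge_min lexx orbT.
  have tr : theta <= r / 4 by rewrite !ge_min lexx !orbT.
  have [l sl cl] := frontier_cover hO t0.
  exists (l, theta); split; rewrite /= ?t0 ?ta//.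
  apply: le_trans (@Rintegral_cutoff_div _ _ _ hO F B CF FB x0 r r0 rH l theta (a k)
    t0 (a0 k) _ sl cl _) _.
  - move: tr; clear; lra.
  - move=> x j jl Ox jx; under eq_bigr do rewrite (Fh _ _ Ox).
    apply: (thH x j.1 j.2) => //; [exact: subset_closure|exact: (sl j jl).1|exact: (sl j jl).2|].
    by apply: lt_le_trans jx _; move: tth; clear; lra.
  - by rewrite /C le_eqVlt; apply/orP; left; apply/eqP; ring.
have [lt ltH] := choice H.
have tcv : (fun k => (lt k).2) @ \oo --> (0 : R).
  apply: (@squeeze_cvgr _ _ _ _ (cst 0) a); last 2 first.
  - exact: cvg_cst.
  - exact: cvg_harmonic.
  by apply: nearW => k; have [_ /andP[/ltW-> ->] _] := ltH k.
pose I k := \int[mu]_(x in Omega) (cutoff (lt k).1 (lt k).2 x * \sum_i pderiv i (F i) x).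
have cdiv x : Omega x -> {for x, continuous (fun x => \sum_i pderiv i (F i) x)}.
  by move=> Ox; apply: continuous_sumr => i; have [_ /(_ i)[]] := CF i x Ox.
have ccut k x : Omega x -> {for x, continuous (cutoff (lt k).1 (lt k).2)}.
  by move=> _; have [/(_ x (Logic.I : setT x))[]] := C2on_cutoff (lt k).1 (lt k).2.
have I1 : I @ \oo --> \int[mu]_(x in Omega) (\sum_i pderiv i (F i) x).
  apply: (@Rintegral_dominated _ _ _ mu Omega _ _ (fun=> B)) => //.
  - move=> k; apply: continuous_on_open_measurable => // x Ox.
    by apply: cont_mul; [exact: ccut|exact: cdiv].
  - exact: continuous_on_open_measurable.
  - move=> x Ox; rewrite -[X in _ --> X]mul1r; apply: cvgM; last exact: cvg_cst.
    have := @cutoff_cvg1 _ _ _ hO (fun k => (lt k).1) (fun k => (lt k).2) [::] x.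
    rewrite (_ : (fun k => cutoff _ _ _) = (fun k => cutoff (lt k).1 (lt k).2 x)).
      apply => // k; first by have [] := ltH k.
      by have [_ /andP[]] := ltH k.
    by apply/funext => k; rewrite cats0.
  - apply: (@bounded_continuous_integrable _ _ _ _ `|B| oO bO) => x Ox.
      exact: cst_continuous.
    by [].
  - move=> k x Ox; rewrite normrM -[leRHS]mul1r ler_pM ?normr_ge0 ?FB//.
    by rewrite ger0_norm ?cutoff_ge0// cutoff_le1.
have I0 : I @ \oo --> (0 : R).
  apply: norm_cvg0; apply: (@squeeze_cvgr _ _ _ _ (cst 0) (fun k => C * a k)).
  - by apply: nearW => k; rewrite normr_ge0/=; have [] := ltH k.
  - exact: cvg_cst.
  - rewrite -[X in _ --> X](mulr0 C); apply: cvgM; first exact: cvg_cst.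
    exact: cvg_harmonic.
exact: (cvg_unique _ I1 I0).
Qed.

End divergence_theorem.

(** * Test functions and the fundamental lemma *)

Section orthants.
Context (R : realType) (n : nat).
Local Notation V := 'rV[R]_n.

Definition orthant (b : V) : set V := [set x | forall i, b ord0 i < x ord0 i].
Definition orthants : set (set V) := [set A | exists b, A = orthant b].

Lemma orthants_setI : setI_closed orthants.
Proof.
move=> _ _ [a ->] [b ->]; exists (\row_i Num.max (a ord0 i) (b ord0 i)).
apply/seteqP; split => [x [ax bx] i|x H]; first by rewrite mxE gt_max ax bx.
by split=> i; have := H i; rewrite mxE gt_max => /andP[].
Qed.

(** A half-space {x_i > a} is the union of the orthants whose other corner
    coordinates are [- k], over all naturals [k]. *)
Lemma measurable_orthants : @measurable _ V = <<s orthants >>.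
Proof.
apply/seteqP; split.
  apply: smallest_sub; first exact: smallest_sigma_algebra.
  move=> A; rewrite -bigcup_seq => -[i /= _ [C mC <-]]; rewrite setTI.
  have mi : @measurable_fun _ _ (g_sigma_algebraType orthants) R setT
      (fun x : V => x ord0 i).
    apply: (measurability _ (RGenOInfty.measurableE R)).
    move=> _ [_ [a ->] <-]; rewrite setTI.
    pose b (k : nat) : V := \row_j (if j == i then a else - k%:R).
    have -> : (fun x : V => x ord0 i) @^-1` `]a, +oo[ = \bigcup_k orthant (b k).
      apply/seteqP; split => [x /=|x [k _ /(_ i)]]; last first.
        by rewrite mxE eqxx /= in_itv/= andbT.
      rewrite in_itv/= andbT => ax.
      pose N := (\max_j (Num.truncn `|x ord0 j|).+1)%N.
      exists N => // j; rewrite mxE; case: eqP => [->//|_].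
      rewrite ltrNl; apply: le_lt_trans (ler_norm _) _; rewrite normrN.
      apply: lt_le_trans (truncnS_gt _) _; rewrite ler_nat.
      exact: (leq_bigmax (F := fun j => (Num.truncn `|x ord0 j|).+1)).
    by apply: bigcupT_measurable => k; apply: sub_sigma_algebra; exists (b k).
  by have := mi measurableT C mC; rewrite setTI.
apply: smallest_sub; first exact: sigma_algebra_measurable.
move=> _ [b ->].
rewrite (_ : orthant b = \bigcap_(i in [set: 'I_n])
    ((fun x : V => x ord0 i) @^-1` `]b ord0 i, +oo[)).
  apply: fin_bigcap_measurable => // i _.
  by rewrite -[X in measurable X]setTI; exact: measurable_coord.
by apply/seteqP; split=> [x bx i _|x bx i];
  [rewrite /= in_itv/= andbT; exact: bx|have := bx i I; rewrite /= in_itv/= andbT].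
Qed.

End orthants.

(** Twice continuous differentiability is what the Laplacian requires, and what the
    cutoffs provide. *)
Definition test_fun (R : realType) (n : nat) (Omega : set 'rV[R]_n)
    (psi : 'rV[R]_n -> R) : Prop :=
  C2on setT psi /\
  exists K, [/\ compact K, K `<=` Omega & forall x, ~ K x -> psi x = 0].

Section fundamental_lemma.
Context (R : realType) (n : nat) (Omega : set 'rV[R]_n).
Hypothesis hO : bounded_convex_smooth_domain Omega.
Local Notation V := 'rV[R]_n.
Local Notation mu := (@lebesgue_rV R n).

Lemma cutoff_test_fun (l : seq (V * V)) theta : 0 < theta ->
  covers_frontier Omega l theta -> test_fun Omega (cutoff l theta \_ Omega).
Proof.
move=> t0 cl; have [K [cK KO K0]] := cutoff_support hO t0 cl.
have cK' : closed K by apply: compact_closed => //; exact: norm_hausdorff.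
split.
  apply: (C2on_patch (domain_open hO) cK' KO K0).
  exact: (C2onS (subsetT Omega) (C2on_cutoff l theta)).
by exists K; split=> // x; exact: (patch_off K0).
Qed.

Variable g : V -> R.
Hypothesis ig : mu.-integrable Omega (EFin \o g).
Hypothesis g0 : forall psi, test_fun Omega psi ->
  \int[mu]_(x in Omega) (g x * psi x) = 0.

Let mO : measurable Omega := open_measurable_rV (domain_open hO).
Let mg : measurable_fun Omega g.
Proof. exact/measurable_EFinP/measurable_int/ig. Qed.

(* [Q] is an intersection of half-spaces; adding them to the list of supporting
   hyperplanes gives test functions that converge to the indicator of [Q] on the
   domain: 0 outside [Q] at every stage, and eventually 1 at each point of [Q]. *)
Let Rintegral_avoid_halfspaces (e : seq (V * V)) (Q : set V) : measurable Q ->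
  (forall x, Q x -> forall j, j \in e -> 0 < depth j x) ->
  (forall x, ~ Q x -> exists2 j, j \in e & depth j x <= 0) ->
  \int[mu]_(x in Omega `&` Q) g x = 0.
Proof.
move=> mQ Qe NQe; rewrite Rintegral_mkcondr.
have [l_ [sl cl]] := exhausting_covers hO.
pose a k : R := k.+1%:R^-1; have a0 k : 0 < a k by rewrite invr_gt0.
have I0 k : \int[mu]_(x in Omega) (g x * cutoff (l_ k ++ e) (a k) x) = 0.
  have ck : covers_frontier Omega (l_ k ++ e) (a k).
    by move=> p /(cl k)[j jl jp]; exists j => //; rewrite mem_cat jl.
  rewrite -[RHS](g0 (cutoff_test_fun (a0 k) ck)); apply: eq_Rintegral => x Ox.
  by rewrite patchE Ox.
have cv : (fun=> 0 : R) @ \oo --> \int[mu]_(x in Omega) (g \_ Q) x.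
  rewrite (_ : (fun=> 0) = (fun k : nat =>
      \int[mu]_(x in Omega) (g x * cutoff (l_ k ++ e) (a k) x))); last exact/esym/funext.
  apply: (@Rintegral_dominated _ _ _ mu Omega _ _ (fun x => `|g x|)) => //.
- move=> k; apply: measurable_funM => //.
  apply: continuous_on_open_measurable; first exact: domain_open hO.
  by move=> x _; have [/(_ x (I : setT x))[]] := C2on_cutoff (l_ k ++ e) (a k).
- by apply/measurable_restrict => //; exact: measurable_funS mg.
- move=> x Ox; have [Qx|NQx] := pselect (Q x).
    rewrite patchE mem_set// -[X in _ --> X]mulr1; apply: cvgM; first exact: cvg_cst.
    apply: (cutoff_cvg1 hO) => //; [exact: cvg_harmonic|exact: Qe].
  rewrite patchE memNset//; have [j je jx] := NQe x NQx.
  rewrite (_ : (fun k => _) = fun=> 0); first exact: cvg_cst.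
  apply/funext => k; rewrite (@cutoff_shallow _ _ _ _ x j) ?mulr0//.
    by rewrite mem_cat je orbT.
  by apply: le_trans jx _; exact: ltW.
- exact: integrable_norm.
- move=> k x Ox; rewrite normrM -[leRHS]mulr1 ler_pM ?normr_ge0//.
  by rewrite ger0_norm ?cutoff_ge0// cutoff_le1.
exact: (cvg_unique _ cv (cvg_cst _)).
Qed.

(** The integral of [g] vanishes on the intersection of the domain with each orthant,
    and orthants form a pi-system that generates the Borel sets. *)
Lemma fundamental_lemma : {ae mu, forall x, Omega x -> g x = 0}.
Proof.
have ig' A : measurable A -> mu.-integrable (Omega `&` A) (EFin \o g).
  by move=> mA; apply: integrableS ig => //; exact: measurableI.
have fin A : measurable A -> \int[mu]_(x in Omega `&` A) g x = 0 ->
    (\int[mu]_(x in Omega `&` A) (g x)%:E = 0)%E.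
  move=> mA H; rewrite -[LHS]fineK; first by rewrite [fine _]H.
  by apply: integrable_fin_num; [exact: measurableI|exact: ig'].
pose P (A : set V) := (\int[mu]_(x in Omega `&` A) (g x)%:E = 0)%E.
have PT : P setT.
  apply: fin => //; apply: (@Rintegral_avoid_halfspaces [::]); [by []|by []|by move=> x []].
have Pmeas A : measurable A -> P A.
  rewrite measurable_orthants; apply: (dynkin_induction (@measurable_orthants R n)).
  - exact: orthants_setI.
  - exact: PT.
  - move=> _ [b ->]; have mb : measurable (orthant b).
      by rewrite measurable_orthants; apply: sub_sigma_algebra; exists b.
    apply: fin => //.
    pose ray i : V * V := (b, - unit_vec R i).
    have rayE i x : depth (ray i) x = x ord0 i - b ord0 i.
      rewrite /depth /= dotC dotNr /dot (bigD1 i)//= /unit_vec !mxE !eqxx mulr1.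
      rewrite big1 ?addr0 ?opprB// => j ji.
      by rewrite !mxE (negbTE ji) andbF mulr0.
    apply: (@Rintegral_avoid_halfspaces [seq ray i | i <- enum 'I_n]) => //.
      by move=> x bx j /mapP[i _ ->]; rewrite rayE subr_gt0.
    move=> x /existsNP[i bx]; exists (ray i).
      by apply: map_f; rewrite mem_enum.
    by rewrite rayE subr_le0 leNgt; exact/negP.
  - move=> S mS PS.
    have : (\int[mu]_(x in (Omega `&` S) `|` (Omega `&` ~` S)) (g x)%:E = 0)%E.
      by rewrite -setIUr setUv; exact: PT.
    rewrite integral_setU.
    + by rewrite [X in (X + _)%E]PS add0e.
    + exact: measurableI.
    + by apply: measurableI => //; exact: measurableC.
    + by rewrite -setIUr setUv setIT; exact/measurable_EFinP.
    + by rewrite disj_set2E setIACA setICr setI0.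
  - move=> F mF tF PF; rewrite /P setI_bigcupr integral_bigcup.
    + by apply: eseries0 => k _ _; exact: PF.
    + by apply: trivIset_setIl.
    + by move=> k; exact: measurableI.
    + rewrite -setI_bigcupr; apply: ig'; exact: bigcupT_measurable.
have := @integral_ae_eq _ V R mu Omega mO (cst 0%E) (EFin \o g) ig (measurable_cst _).
have H E : E `<=` Omega -> measurable E ->
    (\int[mu]_(x in E) (EFin \o g) x = \int[mu]_(x in E) cst 0%E x)%E.
  move=> EO mE; rewrite integral0; have := Pmeas _ mE.
  by rewrite /P setIidr.
move=> /(_ H); apply: filterS => x gx Ox; have := gx Ox.
by move=> /= [].
Qed.

End fundamental_lemma.

Section test_functions.
Context (R : realType) (n : nat) (Omega : set 'rV[R]_n).
Hypothesis hO : bounded_convex_smooth_domain Omega.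
Local Notation V := 'rV[R]_n.
Local Notation mu := (@lebesgue_rV R n).
Implicit Types psi : V -> R.

Let mO : measurable Omega := open_measurable_rV (domain_open hO).

Lemma test_fun_continuous psi : test_fun Omega psi -> continuous psi.
Proof. by move=> [[C _] _] x; have [] := C x I. Qed.

Lemma cpt_support_bounded (f : V -> R) (K : set V) : compact K -> continuous f ->
  (forall x, ~ K x -> f x = 0) -> exists2 M : R, 0 <= M & forall x, `|f x| <= M.
Proof.
move=> cK cf f0.
have /compact_bounded[M [_ HM]] : compact (f @` K).
  by apply: continuous_compact => //; exact: continuous_subspaceT.
exists (`|M| + 1) => [|x]; first by rewrite addr_ge0.
have [Kx|NKx] := pselect (K x); last by rewrite f0// normr0 addr_ge0.
by apply: (HM (`|M| + 1)); [rewrite (le_lt_trans (ler_norm M))// ltrDl|exists x].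
Qed.

Lemma test_fun_bounded psi : test_fun Omega psi ->
  exists2 M : R, 0 <= M & forall x, `|psi x| <= M.
Proof.
move=> tp; have [_ [K [cK _ K0]]] := tp.
exact: (cpt_support_bounded cK (test_fun_continuous tp) K0).
Qed.

Lemma test_fun_measurable psi : test_fun Omega psi -> measurable_fun Omega psi.
Proof.
move=> /test_fun_continuous cp; apply: continuous_on_open_measurable.
  exact: domain_open hO.
by move=> x _; exact: cp.
Qed.

Lemma test_fun_integrable psi : test_fun Omega psi ->
  mu.-integrable Omega (EFin \o psi).
Proof.
move=> tp; have [M _ HM] := test_fun_bounded tp.
apply: (bounded_continuous_integrable (domain_open hO) (domain_bounded hO) _
  (fun x _ => HM x)) => x _; exact: test_fun_continuous.
Qed.

Lemma integrable_mul_test g psi : mu.-integrable Omega (EFin \o g) ->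
  test_fun Omega psi -> mu.-integrable Omega (EFin \o (fun x => g x * psi x)).
Proof.
move=> ig tp; have [M M0 HM] := test_fun_bounded tp.
apply: (le_integrable mO _ _ (integrableZl mO M ig)).
  apply/measurable_EFinP/measurable_funM; last exact: test_fun_measurable.
  exact/measurable_EFinP/measurable_int/ig.
move=> x _; rewrite /= lee_fin !normrM mulrC (ger0_norm M0).
by apply: ler_wpM2r => //; exact: HM.
Qed.

Lemma test_fun_comb psi phi (a : R) : test_fun Omega psi -> test_fun Omega phi ->
  test_fun Omega (fun x => psi x + a * phi x).
Proof.
move=> [Cp [K [cK KO K0]]] [Cq [L [cL LO L0]]]; split.
  apply: (C2onD openT Cp); apply: (C2onM openT (C2on_cst setT a) Cq).
exists (K `|` L); split; first exact: compactU.
  by move=> x [/KO|/LO].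
by move=> x /not_orP[/K0 -> /L0 ->]; rewrite mulr0 addr0.
Qed.

(** If [g] annihilates all test functions of zero mean, the functionals [\int g psi]
    and [\int psi] are proportional on test functions, with some factor [c]; by the
    fundamental lemma [g] equals [c]. *)
Lemma nonconst_test (g : V -> R) :
  mu.-integrable Omega (EFin \o g) -> ~ ae_const mu Omega g ->
  exists psi, [/\ test_fun Omega psi, \int[mu]_(x in Omega) psi x = 0 &
    \int[mu]_(x in Omega) (g x * psi x) != 0].
Proof.
move=> ig Ng; apply: contrapT => H.
have g0 psi : test_fun Omega psi -> \int[mu]_(x in Omega) psi x = 0 ->
    \int[mu]_(x in Omega) (g x * psi x) = 0.
  by move=> tp p0; apply/eqP; apply: contrapT => /negP gp; apply: H; exists psi.
have [c cP] : exists c : R, forall psi, test_fun Omega psi ->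
    \int[mu]_(x in Omega) (g x * psi x) = c * \int[mu]_(x in Omega) psi x.
  have [[phi [tq q0]]|Nphi] := pselect (exists phi, test_fun Omega phi /\
      \int[mu]_(x in Omega) phi x != 0); last first.
    exists 0 => psi tp; rewrite mul0r g0//; apply/eqP; apply: contrapT => /negP p0.
    by apply: Nphi; exists psi.
  exists ((\int[mu]_(x in Omega) (g x * phi x)) / \int[mu]_(x in Omega) phi x).
  move=> psi tp.
  pose a := - ((\int[mu]_(x in Omega) psi x) / \int[mu]_(x in Omega) phi x).
  have iq := test_fun_integrable tq; have ip := test_fun_integrable tp.
  have igq := integrable_mul_test ig tq; have igp := integrable_mul_test ig tp.
  have iaq : mu.-integrable Omega (EFin \o (fun x => a * phi x)).
    exact: (integrableZl mO a iq).
  have iagq : mu.-integrable Omega (EFin \o (fun x => a * (g x * phi x))).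
    exact: (integrableZl mO a igq).
  have := g0 _ (test_fun_comb a tp tq).
  rewrite (RintegralD mO ip iaq) (RintegralZl _ mO iq) /a.
  rewrite mulNr mulfVK// subrr => /(_ erefl).
  have -> : \int[mu]_(x in Omega) (g x * (psi x + a * phi x)) =
      \int[mu]_(x in Omega) (g x * psi x + a * (g x * phi x)).
    by apply: eq_Rintegral => x _; ring.
  rewrite (RintegralD mO igp iagq) (RintegralZl _ mO igq) /a mulNr.
  by move=> /eqP; rewrite subr_eq0 => /eqP ->; ring.
apply: Ng; exists c.
have ic : mu.-integrable Omega (EFin \o (fun=> c)).
  apply: (@bounded_continuous_integrable _ _ _ _ `|c| (domain_open hO) (domain_bounded hO)) => //.
  by move=> x _; exact: cst_continuous.
have igc : mu.-integrable Omega (EFin \o (fun x => g x - c)).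
  exact: (integrableB mO ig ic).
have Hgc psi : test_fun Omega psi -> \int[mu]_(x in Omega) ((g x - c) * psi x) = 0.
  move=> tp; have ip := test_fun_integrable tp.
  have icp : mu.-integrable Omega (EFin \o (fun x => c * psi x)).
    exact: (integrableZl mO c ip).
  have -> : \int[mu]_(x in Omega) ((g x - c) * psi x) =
      \int[mu]_(x in Omega) (g x * psi x - c * psi x).
    by apply: eq_Rintegral => x _; rewrite mulrBl.
  by rewrite (RintegralB mO (integrable_mul_test ig tp) icp) (RintegralZl _ mO ip) cP// subrr.
have := fundamental_lemma hO igc Hgc.
by apply: filterS => x gx Ox; apply/eqP; rewrite -subr_eq0; apply/eqP; exact: gx.
Qed.

End test_functions.

(** * Time slices and differentiation under the integral *)

Lemma within_continuous_at (T U : topologicalType) (A D : set T) (f : T -> U) x :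
  {within A, continuous f} -> open D -> D `<=` A -> D x -> {for x, continuous f}.
Proof.
move=> /subspace_continuousP cf oD DA Dx W hW.
have := cf x (DA _ Dx) W hW; rewrite /= !nbhs_simpl/= /within/= => H.
apply: filterS2 H (open_nbhs_nbhs (conj oD Dx)) => y H Dy; exact: H (DA _ Dy).
Qed.

Section slices.
Context (R : realType) (n : nat) (Omega : set 'rV[R]_n).
Hypothesis hO : bounded_convex_smooth_domain Omega.
Local Notation V := 'rV[R]_n.
Let oO := domain_open hO.

Lemma pair_continuous (t : R) : continuous (fun x : V => (x, t)).
Proof.
move=> x; apply: (@cvg_pair _ _ _ (nbhs x) (nbhs x) (nbhs t)).
  exact: cvg_id.
exact: cvg_cst.
Qed.

Lemma slice_within (g : V * R -> R) (t : R) : 0 < t ->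
  {within cylx Omega, continuous g} ->
  {within closure Omega, continuous (fun x => g (x, t))}.
Proof.
move=> t0 cg.
apply: (@within_continuous_comp _ _ _ (fun x : V => (x, t)) g _ (cylx Omega)).
- by move=> x _; exact: pair_continuous.
- by move=> x cx; split => //=; rewrite in_itv/= t0.
- exact: cg.
Qed.

Lemma slice_continuous (g : V * R -> R) (t : R) x : 0 < t ->
  extends_to_cylx Omega g -> Omega x -> {for x, continuous (fun x => g (x, t))}.
Proof.
move=> t0 [h [ch gh]] Ox.
apply: (@continuous_eq_on _ _ Omega (fun x => h (x, t))) => //.
  by move=> y Oy; rewrite gh//; split=> //=; rewrite in_itv/= t0.
apply: (within_continuous_at (slice_within t0 ch) oO _ Ox).
exact: subset_closure.
Qed.

Lemma within_extends (g : V * R -> R) : {within cylx Omega, continuous g} ->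
  extends_to_cylx Omega g.
Proof. by move=> cg; exists g. Qed.

Lemma C21_slice u t : C21 Omega u -> 0 < t -> C2on Omega (fun x => u (x, t)).
Proof.
move=> [cu du _ eu1 eu2] t0.
have zt x : Omega x -> cyl Omega (x, t) by move=> Ox; split=> //=; rewrite in_itv/= t0.
split=> [x Ox|j x Ox].
  split; first exact: (slice_continuous t0 (within_extends cu) Ox).
  move=> i; split; first by have [_ /(_ i)] := du _ (zt x Ox).
  exact: (slice_continuous t0 (eu1 i) Ox).
split; first exact: (slice_continuous t0 (eu1 j) Ox).
move=> i; split; first by have [_ _ /(_ i j)] := du _ (zt x Ox).
exact: (slice_continuous t0 (eu2 i j) Ox).
Qed.

Lemma bounded_on_slab (g : V * R -> R) (E : set (V * R)) (a b : R) :
  {within E, continuous g} -> closure Omega `*` `[a, b] `<=` E ->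
  exists2 M : R, 0 <= M &
    forall x t, closure Omega x -> a <= t <= b -> `|g (x, t)| <= M.
Proof.
move=> cg sub.
have cK : compact (closure Omega `*` `[a, b]%classic).
  apply: compact_setX; last exact: segment_compact.
  exact: compact_closure_bounded (domain_bounded hO).
have /compact_bounded[M [_ HM]] : compact (g @` (closure Omega `*` `[a, b]%classic)).
  by apply: continuous_compact => //; exact: continuous_subspaceW sub cg.
exists (`|M| + 1) => [|x t cx tab]; first by rewrite addr_ge0.
apply: (HM (`|M| + 1)); first by rewrite (le_lt_trans (ler_norm M))// ltrDl.
by exists (x, t) => //; split=> //=; rewrite in_itv/=.
Qed.

Lemma extension_bounded (g : V * R -> R) (a b : R) : 0 < a ->
  extends_to_cylx Omega g ->
  exists2 M : R, 0 <= M &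
    forall x t, Omega x -> a <= t <= b -> `|g (x, t)| <= M.
Proof.
move=> a0 [h [ch gh]].
have [|M M0 HM] := @bounded_on_slab h (cylx Omega) a b ch.
  move=> [x t] [/= cx]; rewrite in_itv/= => /andP[at_ _]; split=> //=.
  by rewrite in_itv/= andbT (lt_le_trans a0).
exists M => // x t Ox tab; rewrite gh; first by apply: HM => //; exact: subset_closure.
by split=> //=; rewrite in_itv/= andbT; case/andP: tab => /(lt_le_trans a0).
Qed.

(** Uniform bounds on a neighbourhood of [t] dominate the difference quotients. *)
Lemma is_derive_integral (G : V * R -> R) (t : R) :
  (forall z, cyl Omega z -> derivable (fun s => G (z.1, s)) z.2 1) ->
  (forall x s, Omega x -> 0 < s -> {for x, continuous (fun x => G (x, s))}) ->
  (forall a b, 0 < a -> exists2 M, 0 <= M & forall x s, Omega x -> a <= s <= b ->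
     `|G (x, s)| <= M /\ `|dt G (x, s)| <= M) ->
  0 < t ->
  is_derive t 1 (fun s => \int[lebesgue_rV n]_(x in Omega) G (x, s))
    (\int[lebesgue_rV n]_(x in Omega) dt G (x, t)).
Proof.
move=> dG cG bG t0.
have t20 : 0 < t / 2 by rewrite divr_gt0.
have [M M0 HM] := bG (t / 2) (2 * t) t20.
have bO := domain_bounded hO.
have It : `]t / 2, 2 * t[%classic t.
  by rewrite /= in_itv/=; apply/andP; split; lra.
have Ipos s : `]t / 2, 2 * t[%classic s -> 0 < s /\ t / 2 <= s <= 2 * t.
  rewrite /= in_itv/= => /andP[s1 s2]; split; first exact: lt_trans s1.
  by rewrite !ltW.
have := @cvg_differentiation_under_integral R _ V (lebesgue_rV n)
  (fun s x => G (x, s)) Omega (open_measurable_rV oO) t (t / 2) (2 * t) It _ _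
  (fun=> M) (fun=> M0) _ _.
have int1 : forall s, `]t / 2, 2 * t[%classic s ->
    (lebesgue_rV n).-integrable Omega (EFin \o (fun x => G (x, s))).
  move=> s /Ipos[s0 st]; apply: (@bounded_continuous_integrable _ _ _ _ M oO bO).
    by move=> x Ox; exact: cG.
  by move=> x Ox; case: (HM x s Ox st).
have der1 : forall s x, `]t / 2, 2 * t[%classic s -> Omega x ->
    derivable ((fun s x => G (x, s)) ^~ x) s 1.
  move=> s x /Ipos[s0 st] Ox; apply: (dG (x, s)).
  by split=> //=; rewrite in_itv/= s0.
have intM : (lebesgue_rV n).-integrable Omega (EFin \o (fun=> M)).
  apply: (@bounded_continuous_integrable _ _ _ _ M oO bO) => x Ox.
    exact: cst_continuous.
  by rewrite ger0_norm.
have bd : forall s x, `]t / 2, 2 * t[%classic s -> Omega x ->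
    `|partial1of2 (fun s x => G (x, s)) s x| <= M.
  by move=> s x /Ipos[s0 st] Ox; case: (HM x s Ox st).
move=> /(_ int1 der1 intM bd) cv.
set F := fun s => _.
have E : (fun h : R => h^-1 *: (F (h *: 1 + t) - F t)) =
    (fun h : R => h^-1 *: (F (h + t) - F t)).
  by apply/funext => h; rewrite [h%:A]mulr1.
split; first by apply/cvg_ex; eexists; rewrite /= E; exact: cv.
by rewrite /derive /= E; apply/cvg_lim => //; exact: cv.
Qed.

End slices.

(** * The diffusion law and Green formula against test functions *)

Section phi_bounds.
Context (R : realType) (phi : R -> R).
Hypothesis hphi : admissible_phi phi.

Lemma phi_continuous (x : R) : 0 < x -> {for x, continuous phi}.
Proof.
move=> x0; apply: differentiable_continuous; apply/derivable1_diffP.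
exact: (@phi_derivable3 _ _ hphi 0%N).
Qed.

Lemma phi_is_derive (x : R) : 0 < x -> is_derive x 1 phi (derive1 phi x).
Proof.
move=> x0; rewrite derive1E; apply: derivableP.
exact: (@phi_derivable3 _ _ hphi 0%N).
Qed.

Lemma phi_is_derive2 (x : R) : 0 < x ->
  is_derive x 1 (derive1 phi) (derive1n 2 phi x) /\
  {for x, continuous (derive1n 2 phi)}.
Proof.
move=> x0; split.
  rewrite derive1nS derive1E; apply: derivableP.
  exact: (@phi_derivable3 _ _ hphi 1%N).
apply: differentiable_continuous; apply/derivable1_diffP.
exact: (@phi_derivable3 _ _ hphi 2%N).
Qed.

(** Near 0 the one-sided derivative bounds [phi s / s]; on the rest of [(0, M]] a
    maximum of [phi] does. *)
Lemma phi_linear_bound (M : R) : 0 < M ->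
  exists2 C : R, 0 < C & forall s, 0 < s -> s <= M -> phi s <= C * s.
Proof.
move=> M0; have := phi_derivable hphi (lexx 0).
move=> /cvg_ex[/= L] /cvgrPdist_lt /(_ 1 ltr01).
move=> /nbhs_ballP[e /= e0 eH].
have q y : 0 < y -> y < e -> phi y <= (`|L| + 1) * y.
  move=> y0 ye; have := eH y; rewrite /ball/= sub0r normrN gtr0_norm// => /(_ ye).
  move=> /(_ (lt0r_neq0 y0)); rewrite in_itv/= andbT => /(_ (ltW y0)).
  rewrite subr0 (phi_at0 hphi) subr0 => H; rewrite -ler_pdivrMr//.
  have : phi y / y - L <= 1.
    by apply: le_trans (ler_norm _) _; rewrite distrC ltW.
  have := ler_norm L; move: (phi y / y) => z; lra.
have e2 : 0 < e / 2 by rewrite divr_gt0.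
have [||c] := @EVT_max R phi (e / 2) (M + e / 2).
- by rewrite lerDr ltW.
- apply: continuous_in_subspaceT => x; rewrite inE/= in_itv/= => /andP[ex _].
  by apply: phi_continuous; exact: lt_le_trans ex.
rewrite in_itv/= => /andP[ec _] cmax.
have pc : 0 < phi c by apply: phi_gt0 => //; exact: lt_le_trans ec.
exists (`|L| + 1 + phi c / (e / 2)).
  by rewrite addr_gt0// ?divr_gt0// ltr_wpDl.
move=> s s0 sM; rewrite mulrDl.
have [se|es] := ltP s (e / 2).
  apply: (@le_trans _ _ ((`|L| + 1) * s)).
    by apply: q => //; apply: lt_trans se _; rewrite ltr_pdivrMr// ltr_pMr// ltr1n.
  by rewrite lerDl mulr_ge0 ?ltW// divr_gt0.
apply: (@le_trans _ _ (phi c / (e / 2) * s)); last first.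
  by rewrite lerDr mulr_ge0 ?ltW// ltr_wpDl.
apply: (@le_trans _ _ (phi c)).
  by apply: cmax; rewrite in_itv/= es/= (le_trans sM)// lerDl ltW.
by rewrite mulrAC -mulrA ler_peMr ?(ltW pc)// ler_pdivlMr// mul1r.
Qed.

End phi_bounds.

Section test_green.
Context (R : realType) (n : nat) (Omega : set 'rV[R]_n).
Hypothesis hO : bounded_convex_smooth_domain Omega.
Local Notation V := 'rV[R]_n.
Local Notation mu := (@lebesgue_rV R n).
Let oO := domain_open hO.
Let bO := domain_bounded hO.
Let mO : measurable Omega := open_measurable_rV oO.

Definition Lap (f : V -> R) (x : V) : R := \sum_i pderiv i (pderiv i f) x.

Lemma Lap_continuous D f x : C2on D f -> D x -> {for x, continuous (Lap f)}.
Proof.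
by move=> [_ C2] Dx; apply: continuous_sumr => i; have [_ /(_ i)[]] := C2 i x Dx.
Qed.

Lemma test_pderiv0 psi K : closed K -> (forall x, ~ K x -> psi x = 0 :> R) ->
  forall i x, ~ K x -> @pderiv R n i psi x = 0.
Proof.
move=> cK K0 i x NK; have oK : open (~` K) by exact: closed_openC.
by rewrite (@pderiv_eq_on _ _ (~` K) psi (fun=> 0) i oK K0 x NK) pderiv_cst.
Qed.

Lemma test_Lap_bounded psi : test_fun Omega psi ->
  exists2 B : R, 0 <= B & forall x, `|Lap psi x| <= B.
Proof.
move=> [C2 [K [cK KO K0]]].
have cK' : closed K by apply: compact_closed => //; exact: norm_hausdorff.
apply: (cpt_support_bounded cK).
  by move=> x; exact: (Lap_continuous C2 (I : setT x)).
move=> x NK; rewrite /Lap big1// => i _.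
by rewrite (test_pderiv0 cK' (fun y => test_pderiv0 cK' K0 i (x := y))).
Qed.

(** The field [psi grad w - w grad psi] has compact support in the domain and
    divergence [psi Lap w - w Lap psi]. *)
Lemma green_test (w psi : V -> R) (M : R) : C2on Omega w ->
  (forall x, Omega x -> `|w x| <= M) -> test_fun Omega psi ->
  mu.-integrable Omega (EFin \o (fun x => w x * Lap psi x)) /\
  \int[mu]_(x in Omega) (psi x * Lap w x) = \int[mu]_(x in Omega) (w x * Lap psi x).
Proof.
move=> Cw wM tp; have [B B0 HB] := test_Lap_bounded tp.
have [Cp [K [cK KO K0]]] := tp.
have cK' : closed K by apply: compact_closed => //; exact: norm_hausdorff.
have [Cw1 Cw2] := Cw.
have [Cp1 Cp2] := C2onS (subsetT Omega) Cp.
pose E i (x : V) := psi x * pderiv i w x + -1 * (w x * pderiv i psi x).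
have Cwp i : C1on Omega (fun x => w x * pderiv i psi x).
  exact: (C1onM oO Cw1 (Cp2 i)).
have Cpw i : C1on Omega (fun x => psi x * pderiv i w x).
  exact: (C1onM oO Cp1 (Cw2 i)).
have CN i : C1on Omega (fun x => -1 * (w x * pderiv i psi x)).
  exact: (C1onM oO (@C1on_cst _ _ Omega (-1)) (Cwp i)).
have CE i : C1on Omega (E i) by exact: (C1onD oO (Cpw i) (CN i)).
have E0 i x : Omega x -> ~ K x -> E i x = 0.
  by move=> Ox NK; rewrite /E K0// (test_pderiv0 cK' K0)// !(mulr0, mul0r) addr0.
have dE i x : Omega x ->
    pderiv i (E i) x = psi x * pderiv i (pderiv i w) x - w x * pderiv i (pderiv i psi) x.
  move=> Ox; rewrite (pderivD_on _ (Cpw i) (CN i) Ox) (pderivM_on _ Cp1 (Cw2 i) Ox).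
  rewrite (pderivM_on _ (@C1on_cst _ _ Omega (-1)) (Cwp i) Ox) pderiv_cst.
  rewrite (pderivM_on _ Cw1 (Cp2 i) Ox).
  move: (pderiv i (pderiv i w) x) (pderiv i (pderiv i psi) x) (pderiv i w x)
    (pderiv i psi x) (w x) (psi x) => a b c d y z; ring.
have iE i := integrable_pderiv_cpt oO cK' KO (@E0 i) bO (CE i) i.
pose SE (x : V) := \sum_i pderiv i (E i) x.
have [isE sE] : mu.-integrable Omega (EFin \o SE) /\ \int[mu]_(x in Omega) SE x = 0.
  have [-> ->] := Rintegral_sum (index_enum 'I_n) mO iE; split=> //.
  by rewrite big1// => i _; exact: (Rintegral_pderiv_cpt oO cK' KO (@E0 i) bO (CE i)).
have iw : mu.-integrable Omega (EFin \o (fun x => w x * Lap psi x)).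
  apply: (@bounded_continuous_integrable _ _ _ _ (M * B) oO bO) => x Ox.
    apply: cont_mul; first by have [] := Cw1 x Ox.
    exact: (Lap_continuous Cp (I : setT x)).
  by rewrite normrM ler_pM ?normr_ge0 ?wM.
split; [exact iw|].
transitivity (\int[mu]_(x in Omega) (SE x + w x * Lap psi x)).
  apply: eq_Rintegral => x /set_mem Ox; rewrite /SE /Lap !mulr_sumr -big_split/=.
  by apply: eq_bigr => i _; rewrite dE// subrK.
by rewrite (RintegralD mO isE iw) sE add0r.
Qed.

End test_green.

(** * The convex energy density *)

Lemma within_continuous_mul (R : realType) (T : topologicalType) (A : set T) (f g : T -> R) :
  {within A, continuous f} -> {within A, continuous g} ->
  {within A, continuous (fun x => f x * g x)}.
Proof. by move=> cf cg x; exact (cvgM (cf x) (cg x)). Qed.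

Lemma within_continuous_add (R : realType) (T : topologicalType) (A : set T) (f g : T -> R) :
  {within A, continuous f} -> {within A, continuous g} ->
  {within A, continuous (fun x => f x + g x)}.
Proof. by move=> cf cg x; exact (cvgD (cf x) (cg x)). Qed.

Lemma within_continuous_sum (R : realType) (T : topologicalType) (A : set T) (I : Type)
    (r : seq I) (f : I -> T -> R) :
  (forall i, {within A, continuous (f i)}) ->
  {within A, continuous (fun x => \sum_(i <- r) f i x)}.
Proof. by move=> cf x; apply: cvg_sumr => i; exact: cf. Qed.

Lemma within_continuous_postcomp (R : realType) (T : topologicalType) (A : set T) (f : T -> R)
    (g : R -> R) :
  {within A, continuous f} -> continuous g ->
  {within A, continuous (fun x => g (f x))}.
Proof. by move=> cf cg x; exact (continuous_comp (cf x) (cg _)). Qed.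

Section extensions.
Context (R : realType) (n : nat) (Omega : set 'rV[R]_n).
Implicit Types (f g : 'rV[R]_n * R -> R).
Local Notation ext := (extends_to_cylx Omega).

Lemma extends_mul f g : ext f -> ext g -> ext (fun z => f z * g z).
Proof.
move=> [f' [cf ff]] [g' [cg gg]]; exists (fun z => f' z * g' z); split.
  exact: within_continuous_mul.
by move=> z cz; rewrite ff ?gg.
Qed.

Lemma extends_comp f (h : R -> R) : ext f -> continuous h -> ext (fun z => h (f z)).
Proof.
move=> [f' [cf ff]] ch; exists (fun z => h (f' z)); split; first exact: within_continuous_postcomp.
by move=> z cz; rewrite ff.
Qed.

Lemma extends_eq f g : (forall z, cyl Omega z -> f z = g z) -> ext f -> ext g.
Proof. by move=> fg [f' [cf ff]]; exists f'; split=> // z cz; rewrite -fg ?ff. Qed.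

Lemma extends_space (psi : 'rV[R]_n -> R) : continuous psi -> ext (fun z => psi z.1).
Proof.
move=> cp; exists (fun z => psi z.1); split=> //.
apply: continuous_subspaceT => z.
by apply: (@continuous_comp _ _ _ fst psi); [exact: cvg_fst|exact: cp].
Qed.

End extensions.

Section convex_weight.
Context (R : realType) (C L K : R).
Hypotheses (C0 : 0 <= C) (L0 : 0 <= L) (K0 : 0 < K).

(** Twice continuously differentiable and convex; equal to [C * s] on initial
    values, which are below [K], and of slope at least [L] beyond [K + 1].  Between
    [K] and [K + 1] the slope is still at least [C]. *)
Definition weight (s : R) : R := C * s + L * pospow 4 (s - K).
Definition weight' (s : R) : R := C + L * (4 * pospow 3 (s - K)).
Definition weight'' (s : R) : R := L * (4 * (3 * pospow 2 (s - K))).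

Let is_derive_shifted k (s : R) :
  is_derive s 1 (fun s => pospow k.+2 (s - K)) (k.+2%:R * pospow k.+1 (s - K)).
Proof.
have dK : is_derive s 1 (fun s => s - K) (1 : R).
  by apply: is_derive_affine => h; rewrite [h%:A]mulr1 mulr1; ring.
by have := is_derive_comp dK (is_derive_pospow k (s - K)); rewrite mulr1.
Qed.

Lemma is_derive_weight (s : R) : is_derive s 1 weight (weight' s).
Proof.
have d1 : is_derive s 1 (fun s : R => C * s) C.
  by apply: is_derive_affine => h; rewrite [h%:A]mulr1; ring.
have d2 := @is_deriveZ R R R (fun s => pospow 4 (s - K)) L s 1 _ (is_derive_shifted 2 s).
exact (is_deriveD d1 d2).
Qed.

Lemma is_derive_weight' (s : R) : is_derive s 1 weight' (weight'' s).
Proof.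
have d1 : is_derive s 1 (fun _ : R => C) (0 : R) by exact: is_derive_cst.
have d2 := @is_deriveZ R R R (fun s => pospow 3 (s - K)) 4 s 1 _ (is_derive_shifted 1 s).
have d3 := @is_deriveZ R R R _ L s 1 _ d2.
have := is_deriveD d1 d3; rewrite add0r; exact.
Qed.

Let continuous_shifted k : continuous (fun s : R => pospow k (s - K)).
Proof.
move=> s; apply: (@continuous_comp _ _ _ (fun s : R => s - K) (@pospow R k)).
  by apply: cvgB; [exact: cvg_id|exact: cvg_cst].
exact: continuous_pospow.
Qed.

Lemma continuous_weight : continuous weight.
Proof.
move=> s; apply: differentiable_continuous; apply/derivable1_diffP.
by case: (is_derive_weight s).
Qed.

Lemma continuous_weight' : continuous weight'.
Proof.
move=> s; apply: differentiable_continuous; apply/derivable1_diffP.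
by case: (is_derive_weight' s).
Qed.

Lemma continuous_weight'' : continuous weight''.
Proof.
move=> s; have c (a : R) : {for s, continuous (fun=> a)} by exact: cst_continuous.
exact (cont_mul (c L) (cont_mul (c 4) (cont_mul (c 3) (@continuous_shifted 2 s)))).
Qed.

Lemma weight''_ge0 s : 0 <= weight'' s.
Proof. by do 3 (apply: mulr_ge0 => //); exact: pospow_ge0. Qed.

Lemma weight'_ge (s : R) : C <= weight' s.
Proof. by rewrite lerDl; do 2 (apply: mulr_ge0 => //); exact: pospow_ge0. Qed.

Lemma weight'_geL (s : R) : K + 1 <= s -> L <= weight' s.
Proof.
move=> Ks; apply: (@le_trans _ _ (L * (4 * pospow 3 (s - K)))); last by rewrite lerDr.
rewrite ler_peMr//; have : 1 <= pospow 3 (s - K) by apply: pospow_ge1; lra.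
lra.
Qed.

Lemma weight_ge0 s : 0 <= s -> 0 <= weight s.
Proof. by move=> s0; apply: addr_ge0; apply: mulr_ge0 => //; exact: pospow_ge0. Qed.

Lemma weight_le_K s : s <= K -> weight s = C * s.
Proof. by move=> sK; rewrite /weight pospow_le0 ?subr_le0// mulr0 addr0. Qed.

Lemma weight_bound (s M : R) : `|s| <= M -> `|weight s| <= C * M + L * M ^+ 4.
Proof.
move=> sM; have M0 : 0 <= M by exact: le_trans sM.
apply: le_trans (ler_normD _ _) _; rewrite (normrM C) (normrM L) (ger0_norm C0) (ger0_norm L0).
rewrite (ger0_norm (pospow_ge0 _ _)); apply: lerD; first exact: ler_wpM2l.
apply: ler_wpM2l => //; apply: lerXn2r; rewrite ?nnegrE ?le_max ?lexx//.
rewrite ge_max M0 /= lerBlDr; apply: le_trans (ler_norm s) _.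
by apply: le_trans sM _; rewrite lerDl ltW.
Qed.

End convex_weight.

(** * Rates of change of the moment and of the energy *)

Section evolution.
Context (R : realType) (n : nat) (Omega : set 'rV[R]_n).
Hypothesis hO : bounded_convex_smooth_domain Omega.
Local Notation V := 'rV[R]_n.
Local Notation mu := (@lebesgue_rV R n).
Local Notation ext := (extends_to_cylx Omega).
Let oO := domain_open hO.
Let bO := domain_bounded hO.
Let mO : measurable Omega := open_measurable_rV oO.

Lemma cyl_slice x t : Omega x -> 0 < t -> cyl Omega (x, t).
Proof. by move=> Ox t0; split=> //=; rewrite in_itv/= t0. Qed.

Lemma cyl_cylx z : cyl Omega z -> cylx Omega z.
Proof. by move=> [z1 z2]; split=> //; exact: subset_closure. Qed.

Lemma is_derive_integral_ext (G : V * R -> R) (t : R) :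
  (forall z, cyl Omega z -> derivable (fun s => G (z.1, s)) z.2 1) ->
  ext G -> ext (dt G) -> 0 < t ->
  is_derive t 1 (fun s => \int[mu]_(x in Omega) G (x, s))
    (\int[mu]_(x in Omega) dt G (x, t)).
Proof.
move=> dG eG edG t0; apply: (is_derive_integral hO) => //.
  by move=> x s Ox s0; exact (slice_continuous hO s0 eG Ox).
move=> a b a0; have [M M0 HM] := extension_bounded hO b a0 eG.
have [N N0 HN] := extension_bounded hO b a0 edG.
exists (M + N) => [|x s Ox sab]; first exact: addr_ge0.
by split; [apply: le_trans (HM x s Ox sab) _; rewrite lerDl
          |apply: le_trans (HN x s Ox sab) _; rewrite lerDr].
Qed.

Lemma ext_integrable (G : V * R -> R) (t : R) : ext G -> 0 < t ->
  mu.-integrable Omega (EFin \o (fun x => G (x, t))).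
Proof.
move=> eG t0; have [M _ HM] := extension_bounded hO t t0 eG.
apply: (@bounded_continuous_integrable _ _ _ _ M oO bO) => x Ox.
  exact (slice_continuous hO t0 eG Ox).
by apply: HM => //; rewrite lexx.
Qed.

Context (phi : R -> R) (hphi : admissible_phi phi) (u v : V * R -> R).
Hypotheses (Cu : C21 Omega u) (Cv : C21 Omega v).
Hypotheses (u0 : forall z, cylx Omega z -> 0 < u z)
           (v0 : forall z, cylx Omega z -> 0 < v z).
Hypothesis eq_u : forall z, cyl Omega z ->
    dt u z = laplacian (fun y => u y * phi (v y)) z.
Hypothesis eq_v : forall z, cyl Omega z -> dt v z = laplacian v z - u z * v z.
Hypothesis nv : neumann Omega v.

Let eu : ext u. Proof. by case: Cu => cu *; exact: within_extends. Qed.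
Let ev : ext v. Proof. by case: Cv => cv *; exact: within_extends. Qed.

Context (C L K : R).
Hypotheses (C0 : 0 <= C) (L0 : 0 <= L).
Local Notation H := (weight C L K).
Local Notation H' := (weight' C L K).
Local Notation H'' := (weight'' L K).

Context (t : R) (t0 : 0 < t).
Hypothesis phiH : forall x, Omega x -> phi (v (x, t)) <= H' (v (x, t)) * v (x, t).

Let w (x : V) := u (x, t) * phi (v (x, t)).

Let w_ge0 x : Omega x -> 0 <= w x.
Proof.
move=> Ox; have zx := cyl_cylx (cyl_slice Ox t0).
by apply: mulr_ge0; apply: ltW; [exact: u0|apply: phi_gt0 => //; exact: v0].
Qed.

Let C2w : C2on Omega w.
Proof.
apply: (C2onM oO (C21_slice hO Cu t0)).
have vp x : Omega x -> 0 < v (x, t).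
  by move=> Ox; apply: v0; exact: cyl_cylx (cyl_slice Ox t0).
apply: (C2on_comp oO (C21_slice hO Cv t0) (g' := derive1 phi) (g'' := derive1n 2 phi)).
  by move=> x /vp; exact: phi_is_derive.
by move=> x /vp; exact: phi_is_derive2.
Qed.

Let w_bounded : exists2 M, 0 <= M & forall x, Omega x -> `|w x| <= M.
Proof.
have eH : ext (fun z => u z * (H' (v z) * v z)).
  apply: extends_mul => //; apply: extends_mul => //.
  by apply: extends_comp => //; exact: continuous_weight'.
have [M M0 HM] := extension_bounded hO t t0 eH.
exists M => // x Ox; rewrite ger0_norm ?w_ge0//.
apply: le_trans (HM x t Ox _); last by rewrite lexx.
apply: le_trans (ler_norm _); apply: ler_wpM2l; last exact: phiH.
by apply/ltW/u0; exact: cyl_cylx (cyl_slice Ox t0).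
Qed.

Let w_integrable : mu.-integrable Omega (EFin \o w).
Proof.
have [M M0 HM] := w_bounded.
apply: (@bounded_continuous_integrable _ _ _ _ M oO bO) => // x Ox.
by case: C2w => /(_ x Ox)[].
Qed.

(** [X' = \int psi Lap w = \int w Lap psi] with [w = u phi(v)], and [w] is
    nonnegative. *)
Lemma moment_rate psi (B : R) : test_fun Omega psi -> (forall x, `|Lap psi x| <= B) ->
  exists2 D, is_derive t 1 (fun s => \int[mu]_(x in Omega) (u (x, s) * psi x)) D &
    `|D| <= B * \int[mu]_(x in Omega) w x.
Proof.
move=> tp HB; have cp := test_fun_continuous tp.
pose G z := u z * psi z.1.
have du z : cyl Omega z -> derivable (fun s => u (z.1, s)) z.2 1.
  by case: Cu => _ + _ _ _ => /[apply] -[].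
have dG z : cyl Omega z ->
    is_derive z.2 1 (fun s => G (z.1, s)) (dt u z * psi z.1).
  move=> /du/derivableP d; have dk := is_derive_cst (psi z.1) z.2 1.
  have := is_deriveM d dk; rewrite scaler0 add0r /dt derive1E.
  by rewrite [psi z.1 *: _]mulrC; exact.
have dtG z : cyl Omega z -> dt G z = dt u z * psi z.1.
  by move=> /dG [_ <-]; rewrite /dt derive1E.
have eG : ext G by apply: extends_mul => //; exact: extends_space.
have edG : ext (dt G).
  apply: (@extends_eq _ _ _ (fun z => dt u z * psi z.1)).
    by move=> z /dtG.
  by apply: extends_mul; [case: Cu|exact: extends_space].
have := @is_derive_integral_ext G t (fun z cz => let: DeriveDef d _ := dG z cz in d) eG edG t0.
set D := Rintegral _ _ _ => dD; exists D; first exact: dD.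
have [M M0 HM] := w_bounded.
have [iw green] := green_test hO C2w HM tp.
have DE : D = \int[mu]_(x in Omega) (w x * Lap psi x).
  rewrite -green; apply: eq_Rintegral => x /set_mem Ox.
  by rewrite (dtG _ (cyl_slice Ox t0)) (eq_u (cyl_slice Ox t0)) mulrC.
rewrite DE; apply: le_trans (le_normr_Rintegral mO iw) _.
rewrite -(RintegralZl _ mO w_integrable).
apply: (le_Rintegral mO (integrable_norm iw) (integrableZl mO B w_integrable)).
move=> x Ox; rewrite /= normrM (ger0_norm (w_ge0 Ox)) mulrC.
by apply: ler_wpM2r; [exact: w_ge0|exact: HB].
Qed.

(** [Y' = \int H'(v) (Lap v - u v)], where [H'(v) Lap v] is the divergence of
    [H'(v) grad v] minus [H''(v) |grad v|^2]; the divergence integrates to 0, and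
    [H'(v) v >= phi(v)]. *)
Lemma energy_rate :
  exists2 D, is_derive t 1 (fun s => \int[mu]_(x in Omega) H (v (x, s))) D &
    D <= - \int[mu]_(x in Omega) w x.
Proof.
pose G z := H (v z).
have dv z : cyl Omega z -> derivable (fun s => v (z.1, s)) z.2 1.
  by case: Cv => _ + _ _ _ => /[apply] -[].
have dG z : cyl Omega z ->
    is_derive z.2 1 (fun s => G (z.1, s)) (H' (v z) * dt v z).
  move=> /dv/derivableP d; rewrite /dt derive1E.
  by apply: (is_derive_comp d); rewrite -surjective_pairing; exact: is_derive_weight.
have dtG z : cyl Omega z -> dt G z = H' (v z) * dt v z.
  by move=> /dG [_ <-]; rewrite /dt derive1E.
have eH' : ext (fun z => H' (v z)).
  by apply: extends_comp => //; exact: continuous_weight'.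
have eG : ext G by apply: extends_comp => //; exact: continuous_weight.
have edG : ext (dt G).
  apply: (@extends_eq _ _ _ (fun z => H' (v z) * dt v z)).
    by move=> z /dtG.
  by apply: extends_mul => //; case: Cv.
have := @is_derive_integral_ext G t (fun z cz => let: DeriveDef d _ := dG z cz in d) eG edG t0.
set D := Rintegral _ _ _ => dD; exists D; first exact: dD.
(* [h1 i] and [h2 (i, j)] extend the derivatives of [v] up to the lateral boundary,
   so [F = H'(v) grad v] extends to [h], whose normal component vanishes because the
   extended gradient of [v] is what enters the Neumann condition. *)
have [cv _ _ ev1 ev2] := Cv.
have [h1 h1P] := choice ev1.
have [h2 h2P] := choice (fun ij => ev2 ij.1 ij.2).
pose vt (x : V) := v (x, t).
have C2v : C2on Omega vt := C21_slice hO Cv t0.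
have [C1v C1dv] := C2v.
have wvt : {within closure Omega, continuous vt} by exact: (slice_within t0 cv).
pose F i (x : V) := H' (vt x) * pderiv i vt x.
pose h i (x : V) := H' (vt x) * h1 i (x, t).
have Fh i x : Omega x -> F i x = h i x.
  by move=> Ox; rewrite /F /h -(h1P i).2//; exact: cyl_slice.
have wh1 i : {within closure Omega, continuous (fun x => h1 i (x, t))}.
  by apply: (slice_within t0); have [] := h1P i.
have wh i : {within closure Omega, continuous (h i)}.
  apply: within_continuous_mul => //; apply: within_continuous_postcomp => //.
  exact: continuous_weight'.
have C1H' : C1on Omega (fun x => H' (vt x)) /\
    forall i x, Omega x -> pderiv i (fun x => H' (vt x)) x = H'' (vt x) * pderiv i vt x.
  apply: (C1on_comp oO C1v) => x Ox; split; first exact: is_derive_weight'.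
  exact: continuous_weight''.
have CF i : C1on Omega (F i) by exact: (C1onM oO C1H'.1 (C1dv i)).
have dF i x : Omega x -> pderiv i (F i) x =
    H' (vt x) * pderiv i (pderiv i vt) x + H'' (vt x) * pderiv i vt x ^+ 2.
  move=> Ox; rewrite (pderivM_on _ C1H'.1 (C1dv i) Ox) C1H'.2//; congr (_ + _).
  by rewrite mulrC expr2 mulrA.
have tang x nu : frontier Omega x -> outward_unit_normal Omega x nu ->
    \sum_i nu ord0 i * h i x = 0.
  move=> Fx onu; have cx : closure Omega x by case: Fx.
  have L1 i : lim (dx i v (y, t) @[y --> within Omega (nbhs x)]) = h1 i (x, t).
    have PF : ProperFilter (within Omega (nbhs x)) by exact: within_nbhs_proper.
    apply/cvg_lim => //.
    have /subspace_continuousP/(_ x cx) hc := wh1 i.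
    apply: (@cvg_trans _ (h1 i (y, t) @[y --> within Omega (nbhs x)])).
      apply: near_eq_cvg; near=> y; apply/esym.
      have Oy : Omega y by near: y; exact: withinT.
      exact: (proj2 (h1P i) _ (cyl_slice Oy t0)).
    apply: cvg_trans hc; apply: cvg_app.
    by apply: within_subset; exact: subset_closure.
  have := nv Fx onu t0; rewrite /normal_derivative => N0.
  rewrite (eq_bigr (fun i => H' (vt x) * (nu ord0 i * h1 i (x, t)))).
    rewrite -mulr_sumr -[RHS](mulr0 (H' (vt x))); congr (_ * _).
    by rewrite -[RHS]N0; apply: eq_bigr => i _; rewrite L1.
  by move=> i _; rewrite mulrCA.
pose divF (x : V) := \sum_i pderiv i (F i) x.
have [B HB] : exists B, forall x, Omega x -> `|divF x| <= B.
  pose Q (x : V) := \sum_i (H' (vt x) * h2 (i, i) (x, t) +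
                       H'' (vt x) * (h1 i (x, t) * h1 i (x, t))).
  have wQ : {within closure Omega, continuous Q}.
    apply: within_continuous_sum => i; apply: within_continuous_add; apply: within_continuous_mul.
    - by apply: within_continuous_postcomp => //; exact: continuous_weight'.
    - by apply: (slice_within t0); have [] := h2P (i, i).
    - by apply: within_continuous_postcomp => //; exact: continuous_weight''.
    - exact: within_continuous_mul.
  have /compact_bounded[M [_ HM]] : compact (Q @` closure Omega).
    by apply: continuous_compact => //; exact: compact_closure_bounded.
  exists (`|M| + 1) => x Ox; apply: (HM (`|M| + 1)).
    by rewrite (le_lt_trans (ler_norm M))// ltrDl.
  exists x; first exact: subset_closure.
  apply: eq_bigr => i _; rewrite dF// expr2.
  by rewrite -(proj2 (h2P (i, i)) _ (cyl_slice Ox t0)) -(proj2 (h1P i) _ (cyl_slice Ox t0)).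
have int0 := divergence_tangential hO CF wh Fh tang HB.
have idivF : mu.-integrable Omega (EFin \o divF).
  apply: (bounded_continuous_integrable oO bO _ HB) => x Ox.
  by apply: continuous_sumr => i; have [_ /(_ i)[]] := CF i x Ox.
have -> : - (\int[mu]_(x in Omega) w x) = \int[mu]_(x in Omega) (divF x - w x).
  by rewrite (RintegralB mO idivF w_integrable) [X in _ = X - _]int0 sub0r.
apply: (le_Rintegral mO (ext_integrable edG t0) (integrableB mO idivF w_integrable)).
move=> x Ox; have cz := cyl_slice Ox t0; rewrite dtG// eq_v//.
have ux : 0 <= u (x, t) by apply/ltW/u0; exact: cyl_cylx.
have E : divF x = H' (vt x) * laplacian v (x, t) +
    H'' (vt x) * \sum_i pderiv i vt x ^+ 2.
  rewrite /divF /laplacian !mulr_sumr -big_split/=.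
  by apply: eq_bigr => i _; rewrite dF.
have grad0 : 0 <= H'' (vt x) * \sum_i pderiv i vt x ^+ 2.
  apply: mulr_ge0; first exact: weight''_ge0.
  by apply: sumr_ge0 => i _; exact: sqr_ge0.
have wle : w x <= u (x, t) * (H' (vt x) * vt x) by apply: ler_wpM2l => //; exact: phiH.
rewrite E mulrBr mulrCA; move: grad0 wle; change (v (x, t)) with (vt x).
by move: (H' (vt x) * laplacian v _) (u _ * _) (H'' _ * _) => a b c; lra.
Unshelve. all: by end_near. Qed.

End evolution.

(** * Total drift of the moment *)

Section essential_bounds.
Context (R : realType) (n : nat) (Omega : set 'rV[R]_n).
Hypothesis hO : bounded_convex_smooth_domain Omega.
Local Notation mu := (@lebesgue_rV R n).
Implicit Types f : 'rV[R]_n -> R.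
Let mO : measurable Omega := open_measurable_rV (domain_open hO).

Lemma normLpy_ae f (M : R) : (normLp mu Omega +oo f <= M%:E)%E ->
  {ae mu, forall x, Omega x -> `|f x| <= M}.
Proof.
rewrite /normLp unlock; case: ifPn => [_ /ess_supP|].
  apply: filterS => x; rewrite /= patchE => H Ox.
  by move: H; rewrite mem_set// lee_fin.
rewrite -leNgt => mu0 _; exists setT; split => //.
by apply/eqP; rewrite eq_le mu0 measure_ge0.
Qed.

Lemma inLpy_bounded f (M : R) : measurable_fun Omega f ->
  (forall x, Omega x -> `|f x| <= M) -> 0 <= M -> inLp mu Omega +oo%E f.
Proof.
move=> mf fM M0; split=> //; apply: (@le_lt_trans _ _ M%:E); last exact: ltry.
rewrite /normLp unlock; case: ifPn => _; last by rewrite lee_fin.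
apply/ess_supP; apply: aeW => x; rewrite /= patchE lee_fin.
by case: ifPn => [/set_mem /fM//|_]; rewrite normr0.
Qed.

Lemma ae_bounded_integrable f (M : R) : measurable_fun Omega f ->
  {ae mu, forall x, Omega x -> `|f x| <= M} -> mu.-integrable Omega (EFin \o f).
Proof.
move=> mf fM; apply/integrableP; split; first exact/measurable_EFinP.
have muO : (mu Omega < +oo)%E by exact: lebesgue_rV_bounded_lty (domain_bounded hO).
apply: (@le_lt_trans _ _ (\int[mu]_(x in Omega) (`|M|)%:E)%E).
  apply: ae_ge0_le_integral => //.
    by apply/measurable_EFinP/measurableT_comp.
  by apply: filterS fM => x fx Ox; rewrite lee_fin; apply: le_trans (fx Ox) (ler_norm _).
by rewrite integral_cst// lte_mul_pinfty.
Qed.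

Lemma ae_eq_Rintegral f g : measurable_fun Omega f -> measurable_fun Omega g ->
  {ae mu, forall x, Omega x -> f x = g x} ->
  \int[mu]_(x in Omega) f x = \int[mu]_(x in Omega) g x.
Proof.
move=> mf mg fg; rewrite /Rintegral; congr fine; apply: ae_eq_integral => //.
- exact/measurable_EFinP.
- exact/measurable_EFinP.
- by apply: filterS fg => x H Ox; rewrite H.
Qed.

End essential_bounds.

Lemma nonincreasing_of_derive_le0 (R : realType) (Z : R -> R) (s t : R) : s <= t ->
  (forall r, s <= r <= t -> exists2 D, is_derive r 1 Z D & D <= 0) -> Z t <= Z s.
Proof.
move=> st dZ.
have dZ' r : s <= r <= t -> is_derive r 1 Z (derive1 Z r) /\ derive1 Z r <= 0.
  by move=> /dZ[D dD D0]; rewrite derive1E (@derive_val _ _ _ _ _ _ _ dD).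
have [||c cst E] := @MVT_segment R Z (derive1 Z) s t st.
- move=> r; rewrite in_itv/= => /andP[/ltW sr /ltW rt].
  by case: (dZ' r); rewrite ?sr.
- apply: continuous_in_subspaceT => r; rewrite inE/= in_itv/= => srt.
  apply: differentiable_continuous; apply/derivable1_diffP.
  by case: (dZ' r srt) => -[].
rewrite -subr_le0 E; move: cst; rewrite in_itv/= => /dZ'[_ c0].
by apply: mulr_le0_ge0 => //; rewrite subr_ge0.
Qed.

Lemma cvg_div_natS (R : realType) (T : R) : (fun k : nat => T / k.+2%:R) @ \oo --> (0 : R).
Proof.
rewrite -(mulr0 T); apply: cvgM; first exact: cvg_cst.
by have := @cvg_harmonic R; rewrite -(cvg_shiftS (@harmonic R)); exact.
Qed.

Section drift.
Context (R : realType) (n : nat) (Omega : set 'rV[R]_n).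
Hypothesis hO : bounded_convex_smooth_domain Omega.
Local Notation V := 'rV[R]_n.
Local Notation mu := (@lebesgue_rV R n).
Let oO := domain_open hO.
Let bO := domain_bounded hO.
Let mO : measurable Omega := open_measurable_rV oO.
Context (phi : R -> R) (hphi : admissible_phi phi).
Context (u0 v0 : V -> R) (u v : V * R -> R).
Hypothesis sol : global_solution Omega phi u0 v0 u v.
Context (K C : R).
Hypotheses (K0 : 0 < K) (C0 : 0 < C).
Hypothesis phiC : forall s, 0 < s -> s <= K + 1 -> phi s <= C * s.
Hypothesis mv0 : measurable_fun Omega v0.
Hypothesis v0K : {ae mu, forall x, Omega x -> `|v0 x| <= K}.
Context (psi : V -> R) (B : R).
Hypothesis tp : test_fun Omega psi.
Hypotheses (B0 : 0 <= B) (HB : forall x, `|Lap psi x| <= B).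

Let X s := \int[mu]_(x in Omega) (u (x, s) * psi x).

Lemma slice0_continuous x : Omega x -> {for x, continuous (fun x => v (x, 0))}.
Proof.
move=> Ox; apply: (@within_continuous_at _ _ (closure Omega) Omega) => //.
  apply: (@within_continuous_comp _ _ _ (fun x : V => (x, 0)) v _ (cylxt Omega)).
  - by move=> y _; exact: pair_continuous.
  - by move=> y cy; split => //=; rewrite in_itv/= lexx.
  - exact: sol_v_C0 sol.
exact: subset_closure.
Qed.

Section fixed_time.
Context (T L M : R).
Hypotheses (T0 : 0 < T) (L0 : 0 <= L).
Hypothesis vM : forall x t, closure Omega x -> 0 <= t <= T -> `|v (x, t)| <= M.
Hypothesis phiL : forall s, 0 < s -> s <= M -> phi s <= L * s.
Local Notation H := (weight C L K).
Let Y s := \int[mu]_(x in Omega) H (v (x, s)).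

Let v_pos x t : Omega x -> 0 < t -> 0 < v (x, t).
Proof. by move=> Ox t0; apply: (sol_v_gt0 sol); exact: cyl_cylx (cyl_slice Ox t0). Qed.

Let phi_weight x t : Omega x -> 0 < t <= T ->
  phi (v (x, t)) <= weight' C L K (v (x, t)) * v (x, t).
Proof.
move=> Ox /andP[t0 tT]; have vp := v_pos Ox t0.
have [vK|Kv] := leP (v (x, t)) (K + 1).
  apply: le_trans (phiC vp vK) _; apply: ler_wpM2r; first exact: ltW.
  exact: weight'_ge.
apply: (@le_trans _ _ (L * v (x, t))).
  apply: phiL => //; apply: le_trans (ler_norm _) _; apply: vM.
    exact: subset_closure.
  by rewrite ltW.
apply: ler_wpM2r; first exact: ltW.
by apply: weight'_geL; [exact: ltW|exact: L0|exact: ltW].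
Qed.

(** [B Y + sg X] is nonincreasing on [[s, T]], and [Y T >= 0]. *)
Lemma energy_controls_moment (sg s : R) : `|sg| = 1 -> 0 < s <= T ->
  sg * (X T - X s) <= B * Y s.
Proof.
move=> sg1 /andP[s0 sT].
have YT : 0 <= B * Y T.
  apply: mulr_ge0 => //; apply: Rintegral_ge0 => x Ox.
  by apply: weight_ge0; [exact: ltW|exact: L0|apply/ltW/v_pos].
suff : B * Y T + sg * X T <= B * Y s + sg * X s by lra.
apply: (@nonincreasing_of_derive_le0 _ (fun s => B * Y s + sg * X s)) => // r /andP[sr rT].
have r0 : 0 < r by exact: lt_le_trans sr.
have pw x : Omega x -> phi (v (x, r)) <= weight' C L K (v (x, r)) * v (x, r).
  by move=> Ox; apply: phi_weight; rewrite ?r0.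
have [D1 dD1 D1le] := energy_rate hO hphi (sol_u_C21 sol) (sol_v_C21 sol)
  (sol_u_gt0 sol) (sol_v_gt0 sol) (sol_eq_v sol) (sol_neumann_v sol) L0 r0 pw.
have [D2 dD2 D2le] := moment_rate hO hphi (sol_u_C21 sol) (sol_v_C21 sol)
  (sol_u_gt0 sol) (sol_v_gt0 sol) (sol_eq_u sol) r0 pw tp HB.
exists (B * D1 + sg * D2).
  exact (is_deriveD (@is_deriveZ _ _ _ Y B r 1 _ dD1) (@is_deriveZ _ _ _ X sg r 1 _ dD2)).
have : sg * D2 <= `|D2|.
  by apply: le_trans (ler_norm _) _; rewrite normrM sg1 mul1r.
move: (\int[mu]_(x in Omega) _) D1le D2le => W D1le D2le sD.
have := ler_wpM2l B0 D1le; lra.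
Qed.

(** [v] is continuous down to time 0, with values [v0 <= K] there, on which the energy
    density is linear. *)
Lemma energy_initial : (fun k : nat => Y (T / k.+2%:R)) @ \oo --> C * \int[mu]_(x in Omega) v0 x.
Proof.
have s0 k : 0 < T / k.+2%:R by rewrite divr_gt0.
have sT k : T / k.+2%:R <= T.
  by rewrite ler_pdivrMr// ler_peMr ?(ltW T0)// ler1n.
have cs := cvg_div_natS T.
have mv0' : measurable_fun Omega (fun x => v (x, 0)).
  by apply: continuous_on_open_measurable => // x; exact: slice0_continuous.
have mH (f : V -> R) : measurable_fun Omega f -> measurable_fun Omega (fun x => H (f x)).
  move=> mf; apply: (measurableT_comp _ mf); apply: continuous_measurable_fun.
  exact: continuous_weight.
have -> : C * \int[mu]_(x in Omega) v0 x = \int[mu]_(x in Omega) H (v (x, 0)).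
  have iv0 := ae_bounded_integrable hO mv0 v0K.
  rewrite -(RintegralZl _ mO iv0); apply: (ae_eq_Rintegral hO).
  - exact: measurable_funM.
  - exact: mH.
  - apply: filterS2 v0K (sol_init_v sol) => x vK vE Ox.
    by rewrite vE// weight_le_K// (le_trans (ler_norm _))// vK.
have M0 : 0 <= M.
  have [x Ox] := domain_nonempty hO.
  apply: le_trans (vM (subset_closure Ox) (t := T) _); first exact: normr_ge0.
  by rewrite lexx ltW.
apply: (@Rintegral_dominated _ _ _ mu Omega _ _ (fun=> C * M + L * M ^+ 4)) => //.
- move=> k; apply: mH; apply: continuous_on_open_measurable => // x Ox.
  have eV := within_extends (let: And5 c _ _ _ _ := sol_v_C21 sol in c).
  exact (slice_continuous hO (s0 k) eV Ox).
- exact: mH.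
- move=> x Ox.
  suff vc : (fun k : nat => v (x, T / k.+2%:R)) @ \oo --> v (x, 0).
    exact (cvg_comp _ _ vc (@continuous_weight R C L K (v (x, 0)))).
  have /subspace_continuousP vc := sol_v_C0 sol.
  have cx : cylxt Omega (x, 0).
    by split=> /=; [exact: subset_closure|rewrite in_itv/= lexx].
  apply: (@cvg_comp _ _ _ (fun k : nat => (x, T / k.+2%:R)) v _
    (within (cylxt Omega) (nbhs (x, 0 : R)))); last exact: vc.
  move=> A /= [[A1 A2] /= [nA1 nA2] sub].
  have := cs _ nA2; rewrite /= !nbhs_simpl/=; apply: filterS => k kA2.
  apply: (sub (x, T / k.+2%:R)); first by split=> //=; exact: nbhs_singleton.
  by split=> /=; [exact: subset_closure|rewrite in_itv/= andbT ltW].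
- apply: (@bounded_continuous_integrable _ _ _ _ `|C * M + L * M ^+ 4| oO bO) => // x _.
  exact: cst_continuous.
- move=> k x Ox; apply: weight_bound => //; [exact: ltW|].
  by apply: vM; [exact: subset_closure|rewrite ltW ?sT].
Qed.

End fixed_time.

Lemma test_fun_inLp_conj1 : inLp mu Omega (hoelder_conjugate 1%:E) psi.
Proof.
rewrite hoelder_conjugate1; have [N N0 HN] := test_fun_bounded tp.
by apply: (@inLpy_bounded _ _ _ psi N) => //; exact: test_fun_measurable.
Qed.

(** The initial value of [u] is attained weakly in [L^1], against bounded functions
    such as [psi]. *)
Lemma moment_initial T : 0 < T ->
  (fun k : nat => X (T / k.+2%:R)) @ \oo --> \int[mu]_(x in Omega) (u0 x * psi x).
Proof.
move=> T0; have [_ _ /(_ _ test_fun_inLp_conj1)] := sol_init_u sol (lexx 1).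
move=> /cvg_at_rightP; apply; split; first by move=> k; rewrite divr_gt0.
exact: cvg_div_natS.
Qed.

(** The solution is bounded by some [M] up to time [T]; the slope [L] that handles
    values up to [M + 1] disappears as the initial time tends to 0. *)
Lemma moment_drift_le T : 0 < T ->
  `|X T - \int[mu]_(x in Omega) (u0 x * psi x)| <= B * (C * \int[mu]_(x in Omega) v0 x).
Proof.
move=> T0.
have [|M M0 HM] := @bounded_on_slab _ _ _ hO v (cylxt Omega) 0 T (sol_v_C0 sol).
  by move=> [x t] [/= cx]; rewrite in_itv/= => /andP[t0 _]; split=> //=; rewrite in_itv/= t0.
have M1 : 0 < M + 1 by rewrite ltr_wpDl.
have [L /ltW L0 HL] := phi_linear_bound hphi M1.
have vM x t : closure Omega x -> 0 <= t <= T -> `|v (x, t)| <= M + 1.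
  by move=> cx tT; apply: le_trans (HM x t cx tT) _; rewrite lerDl.
have Xc := moment_initial T0; have Yc := energy_initial T0 L0 vM.
have key sg : `|sg| = 1 -> sg * (X T - \int[mu]_(x in Omega) (u0 x * psi x)) <=
    B * (C * \int[mu]_(x in Omega) v0 x).
  move=> sg1.
  have c1 : (fun k : nat => sg * (X T - X (T / k.+2%:R))) @ \oo -->
      sg * (X T - \int[mu]_(x in Omega) (u0 x * psi x)).
    exact (cvgM (cvg_cst sg) (cvgB (cvg_cst (X T)) Xc)).
  have c2 : (fun k : nat => B * \int[mu]_(x in Omega) weight C L K (v (x, T / k.+2%:R)))
      @ \oo --> B * (C * \int[mu]_(x in Omega) v0 x).
    exact (cvgM (cvg_cst B) Yc).
  apply: (ler_cvg_to c1 c2); apply: nearW => k.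
  apply: (energy_controls_moment T0 L0 vM HL sg1).
  by rewrite divr_gt0//= ler_pdivrMr// ler_peMr ?(ltW T0)// ler1n.
have := key 1 (normr1 _); have := key (-1) (normrN1 _).
rewrite mulN1r mul1r ler_norml [- (B * _) <= _]lerNl => -> -> //.
Qed.

End drift.

Unset Implicit Arguments.
Set Strict Implicit.
Set Printing Implicit Defensive.

Theorem theorem1p5 (R : realType) (n : nat) (hn : n = 1%N \/ n = 2%N)
    (Omega : set 'rV[R]_n) (hOmega : bounded_convex_smooth_domain Omega)
    (phi : R -> R) (hphi : admissible_phi phi)
    (u0 : 'rV[R]_n -> R) (hu0 : W1p Omega +oo%E u0)
    (hu0_ge0 : {ae lebesgue_rV n, forall x, Omega x -> 0 <= u0 x})
    (hu0_nonconst : ~ ae_const (lebesgue_rV n) Omega u0) :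
  forall K : R, 0 < K ->
  exists2 delta : R, 0 < delta &
  forall v0 : 'rV[R]_n -> R,
    W1p Omega +oo%E v0 ->
    {ae lebesgue_rV n, forall x, Omega x -> 0 <= v0 x} ->
    W1p Omega 2%:E (fun x => Num.sqrt (v0 x)) ->
    (0 < normLp (lebesgue_rV n) Omega +oo v0 <= K%:E)%E ->
    \int[lebesgue_rV n]_(x in Omega) v0 x <= delta ->
  forall (u v : 'rV[R]_n * R -> R) (uoo : 'rV[R]_n -> R),
    global_solution Omega phi u0 v0 u v ->
    large_time_limit Omega u uoo ->
    ~ ae_const (lebesgue_rV n) Omega uoo.
Proof.
move=> K K0; have mO : measurable Omega := open_measurable_rV (domain_open hOmega).
have [G0 [[mu0 u0fin] _ _]] := hu0.
have iu0 : (lebesgue_rV n).-integrable Omega (EFin \o u0).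
  apply: (@ae_bounded_integrable _ _ _ hOmega _
    (fine (normLp (lebesgue_rV n) Omega +oo u0))) => //.
  apply: normLpy_ae; rewrite fineK// ge0_fin_numE//; exact: Lnorm_ge0.
have [psi [tp psi0 m0]] := nonconst_test hOmega iu0 hu0_nonconst.
have [B B0 HB] := test_Lap_bounded tp.
have K1 : 0 < K + 1 by rewrite ltr_wpDl// ltW.
have [C C0 phiC] := phi_linear_bound hphi K1.
set m := \int[_]_(x in _) _ in m0.
have B1 : 0 < B + 1 by rewrite ltr_wpDl.
have BC : 0 < 2 * (B + 1) * C by rewrite !mulr_gt0.
(* chosen so that the drift [B * (C * delta)] is at most |m| / 2; [B + 1] guards
   against [B = 0] *)
exists (`|m| / (2 * (B + 1) * C)); first by rewrite divr_gt0// normr_gt0.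
move=> v0 [G [[mv0 _] _ _]] _ _ /andP[_ /normLpy_ae v0K] v0d u v uoo sol lim [c uc].
have drift t : 0 < t ->
    `|\int[lebesgue_rV n]_(x in Omega) (u (x, t) * psi x) - m| <= `|m| / 2.
  move=> t0; apply: le_trans (moment_drift_le hOmega hphi sol K0 C0 phiC mv0 v0K tp B0 HB t0) _.
  apply: (@le_trans _ _ (B * (C * (`|m| / (2 * (B + 1) * C))))).
    by apply: ler_wpM2l => //; apply: ler_wpM2l => //; exact: ltW.
  have -> : B * (C * (`|m| / (2 * (B + 1) * C))) = `|m| / 2 * (B / (B + 1)).
    by field; rewrite !gt_eqF.
  rewrite ler_piMr//.
  by rewrite ler_pdivrMr// mul1r lerDl.
have [_ [muoo _] /(_ _ (test_fun_inLp_conj1 hOmega tp))] := lim 1 (lexx 1).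
have -> : \int[lebesgue_rV n]_(x in Omega) (uoo x * psi x) = 0.
  transitivity (\int[lebesgue_rV n]_(x in Omega) (c * psi x)).
    apply: (ae_eq_Rintegral hOmega).
    - by apply: measurable_funM => //; exact: test_fun_measurable.
    - by apply: measurable_funM => //; exact: test_fun_measurable.
    - by apply: filterS uc => x H Ox; rewrite H.
  by rewrite (RintegralZl _ mO (test_fun_integrable hOmega tp)) psi0 mulr0.
have m2 : 0 < `|m| / 2 by rewrite divr_gt0// normr_gt0.
move=> /cvgrPdist_lt /(_ _ m2) lim0.
have [t [t0]] : exists t : R, 0 < t /\
    `|0 - \int[lebesgue_rV n]_(x in Omega) (u (x, t) * psi x)| < `|m| / 2.
  have [t [? ?]] := @filter_ex _ _ _ _ (filterI (nbhs_pinfty_gt (num_real 0)) lim0).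
  by exists t.
have := drift t t0; move: (Rintegral _ _ _) => X.
rewrite sub0r normrN => H1 H2.
by have := ler_distD X m 0; rewrite !subr0 distrC; lra.
Qed.
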